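(* Let $S$ be a smooth compact oriented surface of genus at least two, $\Sigma$ a marked conformal structure on $S$ with hyperbolic metric $h$, and $U$ a holomorphic cubic differential on $\Sigma$ with $\max_\Sigma\|U\|_h^2<\frac1{54}$. Then the Toledo invariant vanishes for the representation $\rho:\pi_1S\to SU(2,1)$ produced from $(\Sigma,U)$ (see context).
   Context: On $\mathbb C^3$ let $\langle u,v\rangle=u_1\bar v_1+u_2\bar v_2-u_3\bar v_3$, $W_-=\{u:\langle u,u\rangle<0\}$, $S_-=\{u:\langle u,u\rangle=-1\}$, $\mathbb{CH}^2=\mathbb PW_-$ with the Kähler structure obtained by identifying $T_{[u]}\mathbb{CH}^2$, $u\in S_-$, with $\{v:\langle v,u\rangle=0\}$ with metric $\mathrm{Re}\langle\,,\rangle$ and Kähler form $\omega=\mathrm{Im}\langle\,,\rangle$. Toledo invariant: for $\rho:\pi_1S\to SU(2,1)$ and any smooth $\rho$-equivariant map $\varphi:\tilde S\to\mathbb{CH}^2$, it is a normalised integral (a fixed nonzero constant times) $\int_S\varphi^*\omega$, where $\varphi^*\omega$ is descended to $S$; it is independent of $\varphi$. The representation: if locally $h=\gamma|dz|^2$ and $U=Q\,dz^3$, then $\|U\|_h^2=|Q|^2/\gamma^3$. There is a unique smooth solution $u:\Sigma\to\mathbb R$ of $\Delta_hu-16\|U\|_h^2e^{-2u}-2e^u+2=0$ satisfying $u\ge\frac13\log(16\max_\Sigma\|U\|_h^2)$ (no constraint if $U=0$). On the universal cover $\tilde\Sigma$ (the Poincaré disc with coordinate $z$), write $e^uh=2s^2|dz|^2$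 ($s>0$), $U=Q\,dz^3$ and $\alpha=A\,dz+B\,d\bar z$ with $$A=\begin{pmatrix}s^{-1}s_z & 0 & s \\ -Qs^{-2} & -s^{-1}s_z & 0 \\ 0 & s & 0\end{pmatrix},\quad B=\begin{pmatrix}-s^{-1}s_{\bar z} & \bar Qs^{-2} & 0 \\ 0 & s^{-1}s_{\bar z} & s \\ s & 0 & 0\end{pmatrix}.$$ There is $F:\tilde\Sigma\to SU(2,1)$, unique up to left multiplication by a constant, with $F^{-1}dF=\alpha$, and $\rho$ is the representation with $F(\gamma z)=\rho(\gamma)F(z)c_\gamma(z)^{-1}$, $c_\gamma=\mathrm{diag}(\gamma'/|\gamma'|,\overline{\gamma'}/|\gamma'|,1)$, for deck transformations $\gamma$. *)

(* Defs.v *)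
From HB Require Import structures.
From mathcomp Require Import all_boot all_order all_algebra.
From mathcomp Require Import all_classical all_reals all_analysis.
From mathcomp Require Import complex.

Set Implicit Arguments.
Unset Strict Implicit.
Unset Printing Implicit Defensive.

Import Order.TTheory GRing.Theory Num.Theory.
Import numFieldNormedType.Exports.
Local Open Scope classical_set_scope.
Local Open Scope ring_scope.
Local Open Scope complex_scope.

Section Calculus.
Variable R : realType.
Local Notation C := R[i].
Implicit Types (f : C -> R) (Q : C -> C) (z : C).

Definition sqmod z : R := complex.Re z ^+ 2 + complex.Im z ^+ 2.

Definition disc : set C := [set z | sqmod z < 1].

(* Partial derivatives in the coordinates z = x + i y. *)
Definition dx f z : R :=
  derive1 (fun t : R => f (t +i* complex.Im z)) (complex.Re z).
Definition dy f z : R :=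
  derive1 (fun t : R => f (complex.Re z +i* t)) (complex.Im z).

Fixpoint Ck (n : nat) f : Prop :=
  (forall z, disc z ->
     {for (complex.Re z, complex.Im z),
        continuous (fun p : R * R => f (p.1 +i* p.2))}) /\
  match n with
  | 0 => True
  | m.+1 =>
      [/\ forall z, disc z ->
            derivable (fun t : R => f (t +i* complex.Im z)) (complex.Re z) 1,
          forall z, disc z ->
            derivable (fun t : R => f (complex.Re z +i* t)) (complex.Im z) 1,
          Ck m (dx f) & Ck m (dy f)]
  end.

Definition smooth f : Prop := forall n, Ck n f.

Definition smoothC Q : Prop :=
  smooth (fun z => complex.Re (Q z)) /\ smooth (fun z => complex.Im (Q z)).

Definition smoothM m n (F : C -> 'M[C]_(m, n)) : Prop :=
  forall i j, smoothC (fun z => F z i j).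

Definition dxC Q z : C :=
  dx (fun w => complex.Re (Q w)) z +i* dx (fun w => complex.Im (Q w)) z.
Definition dyC Q z : C :=
  dy (fun w => complex.Re (Q w)) z +i* dy (fun w => complex.Im (Q w)) z.

(* The Wirtinger operators; [dz Q] is the complex derivative of a holomorphic Q. *)
Definition dz Q z : C := (dxC Q z - (0 +i* 1) * dyC Q z) / 2.
Definition dzbar Q z : C := (dxC Q z + (0 +i* 1) * dyC Q z) / 2.

Definition mxderiv (D : (C -> C) -> C -> C) m n (F : C -> 'M[C]_(m, n)) z :
    'M[C]_(m, n) :=
  \matrix_(i, j) D (fun w => F w i j) z.

Definition holomorphic Q : Prop :=
  smoothC Q /\ forall z, disc z -> dzbar Q z = 0.

End Calculus.

(* A compact oriented surface S with a marked conformal structure Sigma, whose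
   hyperbolic metric has curvature -1, is given by its universal cover: the
   group pi_1 S acts on the Poincare disc by orientation-preserving isometries
   (elements of PU(1,1)), freely, properly discontinuously and cocompactly, and
   Sigma is the quotient.  By uniformisation these are exactly the surfaces of
   genus at least two.  Compact subsets of the disc are exhausted by the closed
   discs |z|^2 <= r with r < 1. *)
Record marked_surface (R : realType) := MarkedSurface {
  pi1 : groupType;
  deck : pi1 -> R[i] -> R[i];
  deck_isometry : forall g, exists a b : R[i],
    a * conjc a - b * conjc b = 1 /\
    forall z, disc z -> deck g z = (a * z + b) / (conjc b * z + conjc a);
  deck1 : forall z, disc z -> deck 1%g z = z;
  deckM : forall g k z, disc z -> deck (g * k)%g z = deck g (deck k z);
  deck_free : forall g z, disc z -> deck g z = z -> g = 1%g;
  deck_proper : forall r : R, r < 1 ->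
    finite_set [set g | exists z, sqmod z <= r /\ sqmod (deck g z) <= r];
  deck_cocompact : exists2 r : R, r < 1 &
    forall z, disc z -> exists g, sqmod (deck g z) <= r
}.

Section Surface.
Variables (R : realType) (Sigma : marked_surface R).
Local Notation C := R[i].
Local Notation act := (@deck R Sigma).

(* The hyperbolic metric is h = gamma_h |dz|^2, with Laplacian (4/gamma_h) d_z d_zbar. *)
Definition gamma_h (z : C) : R := 4 / (1 - sqmod z) ^+ 2.

Definition laplace_h (u : C -> R) (z : C) : R :=
  (dx (dx u) z + dy (dy u) z) / gamma_h z.

(* Q is the coefficient of the lift U = Q dz^3 to the disc. *)
Definition cubic_differential (Q : C -> C) : Prop :=
  holomorphic Q /\
  forall g z, disc z -> Q (act g z) * dz (act g) z ^+ 3 = Q z.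

Definition normU2 (Q : C -> C) (z : C) : R := sqmod (Q z) / gamma_h z ^+ 3.

(* For a cubic differential on Sigma this supremum is finite and attained,
   since [normU2 Q] is continuous and invariant under a cocompact action. *)
Definition max_normU2 (Q : C -> C) : R := sup [set normU2 Q z | z in @disc R].

(* The integral over S of an invariant 2-form f dx /\ dy on the disc, computed on
   the Dirichlet polygon centred at 0: since the hyperbolic distance to 0 is an
   increasing function of the modulus, it is cut out by |z| <= |g z|. *)
Definition dirichlet : set C :=
  [set z | disc z /\ forall g, sqmod z <= sqmod (act g z)].

Definition surface_integral (f : C -> R) : R :=
  Rintegral (@lebesgue_measure R \x @lebesgue_measure R)%E
    [set p : R * R | dirichlet (p.1 +i* p.2)]
    (fun p => f (p.1 +i* p.2)).

Definition herm (u v : 'cV[C]_3) : C :=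
  u 0 0 * conjc (v 0 0) + u 1 0 * conjc (v 1 0) - u ord_max 0 * conjc (v ord_max 0).

Definition Sminus : set 'cV[C]_3 := [set u | herm u u = -1].

Definition SU21 : set 'M[C]_3 :=
  [set g | (forall u v, herm (g *m u) (g *m v) = herm u v) /\ \det g = 1].

Definition representation (rho : pi1 Sigma -> 'M[C]_3) : Prop :=
  (forall g, SU21 (rho g)) /\ forall g k, rho (g * k)%g = rho g *m rho k.

(* The point [u] of the projective plane, as the set of nonzero multiples of u;
   CH^2 consists of the points [u] with u in S_-. *)
Definition proj (u : 'cV[C]_3) : set 'cV[C]_3 :=
  [set v | exists2 c : C, c != 0 & v = c *: u].

(* A map phi from the disc to CH^2 is smooth iff it has a smooth lift to S_-,
   because S_- -> CH^2 has a global smooth section: take u_3 > 0. *)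
Definition smooth_lift (phi : C -> set 'cV[C]_3) (u : C -> 'cV[C]_3) : Prop :=
  smoothM u /\ forall z, disc z -> Sminus (u z) /\ phi z = proj (u z).

Definition equivariant (rho : pi1 Sigma -> 'M[C]_3) (phi : C -> set 'cV[C]_3) :
    Prop :=
  forall g z, disc z -> phi (act g z) = [set rho g *m v | v in phi z].

(* The differential of u |-> [u] at u in S_- sends v to its component in
   {v : <v, u> = 0}. *)
Definition horizontal (u v : 'cV[C]_3) : 'cV[C]_3 := v + herm v u *: u.

(* The coefficient of dx /\ dy in phi^* omega, for a lift u of phi to S_-. *)
Definition pullback_omega (u : C -> 'cV[C]_3) (z : C) : R :=
  complex.Im (herm (horizontal (u z) (mxderiv (@dxC R) u z))
                   (horizontal (u z) (mxderiv (@dyC R) u z))).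

(* tau is the Toledo invariant of rho, with normalising constant c; that every
   smooth equivariant map gives the same value is part of the definition. *)
Definition toledo_invariant (c : R) (rho : pi1 Sigma -> 'M[C]_3) (tau : R) :
    Prop :=
  (exists phi u, smooth_lift phi u /\ equivariant rho phi) /\
  forall phi u, smooth_lift phi u -> equivariant rho phi ->
    tau = c * surface_integral (pullback_omega u).

Definition selected_solution (Q : C -> C) (u : C -> R) : Prop :=
  [/\ smooth u,
      forall g z, disc z -> u (act g z) = u z,
      forall z, disc z ->
        laplace_h u z - 16 * normU2 Q z * expR (- 2 * u z)
          - 2 * expR (u z) + 2 = 0
    & (exists2 z, disc z & Q z != 0) ->
      forall z, disc z -> 3^-1 * ln (16 * max_normU2 Q) <= u z].

Section Connection.
Variables (s : C -> R) (Q : C -> C).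

Let s_ (z : C) : C := (s z)%:C.

Definition A_mx (z : C) : 'M[C]_3 :=
  \matrix_(i, j) nth 0 (nth [::]
    [:: [:: dz s_ z / s_ z; 0; s_ z];
        [:: - Q z / s_ z ^+ 2; - (dz s_ z / s_ z); 0];
        [:: 0; s_ z; 0]] i) j.

Definition B_mx (z : C) : 'M[C]_3 :=
  \matrix_(i, j) nth 0 (nth [::]
    [:: [:: - (dzbar s_ z / s_ z); conjc (Q z) / s_ z ^+ 2; 0];
        [:: 0; dzbar s_ z / s_ z; s_ z];
        [:: s_ z; 0; 0]] i) j.

(* F^-1 dF = A dz + B dzbar *)
Definition frame (F : C -> 'M[C]_3) : Prop :=
  [/\ smoothM F,
      forall z, disc z -> SU21 (F z),
      forall z, disc z -> invmx (F z) *m mxderiv (@dz R) F z = A_mx z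
    & forall z, disc z -> invmx (F z) *m mxderiv (@dzbar R) F z = B_mx z].

End Connection.

(* e^u h = 2 s^2 |dz|^2 *)
Definition s_of (u : C -> R) (z : C) : R :=
  Num.sqrt (expR (u z) * gamma_h z / 2).

Definition c_mx (g : pi1 Sigma) (z : C) : 'M[C]_3 :=
  let g' := dz (act g) z in
  diag_mx (\row_j nth 0 [:: g' / `|g'|; conjc g' / `|g'|; 1] j).

Definition produced_from (Q : C -> C) (rho : pi1 Sigma -> 'M[C]_3) : Prop :=
  representation rho /\
  exists (u : C -> R) (F : C -> 'M[C]_3),
    [/\ selected_solution Q u, frame (s_of u) Q F
      & forall g z, disc z ->
          F (act g z) = rho g *m F z *m invmx (c_mx g z)].

End Surface.

(* Main.v *)
Require Import Defs.
From mathcomp Require Import all_boot all_order all_algebra.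
From mathcomp Require Import all_classical all_reals all_analysis.
From mathcomp Require Import measurable_realfun complex ring lra.

(** The last column f of the frame F lifts a rho-equivariant map to CH^2, and the
    last columns s e1 of A and s e2 of B show that this map is Lagrangian: its
    pullback of omega vanishes.  Any equivariant map with lift u has
    <f, u> <> 0, because both vectors are negative, and the imaginary part eta of
      <du, u> - <df, f> - d log <f, u>
    is an invariant 1-form on the disc, whose exterior derivative is -2 u^* omega.
    It remains to integrate an exact form over the surface.  With
    m(z) = max(0, r - |z|^2), the functions chi_N = m^N / \sum_g (m o g)^N are
    compactly supported and their translates sum to 1, so the integral of
    chi_N d eta over the disc vanishes by Stokes and by the invariance of the
    integral under disc automorphisms.  As N tends to infinity, chi_N tends to the
    indicator of the Dirichlet polygon, off a null set of circles. *)

Set Implicit Arguments.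
Unset Strict Implicit.
Unset Printing Implicit Defensive.

Import Order.TTheory GRing.Theory Num.Theory.
Import numFieldNormedType.Exports.
Local Open Scope classical_set_scope.
Local Open Scope ring_scope.
Local Open Scope complex_scope.

Local Notation Re := complex.Re.
Local Notation Im := complex.Im.

(** * Real functions of class C^n on the disc *)

Section DiscCalculus.
Variable R : realType.
Local Notation C := R[i].
Implicit Types (f g : C -> R) (z w : C) (P Q : C -> C).

(** The form eta compares the connection forms of the tautological line along two maps. The lift u
    of an arbitrary equivariant map is equivariant only up to a phase, which changes [<du, u>];
    since [<f, u>] never vanishes, its logarithmic derivative absorbs this change, and no homotopy
    between the two maps is required. The pullback by u is only known to be smooth on the open disc
    and may be unbounded near the circle, so Stokes is applied only to forms multiplied by a
    compactly supported function. Powers of m select the polygon because m decreases with |z|: for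
    large N the term of z dominates its orbit sum when |z| is strictly smallest on the orbit. No
    description of the sides of the polygon and of their pairing enters. The exponents start at 3,
    so that each chi_N is of class C^2. The invariance of the integral under a disc automorphism
    comes from a deformation: the automorphism is joined to the identity by a path of Moebius maps,
    and the time derivative of the pulled-back integral is the integral of a divergence, hence
    zero. *)

Definition cont_at f z : Prop :=
  {for (Re z, Im z), continuous (fun p : R * R => f (p.1 +i* p.2))}.

(** Stated as a relation with the value, so that one fact carries both differentiability and the
    formula for the derivative. *)
Definition is_dx f z (d : R) : Prop :=
  is_derive (Re z) 1 (fun t : R => f (t +i* Im z)) d.
Definition is_dy f z (d : R) : Prop :=
  is_derive (Im z) 1 (fun t : R => f (Re z +i* t)) d.

Definition nearC z (A : C -> Prop) : Prop :=
  \forall p \near (Re z, Im z), A (p.1 +i* p.2).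

Lemma nearC_refl z A : nearC z A -> A z.
Proof. by case: z => x y /nbhs_singleton. Qed.

Lemma nearC_x z A : nearC z A -> \forall t \near Re z, A (t +i* Im z).
Proof.
move=> zA; suff h : (fun t : R => (t, Im z)) @ Re z --> (Re z, Im z) by exact: h zA.
by apply: (@cvg_pair _ _ _ _ (nbhs (Re z)) (nbhs (Im z))); [exact: cvg_id|exact: cvg_cst].
Qed.

Lemma nearC_y z A : nearC z A -> \forall t \near Im z, A (Re z +i* t).
Proof.
move=> zA; suff h : (fun t : R => (Re z, t)) @ Im z --> (Re z, Im z) by exact: h zA.
by apply: (@cvg_pair _ _ _ _ (nbhs (Re z)) (nbhs (Im z))); [exact: cvg_cst|exact: cvg_id].
Qed.

Lemma nearC_near z A : nearC z A -> nearC z (fun w => nearC w A).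
Proof.
move=> zA; have := nbhs_interior zA; rewrite /nearC /=.
by apply: filterS => -[x y].
Qed.

Lemma is_dx_val f z d : is_dx f z d -> dx f z = d.
Proof. by move=> h; rewrite /dx derive1E (@derive_val _ _ _ _ _ _ _ h). Qed.

Lemma is_dy_val f z d : is_dy f z d -> dy f z = d.
Proof. by move=> h; rewrite /dy derive1E (@derive_val _ _ _ _ _ _ _ h). Qed.

Lemma is_dx_near f g z d : nearC z (fun w => f w = g w) -> is_dx f z d -> is_dx g z d.
Proof.
move=> /nearC_x fg; exact: near_eq_is_derive.
Qed.

Lemma is_dy_near f g z d : nearC z (fun w => f w = g w) -> is_dy f z d -> is_dy g z d.
Proof.
move=> /nearC_y fg; exact: near_eq_is_derive.
Qed.

Lemma cont_at_near f g z : nearC z (fun w => f w = g w) -> cont_at f z -> cont_at g z.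
Proof.
rewrite /cont_at /prop_for /continuous_at => fg.
have -> : f ((Re z, Im z).1 +i* (Re z, Im z).2) = g ((Re z, Im z).1 +i* (Re z, Im z).2).
  by have := nearC_refl fg; case: z {fg} => x y.
apply: cvg_trans; apply: near_eq_cvg; exact: fg.
Qed.

Lemma dx_near f g z : nearC z (fun w => f w = g w) -> dx f z = dx g z.
Proof.
by move=> /nearC_x fg; rewrite /dx !derive1E; apply: near_eq_derive.
Qed.

Lemma dy_near f g z : nearC z (fun w => f w = g w) -> dy f z = dy g z.
Proof.
by move=> /nearC_y fg; rewrite /dy !derive1E; apply: near_eq_derive.
Qed.

Lemma cont_Re z : cont_at (@Re R) z.
Proof. exact: (@cvg_fst _ _ (nbhs (Re z)) (nbhs (Im z))). Qed.

Lemma cont_Im z : cont_at (@Im R) z.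
Proof. exact: (@cvg_snd _ _ (nbhs (Re z)) (nbhs (Im z))). Qed.

Lemma cont_cst (c : R) z : cont_at (fun=> c) z.
Proof. exact: cvg_cst. Qed.

Lemma contD f g z : cont_at f z -> cont_at g z -> cont_at (fun w => f w + g w) z.
Proof. exact: cvgD. Qed.

Lemma contN f z : cont_at f z -> cont_at (fun w => - f w) z.
Proof. exact: cvgN. Qed.

Lemma contM f g z : cont_at f z -> cont_at g z -> cont_at (fun w => f w * g w) z.
Proof. exact: cvgM. Qed.

Lemma contV f z : f z != 0 -> cont_at f z -> cont_at (fun w => (f w)^-1) z.
Proof. by case: z => x y fz; exact: cvgV. Qed.

Lemma contX f n z : cont_at f z -> cont_at (fun w => f w ^+ n) z.
Proof.
move=> cf; elim: n => [|n IH]; first exact: cont_cst.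
under [X in cont_at X]funext => w do rewrite exprS.
exact (contM cf IH).
Qed.

Lemma cont_sqmod z : cont_at (@sqmod R) z.
Proof. by apply: contD; apply: contX; [exact: cont_Re|exact: cont_Im]. Qed.

Lemma cont_lt f z (c : R) : cont_at f z -> f z < c -> nearC z (fun w => f w < c).
Proof. by case: z => x y cf fz; exact: (cvgr_lt _ cf). Qed.

Lemma cont_gt f z (c : R) : cont_at f z -> c < f z -> nearC z (fun w => c < f w).
Proof. by case: z => x y cf fz; exact: (cvgr_gt _ cf). Qed.

Lemma disc_near z : disc z -> nearC z (@disc R).
Proof. by move=> dz; apply: cont_lt dz; exact: cont_sqmod. Qed.

Lemma eq_disc_near f g z :
  (forall w, disc w -> f w = g w) -> disc z -> nearC z (fun w => f w = g w).
Proof. by move=> fg /disc_near; apply: filterS => p /fg. Qed.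

Lemma is_dx_cst (c : R) z : is_dx (fun=> c) z 0.
Proof. exact: is_derive_cst. Qed.
Lemma is_dy_cst (c : R) z : is_dy (fun=> c) z 0.
Proof. exact: is_derive_cst. Qed.
Lemma is_dx_Re z : is_dx (@Re R) z 1.
Proof. exact: is_derive_id. Qed.
Lemma is_dy_Re z : is_dy (@Re R) z 0.
Proof. exact: is_derive_cst. Qed.
Lemma is_dx_Im z : is_dx (@Im R) z 0.
Proof. exact: is_derive_cst. Qed.
Lemma is_dy_Im z : is_dy (@Im R) z 1.
Proof. exact: is_derive_id. Qed.

Lemma is_dxD f g z a b : is_dx f z a -> is_dx g z b -> is_dx (fun w => f w + g w) z (a + b).
Proof. by move=> fa gb; exact: is_deriveD. Qed.
Lemma is_dyD f g z a b : is_dy f z a -> is_dy g z b -> is_dy (fun w => f w + g w) z (a + b).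
Proof. by move=> fa gb; exact: is_deriveD. Qed.
Lemma is_dxN f z a : is_dx f z a -> is_dx (fun w => - f w) z (- a).
Proof. by move=> fa; exact: is_deriveN. Qed.
Lemma is_dyN f z a : is_dy f z a -> is_dy (fun w => - f w) z (- a).
Proof. by move=> fa; exact: is_deriveN. Qed.

Lemma is_dxM f g z a b : is_dx f z a -> is_dx g z b ->
  is_dx (fun w => f w * g w) z (a * g z + f z * b).
Proof.
move=> fa gb; apply: is_derive_eq (is_deriveM fa gb) _.
by case: z {fa gb} => x y /=; rewrite /GRing.scale/= addrC (mulrC a).
Qed.
Lemma is_dyM f g z a b : is_dy f z a -> is_dy g z b ->
  is_dy (fun w => f w * g w) z (a * g z + f z * b).
Proof.
move=> fa gb; apply: is_derive_eq (is_deriveM fa gb) _.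
by case: z {fa gb} => x y /=; rewrite /GRing.scale/= addrC (mulrC a).
Qed.

Lemma is_deriveV1 (h : R -> R) x a : h x != 0 -> is_derive x 1 h a ->
  is_derive x 1 (fun t => (h t)^-1) (- a / h x ^+ 2).
Proof.
move=> h0 ha; apply: DeriveDef; first exact: derivableV.
by rewrite deriveV// derive_val /GRing.scale/= !mulNr mulrC.
Qed.

Lemma is_dxV f z a : f z != 0 -> is_dx f z a -> is_dx (fun w => (f w)^-1) z (- a / f z ^+ 2).
Proof. by case: z => x y fz fa; exact: (is_deriveV1 fz fa). Qed.
Lemma is_dyV f z a : f z != 0 -> is_dy f z a -> is_dy (fun w => (f w)^-1) z (- a / f z ^+ 2).
Proof. by case: z => x y fz fa; exact: (is_deriveV1 fz fa). Qed.

Lemma derivable_dx f z :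
  derivable (fun t : R => f (t +i* Im z)) (Re z) 1 -> is_dx f z (dx f z).
Proof. by move=> h; apply: (DeriveDef h); rewrite -derive1E. Qed.
Lemma derivable_dy f z :
  derivable (fun t : R => f (Re z +i* t)) (Im z) 1 -> is_dy f z (dy f z).
Proof. by move=> h; apply: (DeriveDef h); rewrite -derive1E. Qed.

Lemma Ck_cont n f z : Ck n f -> disc z -> cont_at f z.
Proof. by case: n => [|n] [h _] dz; exact: h. Qed.

Lemma CkS_dx n f z : Ck n.+1 f -> disc z -> is_dx f z (dx f z).
Proof. by move=> [_ [h _ _ _]] dz; apply: derivable_dx; exact: h. Qed.
Lemma CkS_dy n f z : Ck n.+1 f -> disc z -> is_dy f z (dy f z).
Proof. by move=> [_ [_ h _ _]] dz; apply: derivable_dy; exact: h. Qed.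
Lemma Ck_dx n f : Ck n.+1 f -> Ck n (dx f).
Proof. by case=> _ [_ _ h1 h2]. Qed.
Lemma Ck_dy n f : Ck n.+1 f -> Ck n (dy f).
Proof. by case=> _ [_ _ h1 h2]. Qed.

(** The disc is open: equality on it holds near each of its points and therefore passes to the
    partial derivatives. *)
Lemma Ck_eq n f g : (forall z, disc z -> f z = g z) -> Ck n f -> Ck n g.
Proof.
elim: n f g => [|n IH] f g fg cf.
  split; [move=> z dz|exact I]; apply: cont_at_near (Ck_cont cf dz).
  exact: eq_disc_near.
split=> [z dz|].
  by apply: cont_at_near (Ck_cont cf dz); exact: eq_disc_near.
split.
- by move=> z dz; have [] := is_dx_near (eq_disc_near fg dz) (CkS_dx cf dz).
- by move=> z dz; have [] := is_dy_near (eq_disc_near fg dz) (CkS_dy cf dz).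
- by apply: IH (Ck_dx cf) => z dz; apply: dx_near; exact: eq_disc_near.
- by apply: IH (Ck_dy cf) => z dz; apply: dy_near; exact: eq_disc_near.
Qed.

Lemma CkW n f : Ck n.+1 f -> Ck n f.
Proof.
elim: n f => [|n IH] f [cf [h1 h2 h3 h4]]; first exact (conj cf I).
exact (conj cf (And4 h1 h2 (IH _ h3) (IH _ h4))).
Qed.

Lemma Ck_le m n f : (m <= n)%N -> Ck n f -> Ck m f.
Proof.
elim: n => [|n IH]; first by rewrite leqn0 => /eqP ->; exact (fun h => h).
by rewrite leq_eqVlt => /predU1P[-> h|]; [exact h|rewrite ltnS => mn /CkW; exact: IH].
Qed.

(** The closure properties below are inductions through this criterion: the explicit partial
    derivatives [fx] and [fy] are again built by the operations under study. *)
Lemma CkS_intro n f fx fy :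
  (forall z, disc z -> cont_at f z) ->
  (forall z, disc z -> is_dx f z (fx z)) -> (forall z, disc z -> is_dy f z (fy z)) ->
  Ck n fx -> Ck n fy -> Ck n.+1 f.
Proof.
move=> cf dfx dfy cfx cfy; split; first exact cf; split.
- by move=> z /dfx [].
- by move=> z /dfy [].
- by apply: Ck_eq cfx => z dz; rewrite (is_dx_val (dfx _ dz)).
- by apply: Ck_eq cfy => z dz; rewrite (is_dy_val (dfy _ dz)).
Qed.

Lemma Ck_cst n (c : R) : Ck n (fun=> c).
Proof.
elim: n c => [|n IH] c; first exact (conj (fun z _ => @cont_cst c z) I).
apply: (@CkS_intro _ _ (fun=> 0) (fun=> 0)); [move=> z _..|exact: IH|exact: IH].
- exact: cont_cst.
- exact: is_dx_cst.
- exact: is_dy_cst.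
Qed.

Lemma Ck_Re n : Ck n (@Re R).
Proof.
case: n => [|n]; first exact (conj (fun z _ => @cont_Re z) I).
apply: (@CkS_intro _ _ (fun=> 1) (fun=> 0)); [move=> z _|move=> z _|move=> z _|exact: Ck_cst|exact: Ck_cst].
- exact: cont_Re.
- exact: is_dx_Re.
- exact: is_dy_Re.
Qed.

Lemma Ck_Im n : Ck n (@Im R).
Proof.
case: n => [|n]; first exact (conj (fun z _ => @cont_Im z) I).
apply: (@CkS_intro _ _ (fun=> 0) (fun=> 1)); [move=> z _|move=> z _|move=> z _|exact: Ck_cst|exact: Ck_cst].
- exact: cont_Im.
- exact (is_dx_Im z).
- exact (is_dy_Im z).
Qed.

Lemma CkD n f g : Ck n f -> Ck n g -> Ck n (fun z => f z + g z).
Proof.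
elim: n f g => [|n IH] f g cf cg.
  split; [move=> z dz|exact I]; exact (contD (Ck_cont cf dz) (Ck_cont cg dz)).
apply: (@CkS_intro _ _ (fun z => dx f z + dx g z) (fun z => dy f z + dy g z)) => [z dz|z dz|z dz||].
- exact (contD (Ck_cont cf dz) (Ck_cont cg dz)).
- exact (is_dxD (CkS_dx cf dz) (CkS_dx cg dz)).
- exact (is_dyD (CkS_dy cf dz) (CkS_dy cg dz)).
- by apply: IH; exact: Ck_dx.
- by apply: IH; exact: Ck_dy.
Qed.

Lemma CkN n f : Ck n f -> Ck n (fun z => - f z).
Proof.
elim: n f => [|n IH] f cf.
  split; [move=> z dz|exact I]; exact (contN (Ck_cont cf dz)).
apply: (@CkS_intro _ _ (fun z => - dx f z) (fun z => - dy f z)) => [z dz|z dz|z dz||].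
- exact (contN (Ck_cont cf dz)).
- exact (is_dxN (CkS_dx cf dz)).
- exact (is_dyN (CkS_dy cf dz)).
- by apply: IH; exact: Ck_dx.
- by apply: IH; exact: Ck_dy.
Qed.

Lemma CkB n f g : Ck n f -> Ck n g -> Ck n (fun z => f z - g z).
Proof. by move=> cf cg; apply: (CkD cf); exact: CkN. Qed.

Lemma CkM n f g : Ck n f -> Ck n g -> Ck n (fun z => f z * g z).
Proof.
elim: n f g => [|n IH] f g cf cg.
  split; [move=> z dz|exact I]; exact (contM (Ck_cont cf dz) (Ck_cont cg dz)).
apply: (@CkS_intro _ _ (fun z => dx f z * g z + f z * dx g z)
  (fun z => dy f z * g z + f z * dy g z)) => [z dz|z dz|z dz||].
- exact (contM (Ck_cont cf dz) (Ck_cont cg dz)).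
- exact (is_dxM (CkS_dx cf dz) (CkS_dx cg dz)).
- exact (is_dyM (CkS_dy cf dz) (CkS_dy cg dz)).
- by apply: CkD; apply: IH; by [exact: Ck_dx|exact: CkW].
- by apply: CkD; apply: IH; by [exact: Ck_dy|exact: CkW].
Qed.

Lemma CkX n f k : Ck n f -> Ck n (fun z => f z ^+ k).
Proof.
move=> cf; elim: k => [|k IH]; first exact: Ck_cst.
by under [X in Ck _ X]funext => w do rewrite exprS; exact: CkM.
Qed.

Lemma CkV n f : (forall z, disc z -> f z != 0) -> Ck n f -> Ck n (fun z => (f z)^-1).
Proof.
move=> f0; elim: n => [|n IH] cf.
  split; [move=> z dz|exact I]; apply: contV; [exact: f0|exact (Ck_cont cf dz)].
apply: (@CkS_intro _ _ (fun z => - dx f z * (f z)^-1 ^+ 2) (fun z => - dy f z * (f z)^-1 ^+ 2)) => [z dz|z dz|z dz||].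
- apply: contV; [exact: f0|exact (Ck_cont cf dz)].
- by rewrite exprVn; apply: is_dxV; [exact: f0|exact (CkS_dx cf dz)].
- by rewrite exprVn; apply: is_dyV; [exact: f0|exact (CkS_dy cf dz)].
- by apply: CkM; [apply: CkN; exact: Ck_dx|apply: CkX; apply: IH; exact: CkW].
- by apply: CkM; [apply: CkN; exact: Ck_dy|apply: CkX; apply: IH; exact: CkW].
Qed.

Lemma Ck_sum (I : Type) (s : seq I) n (F : I -> C -> R) :
  (forall i, Ck n (F i)) -> Ck n (fun z => \sum_(i <- s) F i z).
Proof.
move=> cF; elim: s => [|i s IH].
  by under [X in Ck _ X]funext => w do rewrite big_nil; exact: Ck_cst.
by under [X in Ck _ X]funext => w do rewrite big_cons; exact: CkD.
Qed.

(** Serves the sums over the whole deck group, which reduce to a fixed finite sum only locally. *)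
Lemma Ck_local n f :
  (forall z, disc z -> exists2 g, Ck n g & nearC z (fun w => g w = f w)) -> Ck n f.
Proof.
elim: n f => [|n IH] f h.
  split; [move=> z dz|exact I]; have [g cg gf] := h z dz; apply: cont_at_near gf (Ck_cont cg dz).
apply: (@CkS_intro _ _ (dx f) (dy f)) => [z dz|z dz|z dz||].
- by have [g cg gf] := h z dz; apply: cont_at_near gf (Ck_cont cg dz).
- have [g cg gf] := h z dz; have := is_dx_near gf (CkS_dx cg dz).
  by move=> k; rewrite (is_dx_val k).
- have [g cg gf] := h z dz; have := is_dy_near gf (CkS_dy cg dz).
  by move=> k; rewrite (is_dy_val k).
- apply: IH => z dz; have [g cg gf] := h z dz; exists (dx g); first exact: Ck_dx.
  by have := nearC_near gf; apply: filterS => p /dx_near.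
- apply: IH => z dz; have [g cg gf] := h z dz; exists (dy g); first exact: Ck_dy.
  by have := nearC_near gf; apply: filterS => p /dy_near.
Qed.

End DiscCalculus.

#[local] Opaque dx dy.

(** * Differentiability, the chain rule and the symmetry of second derivatives *)

Section ChainRule.
Variable R : realType.
Local Notation C := R[i].
Implicit Types (f g : C -> R) (z w : C) (P Q : C -> C).

Lemma nearC_box z (A : C -> Prop) : nearC z A ->
  exists2 r : R, 0 < r & forall x y, `|x - Re z| < r -> `|y - Im z| < r -> A (x +i* y).
Proof.
move=> /nbhs_ballP[r /= r0 zA]; exists r => // x y hx hy.
by apply: (zA (x, y)); split; rewrite /ball /= distrC.
Qed.

Lemma disc_MVT_x f x1 x2 y : Ck 1 f -> x1 < x2 ->
  (forall x, x1 <= x <= x2 -> disc (x +i* y)) ->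
  exists2 t, x1 < t < x2 & f (x2 +i* y) - f (x1 +i* y) = dx f (t +i* y) * (x2 - x1).
Proof.
move=> cf x12 h.
have hd x : x1 <= x <= x2 -> is_derive x 1 (fun t => f (t +i* y)) (dx f (x +i* y)).
  by move=> hx; exact: (CkS_dx cf (h x hx)).
have [] := @MVT _ (fun t => f (t +i* y)) (fun t => dx f (t +i* y)) x1 x2 x12.
- by move=> x; rewrite in_itv /= => /andP[a b]; apply: hd; rewrite !ltW.
- apply: derivable_within_continuous => x; rewrite in_itv /= => hx.
  by have [] := hd x hx.
- by move=> t; rewrite in_itv /= => ht e; exists t.
Qed.

Lemma disc_MVT_y f x y1 y2 : Ck 1 f -> y1 < y2 ->
  (forall y, y1 <= y <= y2 -> disc (x +i* y)) ->
  exists2 t, y1 < t < y2 & f (x +i* y2) - f (x +i* y1) = dy f (x +i* t) * (y2 - y1).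
Proof.
move=> cf y12 h.
have hd y : y1 <= y <= y2 -> is_derive y 1 (fun t => f (x +i* t)) (dy f (x +i* y)).
  by move=> hy; exact: (CkS_dy cf (h y hy)).
have [] := @MVT _ (fun t => f (x +i* t)) (fun t => dy f (x +i* t)) y1 y2 y12.
- by move=> y; rewrite in_itv /= => /andP[a b]; apply: hd; rewrite !ltW.
- apply: derivable_within_continuous => y; rewrite in_itv /= => hy.
  by have [] := hd y hy.
- by move=> t; rewrite in_itv /= => ht e; exists t.
Qed.

Lemma between_lt (x x0 t r : R) : `|x - x0| < r -> x0 <= t <= x \/ x <= t <= x0 -> `|t - x0| < r.
Proof.
rewrite !ltr_norml => /andP[a b] [] /andP[c d]; apply/andP; split; lra.
Qed.

(** Continuous partial derivatives give total differentiability: the increment is split along a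
    horizontal and a vertical segment, the mean value theorem is applied on each, and both
    intermediate points lie in the box where the partial derivatives vary by less than [e]. *)
Lemma disc_diff f z (e : R) : Ck 1 f -> disc z -> 0 < e ->
  nearC z (fun w => `|f w - f z - dx f z * (Re w - Re z) - dy f z * (Im w - Im z)|
     <= e * (`|Re w - Re z| + `|Im w - Im z|)).
Proof.
move=> cf dz e0.
have cx : cont_at (dx f) z := Ck_cont (Ck_dx cf) dz.
have cy : cont_at (dy f) z := Ck_cont (Ck_dy cf) dz.
have nx : nearC z (fun w => `|dx f z - dx f w| < e).
  by move: cx; clear -e0; case: z => x y /cvgrPdist_lt/(_ _ e0).
have ny : nearC z (fun w => `|dy f z - dy f w| < e).
  by move: cy; clear -e0; case: z => x y /cvgrPdist_lt/(_ _ e0).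
have nd := disc_near dz.
have [r r0 hr] := nearC_box (filterI nd (filterI nx ny)).
have : nearC z (fun w => `|Re w - Re z| < r /\ `|Im w - Im z| < r).
  apply/nbhs_ballP; exists r => //= -[x y] [] /=.
  by rewrite /ball /= => hx hy; rewrite distrC (distrC y).
apply: filterS => -[x y] /= [hx hy].
have hX : `|f (x +i* y) - f (Re z +i* y) - dx f z * (x - Re z)| <= e * `|x - Re z|.
  have [xz|zx|->] := ltgtP x (Re z); last by rewrite !subrr mulr0 subrr normr0 mulr0.
  - have [t /andP[t1 t2] ] := @disc_MVT_x f x (Re z) y cf xz (fun s hs => proj1 (hr s y (between_lt hx (or_intror hs)) hy)).
    move=> E; rewrite -(opprB (f (Re z +i* y))) E -mulrN opprB -mulrBl normrM.
    apply: ler_wpM2r => //; rewrite distrC ltW//.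
    by apply: (proj1 (proj2 (hr t y _ hy))); apply: between_lt hx _; right; rewrite !ltW.
  - have [t /andP[t1 t2] ] := @disc_MVT_x f (Re z) x y cf zx (fun s hs => proj1 (hr s y (between_lt hx (or_introl hs)) hy)).
    move=> ->; rewrite -mulrBl normrM.
    apply: ler_wpM2r => //; rewrite distrC ltW//.
    by apply: (proj1 (proj2 (hr t y _ hy))); apply: between_lt hx _; left; rewrite !ltW.
have hY : `|f (Re z +i* y) - f z - dy f z * (y - Im z)| <= e * `|y - Im z|.
  have hx0 : `|Re z - Re z| < r by rewrite subrr normr0.
  have -> : f z = f (Re z +i* Im z) by case: (z).
  have [yz|zy|->] := ltgtP y (Im z); last by rewrite !subrr mulr0 subrr normr0 mulr0.
  - have [t /andP[t1 t2] ] := @disc_MVT_y f (Re z) y (Im z) cf yz (fun s hs => proj1 (hr (Re z) s hx0 (between_lt hy (or_intror hs)))).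
    move=> E; rewrite -(opprB (f (Re z +i* Im z))) E -mulrN opprB -mulrBl normrM.
    apply: ler_wpM2r => //; rewrite distrC ltW//.
    by apply: (proj2 (proj2 (hr (Re z) t hx0 _))); apply: between_lt hy _; right; rewrite !ltW.
  - have [t /andP[t1 t2] ] := @disc_MVT_y f (Re z) (Im z) y cf zy (fun s hs => proj1 (hr (Re z) s hx0 (between_lt hy (or_introl hs)))).
    move=> ->; rewrite -mulrBl normrM.
    apply: ler_wpM2r => //; rewrite distrC ltW//.
    by apply: (proj2 (proj2 (hr (Re z) t hx0 _))); apply: between_lt hy _; left; rewrite !ltW.
rewrite [leRHS]mulrDr; apply: (le_trans _ (lerD hX hY)); apply: (le_trans _ (ler_normD _ _)).
by rewrite le_eqVlt; apply/orP; left; apply/eqP; congr (`| _ |); ring.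
Qed.

Lemma is_derive_quot (h : R -> R) (t d : R) :
  is_derive t 1 h d <-> (fun e : R => e^-1 * (h (e + t) - h t)) @ 0^' --> d.
Proof.
have E : (fun e : R => e^-1 *: ((h \o shift t) (e *: (1 : R^o)) - h t)) = (fun e : R => e^-1 * (h (e + t) - h t)).
  by apply/funext => e /=; rewrite /GRing.scale /= mulr1.
split=> [[dh <-]|H].
  by move: dh; rewrite /derivable /derive E.
apply: DeriveDef.
  by rewrite /derivable E; apply: cvgP H.
by rewrite /derive E; exact: cvg_lim.
Qed.

Lemma chain_curve f (p q : R -> R) (t p' q' : R) :
  Ck 1 f -> disc (p t +i* q t) -> is_derive t 1 p p' -> is_derive t 1 q q' ->
  is_derive t 1 (fun s => f (p s +i* q s))
    (dx f (p t +i* q t) * p' + dy f (p t +i* q t) * q').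
Proof.
move=> cf dz dp dq.
set z := p t +i* q t.
have /is_derive_quot hp := dp; have /is_derive_quot hq := dq.
apply/is_derive_quot.
set P := (fun e : R => _) in hp; set Q := (fun e : R => _) in hq.
have cp : {for t, continuous p} by apply: differentiable_continuous; apply/derivable1_diffP.
have cq : {for t, continuous q} by apply: differentiable_continuous; apply/derivable1_diffP.
have sh : (fun e : R => e + t) @ 0^' --> t.
  have H : (fun e : R => e + t) @ (0 : R) --> 0 + t.
    by apply: cvgD; [exact: cvg_id|exact: cvg_cst].
  by rewrite add0r in H; exact: cvg_within_filter.
have cpq : (fun e : R => (p (e + t), q (e + t))) @ 0^' --> (p t, q t).
  by apply: (@cvg_pair _ _ _ _ (nbhs (p t)) (nbhs (q t))); apply: cvg_comp sh _; assumption.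
have hlin : (fun e => dx f z * P e + dy f z * Q e) @ 0^' --> dx f z * p' + dy f z * q'.
  by apply: cvgD; apply: cvgM; by [exact: cvg_cst|].
rewrite -(addr0 (dx f z * p' + dy f z * q')).
pose E e := e^-1 * (f (p (e + t) +i* q (e + t)) - f z) - (dx f z * P e + dy f z * Q e).
have -> : (fun e : R => e^-1 * (f (p (e + t) +i* q (e + t)) - f z)) = (fun e => (dx f z * P e + dy f z * Q e) + E e).
  by apply/funext => e; rewrite /E; ring.
apply: cvgD => //.
apply/cvgr0Pnorm_le => eps eps0.
(* [M] is the sum of the eventual bounds [|p'| + 1] and [|q'| + 1] on the two difference quotients,
   so an error of [eps / M] relative to them is at most [eps]. *)
pose M := `|p'| + `|q'| + 2.
have M0 : 0 < M by rewrite /M; have := normr_ge0 p'; have := normr_ge0 q'; lra.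
have e0 : 0 < eps / M by rewrite divr_gt0.
have hd : \forall e \near 0^', `|f (p (e + t) +i* q (e + t)) - f z - dx f z * (p (e + t) - p t) - dy f z * (q (e + t) - q t)| <= eps / M * (`|p (e + t) - p t| + `|q (e + t) - q t|).
  exact: (cpq _ (disc_diff cf dz e0)).
have hP : \forall e \near 0^', `|P e| < `|p'| + 1.
  by apply: (cvgr_norm_lt _ hp); rewrite ltrDl.
have hQ : \forall e \near 0^', `|Q e| < `|q'| + 1.
  by apply: (cvgr_norm_lt _ hq); rewrite ltrDl.
have hn : \forall e \near 0^', e != 0 :> R.
  by apply: nbhs_dnbhs_neq.
near=> e.
have en0 : e != 0 by near: e.
have -> : E e = e^-1 * (f (p (e + t) +i* q (e + t)) - f z - dx f z * (p (e + t) - p t) - dy f z * (q (e + t) - q t)).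
  by rewrite /E /P /Q; ring.
rewrite normrM.
apply: (@le_trans _ _ (`|e^-1| * (eps / M * (`|p (e + t) - p t| + `|q (e + t) - q t|)))).
  by apply: ler_wpM2l => //; near: e.
have -> : `|e^-1| * (eps / M * (`|p (e + t) - p t| + `|q (e + t) - q t|)) = eps / M * (`|P e| + `|Q e|).
  by rewrite /P /Q !normrM; ring.
rewrite -[leRHS](divfK (lt0r_neq0 M0)); apply: ler_wpM2l; first exact: ltW.
have a1 : `|P e| < `|p'| + 1 by near: e.
have a2 : `|Q e| < `|q'| + 1 by near: e.
by rewrite /M; lra.
Unshelve. all: by end_near. Qed.

Section Comp.
Variables (p q : C -> R).
Hypothesis pq_disc : forall z, disc z -> disc (p z +i* q z).
Let G z := p z +i* q z.

Lemma is_dx_comp f z a b : Ck 1 f -> disc z -> is_dx p z a -> is_dx q z b ->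
  is_dx (fun w => f (G w)) z (dx f (G z) * a + dy f (G z) * b).
Proof.
move=> cf dz pa qb.
have E : G z = p (Re z +i* Im z) +i* q (Re z +i* Im z) by rewrite /G; case: (z).
rewrite E; apply: (chain_curve cf _ pa qb).
by rewrite -/(G z) -E; exact: pq_disc.
Qed.

Lemma is_dy_comp f z a b : Ck 1 f -> disc z -> is_dy p z a -> is_dy q z b ->
  is_dy (fun w => f (G w)) z (dx f (G z) * a + dy f (G z) * b).
Proof.
move=> cf dz pa qb.
have E : G z = p (Re z +i* Im z) +i* q (Re z +i* Im z) by rewrite /G; case: (z).
rewrite E; apply: (chain_curve cf _ pa qb).
by rewrite -/(G z) -E; exact: pq_disc.
Qed.

Lemma cont_comp f z : cont_at f (G z) -> cont_at p z -> cont_at q z ->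
  cont_at (fun w => f (G w)) z.
Proof.
case: z => x y cf cp cq.
apply: (cvg_comp (fun s : R * R => (p (s.1 +i* s.2), q (s.1 +i* s.2))) _ _ cf).
exact: (@cvg_pair _ _ _ _ (nbhs (p (x +i* y))) (nbhs (q (x +i* y)))).
Qed.

Lemma Ck_comp n f : Ck n f -> Ck n p -> Ck n q -> Ck n (fun z => f (G z)).
Proof.
elim: n f => [|n IH] f cf cp cq.
  by split; [move=> z dz; apply: cont_comp (Ck_cont cf (pq_disc dz)) (Ck_cont cp dz) (Ck_cont cq dz)|exact I].
have cf1 : Ck 1 f by exact: Ck_le cf.
apply: (@CkS_intro _ _ _ (fun z => dx f (G z) * dx p z + dy f (G z) * dx q z)
   (fun z => dx f (G z) * dy p z + dy f (G z) * dy q z)).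
- by move=> z dz; exact (cont_comp (Ck_cont cf (pq_disc dz)) (Ck_cont cp dz) (Ck_cont cq dz)).
- by move=> z dz; exact (is_dx_comp cf1 dz (CkS_dx cp dz) (CkS_dx cq dz)).
- by move=> z dz; exact (is_dy_comp cf1 dz (CkS_dy cp dz) (CkS_dy cq dz)).
- have h1 := IH _ (Ck_dx cf) (CkW cp) (CkW cq).
  have h2 := IH _ (Ck_dy cf) (CkW cp) (CkW cq).
  exact (CkD (CkM h1 (Ck_dx cp)) (CkM h2 (Ck_dx cq))).
- have h1 := IH _ (Ck_dx cf) (CkW cp) (CkW cq).
  have h2 := IH _ (Ck_dy cf) (CkW cp) (CkW cq).
  exact (CkD (CkM h1 (Ck_dy cp)) (CkM h2 (Ck_dy cq))).
Qed.

End Comp.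

(** The second difference [D] over a small square of side [h] is [h * h] times either mixed
    derivative, each at some point of the square: apply the mean value theorem in the two possible
    orders. Continuity brings both values within [e / 2] of those at [z]. *)
Lemma dxdyC f z : Ck 2 f -> disc z -> dx (dy f) z = dy (dx f) z.
Proof.
move=> cf dz; apply/eqP; rewrite -subr_eq0 -normr_le0; apply/ler_addgt0Pr => e e0.
rewrite add0r.
have e2 : 0 < e / 2 by rewrite divr_gt0.
have cxy : nearC z (fun w => `|dx (dy f) z - dx (dy f) w| < e / 2).
  have := Ck_cont (Ck_dx (Ck_dy cf)) dz; clear -e2.
  by case: z => x y /cvgrPdist_lt/(_ _ e2).
have cyx : nearC z (fun w => `|dy (dx f) z - dy (dx f) w| < e / 2).
  have := Ck_cont (Ck_dy (Ck_dx cf)) dz; clear -e2.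
  by case: z => x y /cvgrPdist_lt/(_ _ e2).
have [r r0 hr] := nearC_box (filterI (disc_near dz) (filterI cxy cyx)).
pose h := r / 2; have h0 : 0 < h by rewrite divr_gt0.
set x := Re z; set y := Im z.
have inb (a s : R) : a <= s <= a + h -> `|s - a| < r.
  by rewrite /h => /andP[u v]; rewrite ltr_norml; apply/andP; split; lra.
have dbox s t : x <= s <= x + h -> y <= t <= y + h -> disc (s +i* t).
  by move=> /inb hs /inb ht; have [] := hr s t hs ht.
have lex : x <= x <= x + h by rewrite lexx lerDl ltW.
have lex' : x <= x + h <= x + h by rewrite lexx lerDl ltW.
have ley : y <= y <= y + h by rewrite lexx lerDl ltW.
have ley' : y <= y + h <= y + h by rewrite lexx lerDl ltW.
have xh : x < x + h by rewrite ltrDl.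
have yh : y < y + h by rewrite ltrDl.
have cf1 : Ck 1 f := CkW cf.
pose D := f ((x + h) +i* (y + h)) - f ((x + h) +i* y) - f (x +i* (y + h)) + f (x +i* y).
have [w1 hw1 D1] : exists2 w, `|dy (dx f) z - dy (dx f) w| < e / 2 & D = dy (dx f) w * h * h.
  pose g w := f (Re w +i* (y + h)) - f (Re w +i* y).
  have [s /andP[s1 s2] Es] : exists2 s, x < s < x + h &
      g ((x + h) +i* y) - g (x +i* y) = (dx f (s +i* (y + h)) - dx f (s +i* y)) * (x + h - x).
    have gd s : x <= s <= x + h ->
        is_derive s 1 (fun t => g (t +i* y)) (dx f (s +i* (y + h)) - dx f (s +i* y)).
      move=> hs; apply: is_deriveB.
        exact: (CkS_dx cf1 (dbox _ _ hs ley')).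
      exact: (CkS_dx cf1 (dbox _ _ hs ley)).
    have [] := @MVT _ (fun t => g (t +i* y)) (fun s => dx f (s +i* (y + h)) - dx f (s +i* y)) x (x + h) xh.
    - by move=> s; rewrite in_itv /= => /andP[a b]; apply: gd; rewrite !ltW.
    - apply: derivable_within_continuous => s; rewrite in_itv /= => hs.
      by have [] := gd s hs.
    - by move=> s; rewrite in_itv /= => hs E; exists s.
  have hs : x <= s <= x + h by rewrite !ltW.
  have [t /andP[t1 t2] Et] := @disc_MVT_y (dx f) s y (y + h) (Ck_dx cf) yh (fun t ht => dbox _ _ hs ht).
  exists (s +i* t).
    exact (proj2 (proj2 (hr s t (inb _ _ hs) (inb y t (introT andP (conj (ltW t1) (ltW t2))))))).
  transitivity (g ((x + h) +i* y) - g (x +i* y)); first by rewrite /g /D /=; ring.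
  by rewrite Es Et; ring.
have [w2 hw2 D2] : exists2 w, `|dx (dy f) z - dx (dy f) w| < e / 2 & D = dx (dy f) w * h * h.
  pose g w := f ((x + h) +i* Im w) - f (x +i* Im w).
  have [t /andP[t1 t2] Et] : exists2 t, y < t < y + h &
      g (x +i* (y + h)) - g (x +i* y) = (dy f ((x + h) +i* t) - dy f (x +i* t)) * (y + h - y).
    have gd t : y <= t <= y + h ->
        is_derive t 1 (fun t => g (x +i* t)) (dy f ((x + h) +i* t) - dy f (x +i* t)).
      move=> ht; apply: is_deriveB.
        exact: (CkS_dy cf1 (dbox _ _ lex' ht)).
      exact: (CkS_dy cf1 (dbox _ _ lex ht)).
    have [] := @MVT _ (fun t => g (x +i* t)) (fun t => dy f ((x + h) +i* t) - dy f (x +i* t)) y (y + h) yh.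
    - by move=> t; rewrite in_itv /= => /andP[a b]; apply: gd; rewrite !ltW.
    - apply: derivable_within_continuous => t; rewrite in_itv /= => ht.
      by have [] := gd t ht.
    - by move=> t; rewrite in_itv /= => ht E; exists t.
  have ht : y <= t <= y + h by rewrite !ltW.
  have [s /andP[s1 s2] Es] := @disc_MVT_x (dy f) x (x + h) t (Ck_dy cf) xh (fun s hs => dbox _ _ hs ht).
  exists (s +i* t).
    exact (proj1 (proj2 (hr s t (inb x s (introT andP (conj (ltW s1) (ltW s2)))) (inb _ _ ht)))).
  transitivity (g (x +i* (y + h)) - g (x +i* y)); first by rewrite /g /D /=; ring.
  by rewrite Et Es; ring.
move: hw1 D1 hw2 D2; clear -h0.
move: (dx (dy f) z) (dx (dy f) w2) (dy (dx f) z) (dy (dx f) w1) => a b a' b' h1 -> h2 E.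
have {E}E : b' = b.
  have hh : h * h != 0 by rewrite mulf_neq0 ?gt_eqF.
  by apply: (mulIf hh); rewrite (mulrA b') (mulrA b) E.
have -> : a - a' = (a - b) - (a' - b') by rewrite E; ring.
apply: le_trans (ler_normB _ _) _.
by rewrite E in h1 *; lra.
Qed.

End ChainRule.

(** * Complex-valued functions and the Hermitian form *)

Section ComplexCalculus.
Variable R : realType.
Local Notation C := R[i].
Implicit Types (f g : C -> R) (z w : C) (P Q : C -> C).

Lemma ReD (a b : C) : Re (a + b) = Re a + Re b. Proof. by case: a b => ? ? []. Qed.
Lemma ImD (a b : C) : Im (a + b) = Im a + Im b. Proof. by case: a b => ? ? []. Qed.
Lemma ReN (a : C) : Re (- a) = - Re a. Proof. by case: a. Qed.
Lemma ImN (a : C) : Im (- a) = - Im a. Proof. by case: a. Qed.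
Lemma ReM (a b : C) : Re (a * b) = Re a * Re b - Im a * Im b.
Proof. by case: a b => ? ? []. Qed.
Lemma ImM (a b : C) : Im (a * b) = Re a * Im b + Im a * Re b.
Proof. by case: a b => ? ? []. Qed.
Lemma ReJ (a : C) : Re (conjc a) = Re a. Proof. by case: a. Qed.
Lemma ImJ (a : C) : Im (conjc a) = - Im a. Proof. by case: a. Qed.
Lemma sqmodE (a : C) : sqmod a = Re a * Re a + Im a * Im a.
Proof. by rewrite /sqmod !expr2. Qed.
Lemma ReV (a : C) : Re a^-1 = Re a * (sqmod a)^-1. Proof. by case: a. Qed.
Lemma ImV (a : C) : Im a^-1 = - (Im a * (sqmod a)^-1). Proof. by case: a => x y; rewrite /= -?mulNr. Qed.
Lemma complex_ext (a b : C) : Re a = Re b -> Im a = Im b -> a = b.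
Proof. by case: a b => ? ? [] ? ? /= -> ->. Qed.
Definition reimE := (ReD, ImD, ReN, ImN, ReM, ImM, ReJ, ImJ).

Lemma sqmod_eq0 (a : C) : (sqmod a == 0) = (a == 0).
Proof. by rewrite /sqmod paddr_eq0 ?sqr_ge0// !sqrf_eq0 eq_complex. Qed.
Lemma sqmod_ge0 (a : C) : 0 <= sqmod a.
Proof. by rewrite /sqmod addr_ge0 ?sqr_ge0. Qed.
Lemma sqmodM (a b : C) : sqmod (a * b) = sqmod a * sqmod b.
Proof. by rewrite !sqmodE !reimE; ring. Qed.
Lemma mulcJ (a : C) : a * conjc a = (sqmod a)%:C.
Proof. by apply: complex_ext; rewrite !reimE ?sqmodE /=; ring. Qed.

Section AbstractDerivation.
Variable isd : (C -> R) -> C -> R -> Prop.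
Hypothesis isd_cst : forall c z, isd (fun=> c) z 0.
Hypothesis isdD : forall f g z a b, isd f z a -> isd g z b -> isd (fun w => f w + g w) z (a + b).
Hypothesis isdN : forall f z a, isd f z a -> isd (fun w => - f w) z (- a).
Hypothesis isdM : forall f g z a b, isd f z a -> isd g z b ->
  isd (fun w => f w * g w) z (a * g z + f z * b).
Hypothesis isdV : forall f z a, f z != 0 -> isd f z a ->
  isd (fun w => (f w)^-1) z (- a / f z ^+ 2).

(** The hypotheses on [isd] are the rules shared by [is_dx] and [is_dy]; the complex rules are
    derived from them once and instantiated for both directions. *)
Definition isdC Q z (d : C) : Prop :=
  isd (fun w => Re (Q w)) z (Re d) /\ isd (fun w => Im (Q w)) z (Im d).

Lemma isd_eq f g z a b : isd f z a -> (forall w, f w = g w) -> a = b -> isd g z b.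
Proof. by move=> fa /funext <- <-. Qed.

Lemma isdC_real f z a : isd f z a -> isdC (fun w => (f w)%:C) z a%:C.
Proof. by split=> //=; exact: isd_cst. Qed.

Lemma isdCD P Q z a b : isdC P z a -> isdC Q z b -> isdC (fun w => P w + Q w) z (a + b).
Proof.
move=> [a1 a2] [b1 b2]; split.
- by apply: (isd_eq (isdD a1 b1)) => [w|]; rewrite ReD.
- by apply: (isd_eq (isdD a2 b2)) => [w|]; rewrite ImD.
Qed.

Lemma isdCN P z a : isdC P z a -> isdC (fun w => - P w) z (- a).
Proof.
move=> [a1 a2]; split.
- by apply: (isd_eq (isdN a1)) => [w|]; rewrite ReN.
- by apply: (isd_eq (isdN a2)) => [w|]; rewrite ImN.
Qed.

Lemma isdCB P Q z a b : isdC P z a -> isdC Q z b -> isdC (fun w => P w - Q w) z (a - b).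
Proof. by move=> ha hb; exact (isdCD ha (isdCN hb)). Qed.

Lemma isdCJ P z a : isdC P z a -> isdC (fun w => conjc (P w)) z (conjc a).
Proof.
move=> [a1 a2]; split.
- by apply: (isd_eq a1) => [w|]; rewrite ReJ.
- by apply: (isd_eq (isdN a2)) => [w|]; rewrite ImJ.
Qed.

Lemma isdCM P Q z a b : isdC P z a -> isdC Q z b ->
  isdC (fun w => P w * Q w) z (a * Q z + P z * b).
Proof.
move=> [a1 a2] [b1 b2]; split.
- apply: (isd_eq (isdD (isdM a1 b1) (isdN (isdM a2 b2)))) => [w|]; first by rewrite ReM.
  by rewrite ReD !ReM; ring.
- apply: (isd_eq (isdD (isdM a1 b2) (isdM a2 b1))) => [w|]; first by rewrite ImM.
  by rewrite ImD !ImM; ring.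
Qed.

Lemma isdCV P z a : P z != 0 -> isdC P z a -> isdC (fun w => (P w)^-1) z (- a / P z ^+ 2).
Proof.
move=> P0 [a1 a2].
have s0 : sqmod (P z) != 0 by rewrite sqmod_eq0.
have hs := isdD (isdM a1 a1) (isdM a2 a2).
have E w : Re (P w) * Re (P w) + Im (P w) * Im (P w) = sqmod (P w) by rewrite sqmodE.
have hs' : isd (fun w => sqmod (P w)) z (Re a * Re (P z) + Re (P z) * Re a + (Im a * Im (P z) + Im (P z) * Im a)).
  exact: (isd_eq hs).
have hv := isdV (f := fun w => sqmod (P w)) s0 hs'.
rewrite sqmodE in s0.
split.
- apply: (isd_eq (isdM a1 hv)) => [w|]; first by rewrite ReV.
  rewrite ReM ReN ImN ReV ImV !expr2 sqmodM !reimE !sqmodE.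
  by field.
- apply: (isd_eq (isdN (isdM a2 hv))) => [w|]; first by rewrite ImV.
  rewrite ImM ReN ImN ReV ImV !expr2 sqmodM !reimE !sqmodE.
  by field.
Qed.

Lemma isdC_herm (u v : C -> 'cV[C]_3) z (u' v' : 'cV[C]_3) :
  (forall i, isdC (fun w => u w i 0) z (u' i 0)) ->
  (forall i, isdC (fun w => v w i 0) z (v' i 0)) ->
  isdC (fun w => herm (u w) (v w)) z (herm u' (v z) + herm (u z) v').
Proof.
move=> hu hv; rewrite /herm.
have h i := isdCM (hu i) (isdCJ (hv i)).
have H := isdCB (isdCD (h 0) (h 1)) (h ord_max).
by congr isdC : H; ring.
Qed.

End AbstractDerivation.

Definition is_dxC := isdC (@is_dx R).
Definition is_dyC := isdC (@is_dy R).

Lemma is_dxC_val Q z d : is_dxC Q z d -> dxC Q z = d.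
Proof. by move=> [a b]; apply: complex_ext; rewrite /dxC /= ?(is_dx_val a) ?(is_dx_val b). Qed.
Lemma is_dyC_val Q z d : is_dyC Q z d -> dyC Q z = d.
Proof. by move=> [a b]; apply: complex_ext; rewrite /dyC /= ?(is_dy_val a) ?(is_dy_val b). Qed.

Definition CkC n Q : Prop := Ck n (fun z => Re (Q z)) /\ Ck n (fun z => Im (Q z)).

Lemma CkCS_dx n Q z : CkC n.+1 Q -> disc z -> is_dxC Q z (dxC Q z).
Proof. by move=> [a b] dz; split; [exact: (CkS_dx a dz)|exact: (CkS_dx b dz)]. Qed.
Lemma CkCS_dy n Q z : CkC n.+1 Q -> disc z -> is_dyC Q z (dyC Q z).
Proof. by move=> [a b] dz; split; [exact: (CkS_dy a dz)|exact: (CkS_dy b dz)]. Qed.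
Lemma CkC_dx n Q : CkC n.+1 Q -> CkC n (dxC Q).
Proof. by move=> [a b]; split; [exact: (Ck_dx a)|exact: (Ck_dx b)]. Qed.
Lemma CkC_dy n Q : CkC n.+1 Q -> CkC n (dyC Q).
Proof. by move=> [a b]; split; [exact: (Ck_dy a)|exact: (Ck_dy b)]. Qed.
Lemma smoothC_CkC n Q : smoothC Q -> CkC n Q.
Proof. by move=> [a b]; split; [exact: a|exact: b]. Qed.

Lemma CkC_eq n P Q : (forall z, disc z -> P z = Q z) -> CkC n P -> CkC n Q.
Proof. by move=> PQ [a b]; split; [apply: Ck_eq a|apply: Ck_eq b] => z dz; rewrite PQ. Qed.
Lemma CkC_cst n (c : C) : CkC n (fun=> c).
Proof. by split; exact: Ck_cst. Qed.
Lemma CkCD n P Q : CkC n P -> CkC n Q -> CkC n (fun z => P z + Q z).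
Proof.
move=> [a b] [c d]; split.
- by apply: Ck_eq (CkD a c) => z _; rewrite ReD.
- by apply: Ck_eq (CkD b d) => z _; rewrite ImD.
Qed.
Lemma CkCN n P : CkC n P -> CkC n (fun z => - P z).
Proof.
move=> [a b]; split.
- by apply: Ck_eq (CkN a) => z _; rewrite ReN.
- by apply: Ck_eq (CkN b) => z _; rewrite ImN.
Qed.
Lemma CkCB n P Q : CkC n P -> CkC n Q -> CkC n (fun z => P z - Q z).
Proof. by move=> a b; exact (CkCD a (CkCN b)). Qed.
Lemma CkCJ n P : CkC n P -> CkC n (fun z => conjc (P z)).
Proof.
move=> [a b]; split.
- by apply: Ck_eq a => z _; rewrite ReJ.
- by apply: Ck_eq (CkN b) => z _; rewrite ImJ.
Qed.
Lemma CkCM n P Q : CkC n P -> CkC n Q -> CkC n (fun z => P z * Q z).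
Proof.
move=> [a b] [c d]; split.
- by apply: Ck_eq (CkB (CkM a c) (CkM b d)) => z _; rewrite ReM.
- by apply: Ck_eq (CkD (CkM a d) (CkM b c)) => z _; rewrite ImM.
Qed.
Lemma Ck_sqmod n P : CkC n P -> Ck n (fun z => sqmod (P z)).
Proof. by move=> [a b]; exact (CkD (CkX 2 a) (CkX 2 b)). Qed.
Lemma CkCV n P : (forall z, disc z -> P z != 0) -> CkC n P -> CkC n (fun z => (P z)^-1).
Proof.
move=> P0 cP; have [a b] := cP.
have cs : Ck n (fun z => (sqmod (P z))^-1).
  by apply: CkV (Ck_sqmod cP) => z dz; rewrite sqmod_eq0 P0.
split.
- by apply: Ck_eq (CkM a cs) => z _; rewrite ReV.
- by apply: Ck_eq (CkN (CkM b cs)) => z _; rewrite ImV.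
Qed.
Lemma CkC_sum (I : Type) (s : seq I) n (F : I -> C -> C) :
  (forall i, CkC n (F i)) -> CkC n (fun z => \sum_(i <- s) F i z).
Proof.
move=> cF; elim: s => [|i s IH].
  by apply: CkC_eq (CkC_cst n 0) => z _; rewrite big_nil.
by apply: CkC_eq (CkCD (cF i) IH) => z _; rewrite big_cons.
Qed.
Lemma CkC_herm n (u v : C -> 'cV[C]_3) :
  (forall i, CkC n (fun w => u w i 0)) -> (forall i, CkC n (fun w => v w i 0)) ->
  CkC n (fun w => herm (u w) (v w)).
Proof.
move=> hu hv; have h i := CkCM (hu i) (CkCJ (hv i)).
exact (CkCB (CkCD (h 0) (h 1)) (h ord_max)).
Qed.

Lemma is_dxC_near P Q z d : nearC z (fun w => P w = Q w) -> is_dxC P z d -> is_dxC Q z d.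
Proof.
move=> PQ [a b]; split.
- by apply: is_dx_near a; apply: filterS PQ => p ->.
- by apply: is_dx_near b; apply: filterS PQ => p ->.
Qed.
Lemma is_dyC_near P Q z d : nearC z (fun w => P w = Q w) -> is_dyC P z d -> is_dyC Q z d.
Proof.
move=> PQ [a b]; split.
- by apply: is_dy_near a; apply: filterS PQ => p ->.
- by apply: is_dy_near b; apply: filterS PQ => p ->.
Qed.

Lemma eqC_disc_near P Q z :
  (forall w, disc w -> P w = Q w) -> disc z -> nearC z (fun w => P w = Q w).
Proof. by move=> fg /disc_near; apply: filterS => p /fg. Qed.

Lemma dxCdyCC Q z : CkC 2 Q -> disc z -> dxC (dyC Q) z = dyC (dxC Q) z.
Proof.
move=> [a b] dz; apply: complex_ext.
- exact (dxdyC a dz).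
- exact (dxdyC b dz).
Qed.

Lemma is_dxCD P Q z a b : is_dxC P z a -> is_dxC Q z b -> is_dxC (fun w => P w + Q w) z (a + b).
Proof. exact: isdCD (@is_dxD R) _ _ _ _ _. Qed.
Lemma is_dyCD P Q z a b : is_dyC P z a -> is_dyC Q z b -> is_dyC (fun w => P w + Q w) z (a + b).
Proof. exact: isdCD (@is_dyD R) _ _ _ _ _. Qed.
Lemma is_dxCB P Q z a b : is_dxC P z a -> is_dxC Q z b -> is_dxC (fun w => P w - Q w) z (a - b).
Proof. exact: isdCB (@is_dxD R) (@is_dxN R) _ _ _ _ _. Qed.
Lemma is_dyCB P Q z a b : is_dyC P z a -> is_dyC Q z b -> is_dyC (fun w => P w - Q w) z (a - b).
Proof. exact: isdCB (@is_dyD R) (@is_dyN R) _ _ _ _ _. Qed.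
Lemma is_dxCM P Q z a b : is_dxC P z a -> is_dxC Q z b -> is_dxC (fun w => P w * Q w) z (a * Q z + P z * b).
Proof. exact: isdCM (@is_dxD R) (@is_dxN R) (@is_dxM R) _ _ _ _ _. Qed.
Lemma is_dyCM P Q z a b : is_dyC P z a -> is_dyC Q z b -> is_dyC (fun w => P w * Q w) z (a * Q z + P z * b).
Proof. exact: isdCM (@is_dyD R) (@is_dyN R) (@is_dyM R) _ _ _ _ _. Qed.
Lemma is_dxCJ P z a : is_dxC P z a -> is_dxC (fun w => conjc (P w)) z (conjc a).
Proof. exact: isdCJ (@is_dxN R) _ _ _. Qed.
Lemma is_dyCJ P z a : is_dyC P z a -> is_dyC (fun w => conjc (P w)) z (conjc a).
Proof. exact: isdCJ (@is_dyN R) _ _ _. Qed.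
Lemma is_dxCV P z a : P z != 0 -> is_dxC P z a -> is_dxC (fun w => (P w)^-1) z (- a / P z ^+ 2).
Proof. exact: isdCV (@is_dxD R) (@is_dxN R) (@is_dxM R) (@is_dxV R) _ _ _. Qed.
Lemma is_dyCV P z a : P z != 0 -> is_dyC P z a -> is_dyC (fun w => (P w)^-1) z (- a / P z ^+ 2).
Proof. exact: isdCV (@is_dyD R) (@is_dyN R) (@is_dyM R) (@is_dyV R) _ _ _. Qed.
Lemma is_dxC_herm (u v : C -> 'cV[C]_3) z (u' v' : 'cV[C]_3) :
  (forall i, is_dxC (fun w => u w i 0) z (u' i 0)) ->
  (forall i, is_dxC (fun w => v w i 0) z (v' i 0)) ->
  is_dxC (fun w => herm (u w) (v w)) z (herm u' (v z) + herm (u z) v').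
Proof. exact: isdC_herm (@is_dxD R) (@is_dxN R) (@is_dxM R) _ _ _ _ _. Qed.
Lemma is_dyC_herm (u v : C -> 'cV[C]_3) z (u' v' : 'cV[C]_3) :
  (forall i, is_dyC (fun w => u w i 0) z (u' i 0)) ->
  (forall i, is_dyC (fun w => v w i 0) z (v' i 0)) ->
  is_dyC (fun w => herm (u w) (v w)) z (herm u' (v z) + herm (u z) v').
Proof. exact: isdC_herm (@is_dyD R) (@is_dyN R) (@is_dyM R) _ _ _ _ _. Qed.

End ComplexCalculus.

(** * Integration over the plane of functions compactly supported in the disc *)

Section PlaneIntegral.
Variable R : realType.
Local Notation C := R[i].
Implicit Types (f g : C -> R) (z w : C).
Local Notation leb := (@lebesgue_measure R).
Local Notation mu2 := (@lebesgue_measure R \x @lebesgue_measure R)%E.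

(** The measurable sets are those of the product sigma-algebra, so openness has to be exhausted by
    rectangles: an open set is the union of the countably many rational boxes that it contains. *)
Lemma open_measurable2 (U : set (R * R)) : open U -> measurable U.
Proof.
move=> oU.
pose box (i : (rat * rat) * (rat * rat)) : set (R * R) :=
  `]ratr i.1.1, ratr i.1.2[%classic `*` `]ratr i.2.1, ratr i.2.2[%classic.
pose F i := if `[< box i `<=` U >] then box i else set0.
have -> : U = \bigcup_i F i.
  apply/seteqP; split => [[x y] Uxy|p [i _]]; last first.
    by rewrite /F; case: asboolP => // h /h.
  have /nbhs_ballP[r /= r0 hr] := open_nbhs_nbhs (conj oU Uxy).
  have l (t : R) : t - r < t by rewrite ltrBlDr ltrDl.
  have u (t : R) : t < t + r by rewrite ltrDl.
  have [a] := rat_in_itvoo (l x); rewrite in_itv /= => /andP[a1 a2].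
  have [b] := rat_in_itvoo (u x); rewrite in_itv /= => /andP[b1 b2].
  have [c] := rat_in_itvoo (l y); rewrite in_itv /= => /andP[c1 c2].
  have [d] := rat_in_itvoo (u y); rewrite in_itv /= => /andP[d1 d2].
  exists ((a, b), (c, d)) => //; rewrite /F.
  have hb : box (a, b, (c, d)) `<=` U.
    move=> [s t] [] /=; rewrite !in_itv /= => /andP[s1 s2] /andP[t1 t2].
    apply: hr; split; rewrite /ball /= ltr_norml; apply/andP; split; lra.
  rewrite asboolT//; split; rewrite /= in_itv /=; exact/andP.
apply: countable_bigcupT_measurable; first exact: countableP.
move=> i; rewrite /F; case: ifP => // _.
by apply: measurableX; exact: measurable_itv.
Qed.

Lemma continuous_measurable2 (F : R * R -> R) : continuous F -> measurable_fun setT F.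
Proof.
move=> cF; apply: (measurability _ (RGenOInfty.measurableE R)) => _ [_ [x ->] <-].
rewrite setTI; apply: open_measurable2.
by apply: open_comp; [move=> p _; exact: cF|exact: rray_open].
Qed.

(** The extension by zero moves the integral to the whole plane, where Fubini applies to full lines
    instead of chords of the disc. *)
Definition ext f (p : R * R) : R :=
  if sqmod (p.1 +i* p.2) < 1 then f (p.1 +i* p.2) else 0.

Definition II f : R := \int[mu2]_p ext f p.

(** [r] bounds the squared modulus, as in [deck_proper]; compactness of the support in the disc
    comes from [r < 1]. *)
Definition csupp (r : R) f : Prop := forall z, disc z -> r < sqmod z -> f z = 0.

Definition Ck_csupp n (r : R) f : Prop := Ck n f /\ csupp r f.

Lemma eq_II f g : (forall z, disc z -> f z = g z) -> II f = II g.
Proof.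
move=> fg; congr (Rintegral mu2 setT _); apply/funext => p; rewrite /ext.
by case: ifP => // /fg.
Qed.

Lemma ext_near f z : disc z -> nearC z (fun w => f w = ext f (Re w, Im w)).
Proof.
move=> /disc_near; apply: filterS => -[x y] h.
by rewrite /ext /=; move: h; rewrite /disc /= => ->.
Qed.

Lemma ext_near0 r f z : r < 1 -> csupp r f -> ~ disc z -> nearC z (fun w => ext f (Re w, Im w) = 0).
Proof.
move=> r1 sf; rewrite /disc /= => /negP; rewrite -leNgt => z1.
have : nearC z (fun w => r < sqmod w).
  by apply: cont_gt (lt_le_trans r1 z1); exact: cont_sqmod.
apply: filterS => -[x y] /= h; rewrite /ext; case: ifP => // d.
by rewrite sf.
Qed.

(** At a point outside the disc the squared modulus is at least 1, hence greater than [r] on a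
    neighbourhood, and the extension is zero there. *)
Lemma ext_continuous r f : r < 1 -> csupp r f -> (forall z, disc z -> cont_at f z) ->
  continuous (ext f).
Proof.
move=> r1 sf cf [x y].
have H : cont_at (fun w => ext f (Re w, Im w)) (x +i* y).
  have [dz|dz] := pselect (disc (x +i* y)).
    exact: (cont_at_near (ext_near f dz) (cf _ dz)).
  apply: (cont_at_near _ (@cont_cst _ 0 _)).
  by have := ext_near0 r1 sf dz; apply: filterS => p ->.
have E : (fun p : R * R => ext f (Re (p.1 +i* p.2), Im (p.1 +i* p.2))) = ext f.
  by apply/funext => -[].
by rewrite -E; exact: H.
Qed.

Let I1 : set R := `[-1, 1]%classic.
Definition box : set (R * R) := I1 `*` I1.

Lemma sqmod_box x y : sqmod (x +i* y) < 1 -> box (x, y).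
Proof.
rewrite /sqmod /= => h; split; rewrite /I1 /= in_itv /=; apply/andP; split; nra.
Qed.

Lemma compact_box : compact box.
Proof. by apply: compact_setX; exact: segment_compact. Qed.

Lemma ext_bounded r f : r < 1 -> csupp r f -> (forall z, disc z -> cont_at f z) ->
  exists2 M : R, 0 <= M & forall p, `|ext f p| <= M.
Proof.
move=> r1 sf cf.
have ce := ext_continuous r1 sf cf.
have /compact_bounded[M [_ hM]] : compact (ext f @` box).
  by apply: continuous_compact compact_box; exact: continuous_subspaceT.
exists (`|M| + 1) => [|p]; first by rewrite addr_ge0.
have [pb|pb] := pselect (box p).
  by apply: hM; [rewrite (le_lt_trans (ler_norm _))// ltrDl|exists p].
rewrite /ext; case: ifPn => [h|_]; last by rewrite normr0 addr_ge0.
by case: pb; case: p h => x y; exact: sqmod_box.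
Qed.

Lemma measurable_box : measurable box.
Proof. by apply: measurableX; exact: measurable_itv. Qed.

Lemma box_integrable (M : R) : mu2.-integrable setT (EFin \o (fun p => M * \1_box p)).
Proof.
have -> : EFin \o (fun p => M * \1_box p) = (fun p => M%:E * (EFin \o \1_box) p)%E.
  by apply/funext => p; rewrite /= EFinM.
apply: integrableZl => //; apply: finite_measure_integrable_indic || idtac.
apply/integrableP; split.
  by apply/measurable_EFinP; exact: measurable_indic measurable_box.
under eq_integral do rewrite gee0_abs ?lee_fin//.
rewrite integral_indic// ?setIT; last exact: measurable_box.
rewrite [X in (X < _)%E](_ : _ = (leb I1 * leb I1)%E); last first.
  by apply: product_measure1E; exact: measurable_itv.
rewrite !lebesgue_measure_itv /=.
by rewrite -!EFinD; case: ifP => _ //=; rewrite -?EFinM ltry.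
Qed.

Lemma box_bound_integrable (h : R * R -> R) (M : R) : measurable_fun setT h ->
  (forall p, `|h p| <= M * \1_box p) -> mu2.-integrable setT (EFin \o h).
Proof.
move=> mh hM; apply: (le_integrable _ _ _ (box_integrable M)) => //.
  exact/measurable_EFinP.
by move=> p _ /=; rewrite lee_fin (le_trans (hM p))// ler_norm.
Qed.

Lemma le_box f (M : R) : (forall p, `|ext f p| <= M) -> forall p, `|ext f p| <= M * \1_box p.
Proof.
move=> hM p; rewrite indicE; have [pb|pb] := boolP (p \in box); first by rewrite mulr1.
rewrite mulr0 /ext; case: ifPn => [h|_]; last by rewrite normr0.
by case/negP: pb; rewrite inE; case: p h => x y; exact: sqmod_box.
Qed.

Lemma ext_integrable r f : r < 1 -> csupp r f -> (forall z, disc z -> cont_at f z) ->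
  mu2.-integrable setT (EFin \o ext f).
Proof.
move=> r1 sf cf; have [M _ hM] := ext_bounded r1 sf cf.
apply: box_bound_integrable (le_box hM).
exact: continuous_measurable2 (ext_continuous r1 sf cf).
Qed.

Lemma IID r f g : r < 1 -> Ck_csupp 0 r f -> Ck_csupp 0 r g ->
  II (fun z => f z + g z) = II f + II g.
Proof.
move=> r1 [cf sf] [cg sg]; rewrite /II.
have cf' z : disc z -> cont_at f z by exact (Ck_cont cf).
have cg' z : disc z -> cont_at g z by exact (Ck_cont cg).
rewrite -RintegralD//; [|exact: ext_integrable sf cf'|exact: ext_integrable sg cg'].
congr (Rintegral mu2 setT _); apply/funext => p; rewrite /ext.
by case: ifP; rewrite ?addr0.
Qed.

Lemma IIB r f g : r < 1 -> Ck_csupp 0 r f -> Ck_csupp 0 r g ->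
  II (fun z => f z - g z) = II f - II g.
Proof.
move=> r1 [cf sf] [cg sg]; rewrite /II.
have cf' z : disc z -> cont_at f z by exact (Ck_cont cf).
have cg' z : disc z -> cont_at g z by exact (Ck_cont cg).
rewrite -RintegralB//; [|exact: ext_integrable sf cf'|exact: ext_integrable sg cg'].
congr (Rintegral mu2 setT _); apply/funext => p; rewrite /ext.
by case: ifP; rewrite ?subr0.
Qed.

Lemma II0 : II (fun=> 0) = 0.
Proof.
rewrite /II; have -> : ext (fun=> 0) = cst 0 by apply/funext => p; rewrite /ext; case: ifP.
by rewrite Rintegral_cst //= ?mul0r.
Qed.

Lemma II_sum (I : Type) (s : seq I) r (F : I -> C -> R) : r < 1 ->
  (forall i, Ck_csupp 0 r (F i)) ->
  II (fun z => \sum_(i <- s) F i z) = \sum_(i <- s) II (F i).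
Proof.
move=> r1 hF; elim: s => [|i s IH].
  by rewrite big_nil -{2}II0; apply: eq_II => z _; rewrite big_nil.
rewrite big_cons -IH -(IID r1 (hF i)).
  by apply: eq_II => z _; rewrite big_cons.
split; first by apply: Ck_sum => j; exact: (hF j).1.
by move=> z dz rz; rewrite big1// => j _; exact: (hF j).2.
Qed.

Lemma csupp_near0 r f z : csupp r f -> disc z -> r < sqmod z -> nearC z (fun w => 0 = f w).
Proof.
move=> sf dz rz.
have h : nearC z (fun w => r < sqmod w) by apply: cont_gt rz; exact: cont_sqmod.
have H : nearC z (fun w => disc w /\ r < sqmod w) by exact: filterI (disc_near dz) h.
by apply: filterS H => p [d l]; rewrite sf.
Qed.

Lemma csupp_dx r f : csupp r f -> csupp r (dx f).
Proof.
move=> sf z dz rz; apply: is_dx_val.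
exact: is_dx_near (csupp_near0 sf dz rz) (@is_dx_cst _ 0 _).
Qed.

Lemma csupp_dy r f : csupp r f -> csupp r (dy f).
Proof.
move=> sf z dz rz; apply: is_dy_val.
exact: is_dy_near (csupp_near0 sf dz rz) (@is_dy_cst _ 0 _).
Qed.

Lemma Ck_csupp_dx n r f : Ck_csupp n.+1 r f -> Ck_csupp n r (dx f).
Proof. by move=> [cf sf]; split; [exact: Ck_dx|exact: csupp_dx]. Qed.
Lemma Ck_csupp_dy n r f : Ck_csupp n.+1 r f -> Ck_csupp n r (dy f).
Proof. by move=> [cf sf]; split; [exact: Ck_dy|exact: csupp_dy]. Qed.

(** The interval [[-1, 1]] contains every horizontal and vertical section of the disc, and the
    extended functions vanish at its ends. *)
Lemma integral_derive_compact (F F' : R -> R) : (forall x : R, is_derive x 1 F (F' x)) ->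
  continuous F' -> F 1 = 0 -> F (-1) = 0 -> (forall x : R, ~ `[-1, 1]%classic x -> F' x = 0) ->
  (\int[leb]_x (F' x)%:E = 0)%E.
Proof.
move=> dF cF' F1 FN1 F0.
have -> : (fun x => (F' x)%:E) = ((fun x => (F' x)%:E) \_ `[-1, 1]%classic).
  apply/funext => x; rewrite patchE; case: ifPn => // /negP; rewrite inE => h.
  by rewrite F0.
rewrite -integral_mkcond.
have cF : continuous F.
  by move=> x; apply: differentiable_continuous; apply/derivable1_diffP; have [] := dF x.
rewrite (@continuous_FTC2 _ F' F) ?F1 ?FN1 ?sube0//.
- exact: continuous_subspaceT.
- split=> [x _||]; first by have [] := dF x.
  + by apply: cvg_at_right_filter; exact: cF.
  + by apply: cvg_at_left_filter; exact: cF.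
- by move=> x _; rewrite derive1E; have [_] := dF x.
Qed.

(** Fubini with the integral in x inside: on each horizontal line the integrand is the derivative of
    a function that vanishes at both ends. *)
Lemma II_dx r f : r < 1 -> Ck_csupp 1 r f -> II (dx f) = 0.
Proof.
move=> r1 [cf sf]; have sdx := csupp_dx sf.
have cdx z : disc z -> cont_at (dx f) z by exact: (Ck_cont (Ck_dx cf)).
have ce := ext_continuous r1 sdx cdx.
rewrite /II /Rintegral -(integral21_prod_meas1 (ext_integrable r1 sdx cdx)) /fubini_G /=.
rewrite (eq_integral (cst 0%E)) ?integral0// => y _.
apply: (@integral_derive_compact (fun x => ext f (x, y))).
- move=> x; have [dz|dz] := pselect (disc (x +i* y)).
    have /= := is_dx_near (ext_near f dz) (CkS_dx cf dz).
    by have -> : ext (dx f) (x, y) = dx f (x +i* y) by rewrite /ext; case: ifP => //; move: dz; rewrite /disc /= => ->.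
  have -> : ext (dx f) (x, y) = 0 by rewrite /ext; case: ifP.
  apply: (@is_dx_near _ (fun=> 0) (fun w => ext f (Re w, Im w)) (x +i* y)); last exact: is_dx_cst.
  by have := ext_near0 r1 sf dz; apply: filterS => p ->.
- move=> x; apply: (@cvg_comp _ _ _ (fun t : R => (t, y)) _ _ (nbhs (x, y))); last exact: ce.
  by apply: (@cvg_pair _ _ _ _ (nbhs x) (nbhs y)); [exact: cvg_id|exact: cvg_cst].
- by rewrite /ext /sqmod /=; case: ifP => // h; exfalso; nra.
- by rewrite /ext /sqmod /=; case: ifP => // h; exfalso; nra.
- by move=> x hx; rewrite /ext; case: ifP => // /sqmod_box[].
Qed.

Lemma II_dy r f : r < 1 -> Ck_csupp 1 r f -> II (dy f) = 0.
Proof.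
move=> r1 [cf sf]; have sdy := csupp_dy sf.
have cdy z : disc z -> cont_at (dy f) z by exact: (Ck_cont (Ck_dy cf)).
have ce := ext_continuous r1 sdy cdy.
rewrite /II /Rintegral -(integral12_prod_meas1 (ext_integrable r1 sdy cdy)) /fubini_F /=.
rewrite (eq_integral (cst 0%E)) ?integral0// => x _.
apply: (@integral_derive_compact (fun y => ext f (x, y))).
- move=> y; have [dz|dz] := pselect (disc (x +i* y)).
    have /= := is_dy_near (ext_near f dz) (CkS_dy cf dz).
    by have -> : ext (dy f) (x, y) = dy f (x +i* y) by rewrite /ext; case: ifP => //; move: dz; rewrite /disc /= => ->.
  have -> : ext (dy f) (x, y) = 0 by rewrite /ext; case: ifP.
  apply: (@is_dy_near _ (fun=> 0) (fun w => ext f (Re w, Im w)) (x +i* y)); last exact: is_dy_cst.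
  by have := ext_near0 r1 sf dz; apply: filterS => p ->.
- move=> y; apply: (@cvg_comp _ _ _ (fun t : R => (x, t)) _ _ (nbhs (x, y))); last exact: ce.
  by apply: (@cvg_pair _ _ _ _ (nbhs x) (nbhs y)); [exact: cvg_cst|exact: cvg_id].
- by rewrite /ext /sqmod /=; case: ifP => // h; exfalso; nra.
- by rewrite /ext /sqmod /=; case: ifP => // h; exfalso; nra.
- by move=> y hy; rewrite /ext; case: ifP => // /sqmod_box[].
Qed.

End PlaneIntegral.

(** * Moebius maps of the disc and the invariance of the integral *)

Section MobiusFlow.
Variable R : realType.
Local Notation C := R[i].
Local Notation I := (0 +i* 1).
Implicit Types (f g : C -> R) (z w : C).

Lemma is_dxC_id z : is_dxC (fun w => w) z 1.
Proof. by split; [exact: is_dx_Re|exact: is_dx_Im]. Qed.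
Lemma is_dyC_id z : is_dyC (fun w => w) z I.
Proof. by split; [exact: is_dy_Re|exact: is_dy_Im]. Qed.
Lemma is_dxC_cst (c : C) z : is_dxC (fun=> c) z 0.
Proof. by split; exact: is_dx_cst. Qed.
Lemma is_dyC_cst (c : C) z : is_dyC (fun=> c) z 0.
Proof. by split; exact: is_dy_cst. Qed.
Lemma CkC_id n : CkC n (fun z : C => z).
Proof. by split; [exact: Ck_Re|exact: Ck_Im]. Qed.

Section Mobius.
Variables a b : C.
Definition mobN z := a * z + b.
Definition mobD z := conjc b * z + conjc a.
(** The determinant [sqmod a - sqmod b] is only required to be positive, since the path to the
    identity used below does not stay in SU(1,1). *)
Definition mob z := mobN z * (mobD z)^-1.
Let Delta := sqmod a - sqmod b.
Hypothesis Delta_gt0 : 0 < Delta.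

(** The matrix with rows (a, b) and (conj b, conj a) multiplies the Hermitian form of signature
    (1,1) by its determinant; the identity is this fact at the vector (z, 1). *)
Lemma mobND z : sqmod (mobD z) - sqmod (mobN z) = Delta * (1 - sqmod z).
Proof. by rewrite /Delta /mobD /mobN !sqmodE !reimE; ring. Qed.

Lemma mobD_gt0 z : disc z -> 0 < sqmod (mobD z).
Proof.
rewrite /disc /= => dz; have := mobND z; have := sqmod_ge0 (mobN z).
have : 0 < Delta * (1 - sqmod z) by rewrite mulr_gt0// subr_gt0.
lra.
Qed.

Lemma mobD_neq0 z : disc z -> mobD z != 0.
Proof. by move=> /mobD_gt0; rewrite lt_neqAle eq_sym sqmod_eq0 => /andP[]. Qed.

Lemma sqmodV z : sqmod z^-1 = (sqmod z)^-1.
Proof.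
have [->|z0] := eqVneq z 0; first by rewrite invr0 /sqmod /= expr0n /= addr0 invr0.
have s0 : sqmod z != 0 by rewrite sqmod_eq0.
apply: (mulIf s0); rewrite mulVf// -sqmodM mulVf//.
by rewrite /sqmod /= expr1n expr0n /= addr0.
Qed.

Lemma mob_defect z : disc z ->
  1 - sqmod (mob z) = Delta * (1 - sqmod z) / sqmod (mobD z).
Proof.
move=> dz; have D0 := mobD_gt0 dz.
rewrite /mob sqmodM sqmodV -mobND; field.
by rewrite gt_eqF.
Qed.

Lemma mob_disc z : disc z -> disc (mob z).
Proof.
move=> dz; rewrite /disc /= -subr_gt0 mob_defect//.
by rewrite divr_gt0 ?mobD_gt0// mulr_gt0// subr_gt0.
Qed.

Lemma conjcM (u v : C) : conjc (u * v) = conjc u * conjc v.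
Proof. by apply: complex_ext; rewrite !reimE; ring. Qed.
Lemma conjcD (u v : C) : conjc (u + v) = conjc u + conjc v.
Proof. by apply: complex_ext; rewrite !reimE; ring. Qed.
Lemma sqmodJ (u : C) : sqmod (conjc u) = sqmod u.
Proof. by rewrite !sqmodE !reimE; ring. Qed.
Lemma sqmod_real (x : R) : sqmod x%:C = x ^+ 2.
Proof. by rewrite sqmodE /= expr2; ring. Qed.
Lemma sqmodD_le (u v : C) : sqmod (u + v) <= 2 * (sqmod u + sqmod v).
Proof.
rewrite !sqmodE !reimE; have := sqr_ge0 (Re u - Re v); have := sqr_ge0 (Im u - Im v).
rewrite !expr2; nra.
Qed.
Lemma sqmodN (u : C) : sqmod (- u) = sqmod u.
Proof. by rewrite !sqmodE !reimE; ring. Qed.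

Lemma DeltaC : Delta%:C = a * conjc a - b * conjc b.
Proof. by rewrite /Delta !mulcJ; apply: complex_ext; rewrite !reimE /=; ring. Qed.

(** The inverse matrix gives [a - conjc b * mob z = Delta / mobD z], whose left side is bounded
    because [mob z] lies in the disc. *)
Lemma mob_inv_bound z : disc z -> sqmod (mobD z)^-1 <= 2 * (sqmod a + sqmod b) / Delta ^+ 2.
Proof.
move=> dz; have D0 := mobD_neq0 dz.
have E : a - conjc b * mob z = Delta%:C * (mobD z)^-1.
  by rewrite DeltaC /mob /mobN /mobD; field.
have : sqmod (a - conjc b * mob z) <= 2 * (sqmod a + sqmod b).
  apply: le_trans (sqmodD_le _ _) _; rewrite ler_pM2l// lerD2l sqmodN sqmodM sqmodJ.
  by apply: ler_piMr; [exact: sqmod_ge0|apply: ltW; exact: mob_disc].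
rewrite E sqmodM sqmod_real => h.
by rewrite ler_pdivlMr ?exprn_gt0// mulrC.
Qed.

(** The preimage of a smaller disc stays away from the circle by an amount that depends on the map
    only through [Delta] and [sqmod a + sqmod b]; this gives a common support for all times of the
    flow. *)
Lemma mob_supp z r : disc z -> sqmod (mob z) <= r -> r < 1 ->
  (1 - r) * Delta / (2 * (sqmod a + sqmod b)) <= 1 - sqmod z.
Proof.
move=> dz Mr r1; have D0 := mobD_gt0 dz.
have hK := mob_inv_bound dz; rewrite sqmodV in hK.
have K0 : 0 < sqmod a + sqmod b.
  by have := Delta_gt0; rewrite /Delta; have := sqmod_ge0 b; lra.
have E : 1 - sqmod z = (1 - sqmod (mob z)) * sqmod (mobD z) / Delta.
  by rewrite mob_defect//; field; rewrite !gt_eqF.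
rewrite E ler_pdivrMr ?mulr_gt0//.
have h1 : 1 <= 2 * (sqmod a + sqmod b) / Delta ^+ 2 * sqmod (mobD z).
  by have := ler_wpM2r (ltW D0) hK; rewrite mulVf ?gt_eqF.
have -> : (1 - sqmod (mob z)) * sqmod (mobD z) / Delta * (2 * (sqmod a + sqmod b)) =
   ((1 - sqmod (mob z)) * Delta) * (2 * (sqmod a + sqmod b) / Delta ^+ 2 * sqmod (mobD z)).
  by field; rewrite gt_eqF.
have h2 : (1 - r) * Delta <= (1 - sqmod (mob z)) * Delta by rewrite ler_pM2r// lerD2l lerN2.
apply: le_trans h2 _; apply: ler_peMr => //.
by apply: mulr_ge0; [rewrite subr_ge0 ltW//; exact: mob_disc|exact: ltW].
Qed.

Lemma CkC_mobD n : CkC n mobD.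
Proof. exact (CkCD (CkCM (CkC_cst n _) (CkC_id n)) (CkC_cst n _)). Qed.
Lemma CkC_mobN n : CkC n mobN.
Proof. exact (CkCD (CkCM (CkC_cst n _) (CkC_id n)) (CkC_cst n _)). Qed.
Lemma CkC_mob n : CkC n mob.
Proof. exact (CkCM (CkC_mobN n) (CkCV mobD_neq0 (CkC_mobD n))). Qed.

(** The complex derivative of [mob]; its squared modulus is the Jacobian determinant. *)
Definition mobH z := Delta%:C * ((mobD z)^-1 * (mobD z)^-1).

Lemma CkC_mobH n : CkC n mobH.
Proof. 
have h := CkCV mobD_neq0 (CkC_mobD n).
exact (CkCM (CkC_cst n _) (CkCM h h)).
Qed.

Lemma is_dxC_mob z : disc z -> is_dxC mob z (mobH z).
Proof.
move=> dz; have D0 := mobD_neq0 dz.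
have dD : is_dxC mobD z _ := is_dxCD (is_dxCM (is_dxC_cst _ z) (is_dxC_id z)) (is_dxC_cst _ z).
have dN : is_dxC mobN z _ := is_dxCD (is_dxCM (is_dxC_cst _ z) (is_dxC_id z)) (is_dxC_cst _ z).
have := is_dxCM dN (is_dxCV D0 dD); congr is_dxC.
by rewrite /mobH DeltaC; rewrite /mobN /mobD in D0 *; field.
Qed.

Lemma is_dyC_mob z : disc z -> is_dyC mob z (I * mobH z).
Proof.
move=> dz; have D0 := mobD_neq0 dz.
have dD : is_dyC mobD z _ := is_dyCD (is_dyCM (is_dyC_cst _ z) (is_dyC_id z)) (is_dyC_cst _ z).
have dN : is_dyC mobN z _ := is_dyCD (is_dyCM (is_dyC_cst _ z) (is_dyC_id z)) (is_dyC_cst _ z).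
have := is_dyCM dN (is_dyCV D0 dD); congr is_dyC.
by rewrite /mobH DeltaC; rewrite /mobN /mobD in D0 *; field.
Qed.

Lemma sqmod_mobH z : sqmod (mobH z) = Delta ^+ 2 / sqmod (mobD z) ^+ 2.
Proof. by rewrite /mobH !sqmodM sqmod_real sqmodV -exprVn !expr2. Qed.

End Mobius.

Lemma complex_eta (c : C) : Re c +i* Im c = c.
Proof. by case: c. Qed.

Section CompC.
Variable M : C -> C.
Hypothesis M_disc : forall z, disc z -> disc (M z).

Lemma is_dx_compC f z d : Ck 1 f -> disc z -> is_dxC M z d ->
  is_dx (fun w => f (M w)) z (dx f (M z) * Re d + dy f (M z) * Im d).
Proof.
move=> cf dz [h1 h2].
have hM w : disc w -> disc (Re (M w) +i* Im (M w)) by rewrite complex_eta; exact: M_disc.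
have := is_dx_comp hM cf dz h1 h2.
rewrite complex_eta; congr is_dx; apply/funext => w; rewrite complex_eta//.
Qed.

Lemma is_dy_compC f z d : Ck 1 f -> disc z -> is_dyC M z d ->
  is_dy (fun w => f (M w)) z (dx f (M z) * Re d + dy f (M z) * Im d).
Proof.
move=> cf dz [h1 h2].
have hM w : disc w -> disc (Re (M w) +i* Im (M w)) by rewrite complex_eta; exact: M_disc.
have := is_dy_comp hM cf dz h1 h2.
rewrite complex_eta; congr is_dy; apply/funext => w; rewrite complex_eta//.
Qed.

Lemma Ck_compC n f : Ck n f -> CkC n M -> Ck n (fun z => f (M z)).
Proof.
move=> cf [h1 h2].
have hM w : disc w -> disc (Re (M w) +i* Im (M w)) by rewrite complex_eta; exact: M_disc.
apply: Ck_eq (Ck_comp hM cf h1 h2) => z _; rewrite complex_eta//.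
Qed.

End CompC.

Lemma is_dx_sqmod (P : C -> C) z d : is_dxC P z d ->
  is_dx (fun w => sqmod (P w)) z (2 * (Re (P z) * Re d + Im (P z) * Im d)).
Proof.
move=> [h1 h2]; apply: (isd_eq (is_dxD (is_dxM h1 h1) (is_dxM h2 h2))) => [w|]; first by rewrite sqmodE.
by ring.
Qed.
Lemma is_dy_sqmod (P : C -> C) z d : is_dyC P z d ->
  is_dy (fun w => sqmod (P w)) z (2 * (Re (P z) * Re d + Im (P z) * Im d)).
Proof.
move=> [h1 h2]; apply: (isd_eq (is_dyD (is_dyM h1 h1) (is_dyM h2 h2))) => [w|]; first by rewrite sqmodE.
by ring.
Qed.

Section Flow.
Variables a b : C.
Hypothesis ab1 : sqmod a - sqmod b = 1.
Hypothesis a_ge0 : 0 <= Re a.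
(* The squares keep sqmod (pathA t) - sqmod (pathB t) positive for every real t,
   not only on [0, 1]. *)
Definition pathA (t : R) : C := ((1 - t) * (1 - t))%:C + (t * t)%:C * a.
Definition pathB (t : R) : C := (t * t)%:C * b.
Definition dpathA (t : R) : C := (- (2 * (1 - t)))%:C + (2 * t)%:C * a.
Definition dpathB (t : R) : C := (2 * t)%:C * b.
Let A := pathA.
Let B := pathB.
Let A' := dpathA.
Let B' := dpathB.
Let Delta t := sqmod (A t) - sqmod (B t).

(** With p = (1 - t)^2 and q = t^2, the determinant is p^2 + 2 p q Re a + q^2. As Re a is
    nonnegative, it is at least p^2 + q^2, hence at least (p + q)^2 / 2, and p + q is at least
    1/2. *)
Lemma Delta_ge t : 8^-1 <= Delta t.
Proof.
have -> : Delta t = ((1 - t) * (1 - t)) ^+ 2 + 2 * (((1 - t) * (1 - t)) * (t * t) * Re a) + (t * t) ^+ 2 * (sqmod a - sqmod b).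
  by rewrite /Delta /A /B /pathA /pathB !sqmodE !reimE /=; ring.
rewrite ab1 mulr1.
have h0 : 0 <= (1 - t) * (1 - t) * (t * t) * Re a by apply: mulr_ge0 => //; apply: mulr_ge0; rewrite -expr2 sqr_ge0.
have h1 : 2^-1 <= (1 - t) * (1 - t) + t * t by have := sqr_ge0 (t - 2^-1); rewrite expr2; lra.
have h2 := sqr_ge0 ((1 - t) * (1 - t) - t * t).
move: h1 h2 h0; rewrite !expr2; move: ((1 - t) * (1 - t)) (t * t) => p q; nra.
Qed.

Lemma Delta_pos t : 0 < Delta t.
Proof. by apply: lt_le_trans (Delta_ge t); rewrite invr_gt0. Qed.

Lemma is_dxC_pathA w : is_dxC (fun w => A (Re w)) w (A' (Re w)).
Proof.
have h1 : is_dx (fun w => 1 - Re w) w _ := is_dxD (is_dx_cst 1 w) (is_dxN (is_dx_Re w)).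
have h2 := isdC_real (@is_dx_cst R) (is_dxM h1 h1).
have h3 := isdC_real (@is_dx_cst R) (is_dxM (is_dx_Re w) (is_dx_Re w)).
have := is_dxCD h2 (is_dxCM h3 (is_dxC_cst a w)); congr is_dxC.
by apply: complex_ext; rewrite !reimE /=; ring.
Qed.
Lemma is_dxC_pathB w : is_dxC (fun w => B (Re w)) w (B' (Re w)).
Proof.
have h3 := isdC_real (@is_dx_cst R) (is_dxM (is_dx_Re w) (is_dx_Re w)).
have := is_dxCM h3 (is_dxC_cst b w); congr is_dxC.
by apply: complex_ext; rewrite !reimE /=; ring.
Qed.

Let N t := mobN (A t) (B t).
Let D t := mobD (A t) (B t).
Let M t := mob (A t) (B t).
Let H t := mobH (A t) (B t).
Let N' t z := A' t * z + B' t.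
Let D' t z := conjc (B' t) * z + conjc (A' t).
Let P t z := N' t z * D t z - N t z * D' t z.
(** The velocity of the flow pulled back to the source: the time derivative of [M] is [X * H]. The
    denominators of [M] cancel, and [X t] is a quadratic polynomial in z. *)
Let X t z := P t z * ((Delta t)^-1)%:C.
(** [dDelta] and [Ht] are the time derivatives of [Delta] and [H]; [H1] and [X1] are the complex
    derivatives of [H] and [X] in z. *)
Let dDelta t := A' t * conjc (A t) + A t * conjc (A' t) - (B' t * conjc (B t) + B t * conjc (B' t)).
Let Ht t z := dDelta t * ((D t z)^-1 * (D t z)^-1)
  + (Delta t)%:C * (- D' t z / D t z ^+ 2 * (D t z)^-1 + (D t z)^-1 * (- D' t z / D t z ^+ 2)).
Let H1 t z := (Delta t)%:C * (- conjc (B t) / D t z ^+ 2 * (D t z)^-1 + (D t z)^-1 * (- conjc (B t) / D t z ^+ 2)).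
Let X1 t z := (A' t * D t z + N' t z * conjc (B t) - (A t * D' t z + N t z * conjc (B' t))) * ((Delta t)^-1)%:C.

Lemma D_neq0 t z : disc z -> D t z != 0.
Proof. exact: mobD_neq0 (Delta_pos t) _. Qed.

Lemma DeltaVC t : ((Delta t)^-1)%:C = (A t * conjc (A t) - B t * conjc (B t))^-1.
Proof.
rewrite -DeltaC; apply: complex_ext; rewrite ?ReV ?ImV /=; last by rewrite mul0r oppr0.
rewrite sqmod_real -/(Delta t); have := Delta_pos t => d; field.
by rewrite gt_eqF.
Qed.

Lemma DeltaC_neq0 t : A t * conjc (A t) - B t * conjc (B t) != 0.
Proof.
rewrite -DeltaC; apply/eqP => /(congr1 (@Re R)) /=; rewrite -/(Delta t).
by apply/eqP; rewrite gt_eqF// Delta_pos.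
Qed.

Lemma is_derive_flow_D t z : is_dxC (fun w => D (Re w) z) (t +i* 0) (D' t z).
Proof.
have hA := is_dxC_pathA (t +i* 0); have hB := is_dxC_pathB (t +i* 0).
have := is_dxCD (is_dxCM (is_dxCJ hB) (is_dxC_cst z _)) (is_dxCJ hA); congr is_dxC.
by rewrite /D' /=; ring.
Qed.

Lemma is_derive_flow_M t z : disc z -> is_dxC (fun w => M (Re w) z) (t +i* 0) (X t z * H t z).
Proof.
move=> dz; have D0 := D_neq0 t dz.
have hA := is_dxC_pathA (t +i* 0); have hB := is_dxC_pathB (t +i* 0).
have hD := is_derive_flow_D t z.
have hN := is_dxCD (is_dxCM hA (is_dxC_cst z _)) hB.
have := is_dxCM hN (is_dxCV (P := fun w => D (Re w) z) (z := t +i* 0) D0 hD); congr is_dxC => /=.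
have d0 := DeltaC_neq0 t.
rewrite /X /H /mobH /P DeltaVC DeltaC -/(D t z) /N' /N /mobN.
by field; rewrite D0.
Qed.

Lemma is_derive_flow_H t z : disc z -> is_dxC (fun w => H (Re w) z) (t +i* 0) (Ht t z).
Proof.
move=> dz; have D0 := D_neq0 t dz.
have hA := is_dxC_pathA (t +i* 0); have hB := is_dxC_pathB (t +i* 0).
have hV := is_dxCV (P := fun w => D (Re w) z) (z := t +i* 0) D0 (is_derive_flow_D t z).
have hd : is_dxC (fun w => (Delta (Re w))%:C) (t +i* 0) (dDelta t).
  have := is_dxCB (is_dxCM hA (is_dxCJ hA)) (is_dxCM hB (is_dxCJ hB)); congr is_dxC.
  by apply/funext => w; rewrite -DeltaC.
by have := is_dxCM hd (is_dxCM hV hV).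
Qed.

Lemma is_dxC_H t z : disc z -> is_dxC (H t) z (H1 t z).
Proof.
move=> dz; have D0 := D_neq0 t dz.
have hD : is_dxC (D t) z (conjc (B t)).
  have := is_dxCD (is_dxCM (is_dxC_cst (conjc (B t)) z) (is_dxC_id z)) (is_dxC_cst (conjc (A t)) z).
  by congr is_dxC; ring.
have hV := is_dxCV D0 hD.
have := is_dxCM (is_dxC_cst (Delta t)%:C z) (is_dxCM hV hV); congr is_dxC.
by rewrite /H1 mul0r add0r.
Qed.
Lemma is_dyC_H t z : disc z -> is_dyC (H t) z (I * H1 t z).
Proof.
move=> dz; have D0 := D_neq0 t dz.
have hD : is_dyC (D t) z (conjc (B t) * I).
  have := is_dyCD (is_dyCM (is_dyC_cst (conjc (B t)) z) (is_dyC_id z)) (is_dyC_cst (conjc (A t)) z).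
  by congr is_dyC; ring.
have hV := is_dyCV D0 hD.
have := is_dyCM (is_dyC_cst (Delta t)%:C z) (is_dyCM hV hV); congr is_dyC.
by rewrite /H1; field.
Qed.

Lemma is_dxC_X t z : is_dxC (X t) z (X1 t z).
Proof.
have id := is_dxC_id z; have c u := is_dxC_cst u z.
have hD := is_dxCD (is_dxCM (c (conjc (B t))) id) (c (conjc (A t))).
have hN := is_dxCD (is_dxCM (c (A t)) id) (c (B t)).
have hD' := is_dxCD (is_dxCM (c (conjc (B' t))) id) (c (conjc (A' t))).
have hN' := is_dxCD (is_dxCM (c (A' t)) id) (c (B' t)).
have := is_dxCM (is_dxCB (is_dxCM hN' hD) (is_dxCM hN hD')) (c ((Delta t)^-1)%:C).
by congr is_dxC; rewrite /X1 /N' /D' /N /D /mobN /mobD; ring.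
Qed.
Lemma is_dyC_X t z : is_dyC (X t) z (I * X1 t z).
Proof.
have id := is_dyC_id z; have c u := is_dyC_cst u z.
have hD := is_dyCD (is_dyCM (c (conjc (B t))) id) (c (conjc (A t))).
have hN := is_dyCD (is_dyCM (c (A t)) id) (c (B t)).
have hD' := is_dyCD (is_dyCM (c (conjc (B' t))) id) (c (conjc (A' t))).
have hN' := is_dyCD (is_dyCM (c (A' t)) id) (c (B' t)).
have := is_dyCM (is_dyCB (is_dyCM hN' hD) (is_dyCM hN hD')) (c ((Delta t)^-1)%:C).
by congr is_dyC; rewrite /X1 /N' /D' /N /D /mobN /mobD; ring.
Qed.

(* Both sides are the mixed derivative of the flow in the time and in z. *)
Lemma flow_identity t z : disc z -> Ht t z = X1 t z * H t z + X t z * H1 t z.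
Proof.
move=> dz; have D0 := D_neq0 t dz; have d0 := DeltaC_neq0 t.
rewrite /Ht /X1 /H /H1 /X /P /mobH DeltaVC DeltaC -/(D t z) /dDelta /N' /D' /N /mobN.
rewrite /D /mobD in D0 *.
field.
by rewrite D0.
Qed.

Variables (f : C -> R) (r : R).
Hypotheses (r1 : r < 1) (cf : Ck_csupp 1 r f).

Lemma M_disc t z : disc z -> disc (M t z).
Proof. exact: mob_disc (Delta_pos t) _. Qed.

(** The coefficient of the pullback of f dx dy under the map at time t; [flowG] is its time
    derivative. *)
Definition flowF t z : R := f (M t z) * sqmod (H t z).
Definition flowG t z : R :=
  (dx f (M t z) * Re (X t z * H t z) + dy f (M t z) * Im (X t z * H t z)) * sqmod (H t z)
  + f (M t z) * (2 * (Re (H t z) * Re (Ht t z) + Im (H t z) * Im (Ht t z))).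

Lemma is_derive_flowF (t : R) z : disc z -> is_derive t 1 (fun s : R => flowF s z) (flowG t z).
Proof.
move=> dz.
have [h1 h2] := is_derive_flow_M t dz.
have hf := @chain_curve _ f _ _ t _ _ cf.1 _ h1 h2.
have hH := is_dx_sqmod (is_derive_flow_H t dz).
have hf' : is_dx (fun w => f (M (Re w) z)) (t +i* 0) (dx f (M t z) * Re (X t z * H t z) + dy f (M t z) * Im (X t z * H t z)).
  have := hf; rewrite complex_eta => /(_ (M_disc t dz)) {}hf.
  have -> : (fun w => f (M (Re w) z)) = (fun w => f (Re (M (Re w) z) +i* Im (M (Re w) z))).
    by apply/funext => w; rewrite complex_eta.
  exact: hf.
exact: (is_dxM hf' hH).
Qed.

(** Cartan's formula: the time derivative of the pulled-back 2-form is the exterior derivative of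
    its contraction with [X]. The term coming from the Jacobian is rewritten by [flow_identity]. *)
Lemma flowG_div t z : disc z ->
  flowG t z = dx (fun w => Re (X t w) * flowF t w) z + dy (fun w => Im (X t w) * flowF t w) z.
Proof.
move=> dz.
have hM : is_dxC (M t) z (H t z) := is_dxC_mob (Delta_pos t) dz.
have hM' : is_dyC (M t) z (I * H t z) := is_dyC_mob (Delta_pos t) dz.
have fx := is_dx_compC (@M_disc t) cf.1 dz hM.
have fy := is_dy_compC (@M_disc t) cf.1 dz hM'.
have Fx := is_dxM fx (is_dx_sqmod (is_dxC_H t dz)).
have Fy := is_dyM fy (is_dy_sqmod (is_dyC_H t dz)).
have [x1 _] := is_dxC_X t z; have [_ x2] := is_dyC_X t z.
rewrite (is_dx_val (is_dxM x1 Fx)) (is_dy_val (is_dyM x2 Fy)).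
rewrite /flowG (flow_identity t dz) /flowF.
move: (X t z) (H t z) (X1 t z) (H1 t z) (f (M t z)) (dx f (M t z)) (dy f (M t z)).
clear => x h x1 h1 f0 f1 f2; rewrite sqmodE !reimE /=; ring.
Qed.

Lemma CkC_H n t : CkC n (H t).
Proof. exact: (CkC_mobH (Delta_pos t)). Qed.

Lemma Ck_flowF t : Ck 1 (flowF t).
Proof.
have h1 := Ck_compC (@M_disc t) cf.1 (CkC_mob (Delta_pos t) 1).
exact (CkM h1 (Ck_sqmod (CkC_H 1 t))).
Qed.

Lemma CkC_X n t : CkC n (X t).
Proof.
have c (u : C) := CkC_cst n u; have id := CkC_id n.
have hD := CkCD (CkCM (c (conjc (B t))) id) (c (conjc (A t))).
have hN := CkCD (CkCM (c (A t)) id) (c (B t)).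
have hD' := CkCD (CkCM (c (conjc (B' t))) id) (c (conjc (A' t))).
have hN' := CkCD (CkCM (c (A' t)) id) (c (B' t)).
exact (CkCM (CkCB (CkCM hN' hD) (CkCM hN hD')) (c ((Delta t)^-1)%:C)).
Qed.

(** The times range over an open interval around [[0, 1]], since differentiation under the integral
    is carried out on an open interval. *)
Definition flow_bounded (h : R -> C -> R) : Prop :=
  exists K : R, forall t z, -1 < t < 2 -> disc z -> `|h t z| <= K.

Lemma flow_boundedD h k : flow_bounded h -> flow_bounded k -> flow_bounded (fun t z => h t z + k t z).
Proof.
move=> [K hK] [L hL]; exists (K + L) => t z ht dz.
by apply: le_trans (ler_normD _ _) _; apply: lerD; [exact: hK|exact: hL].
Qed.
Lemma flow_boundedN h : flow_bounded h -> flow_bounded (fun t z => - h t z).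
Proof. by move=> [K hK]; exists K => t z ht dz; rewrite normrN; exact: hK. Qed.
Lemma flow_boundedM h k : flow_bounded h -> flow_bounded k -> flow_bounded (fun t z => h t z * k t z).
Proof.
move=> [K hK] [L hL]; exists (K * L) => t z ht dz.
by rewrite normrM; apply: ler_pM => //; [exact: hK|exact: hL].
Qed.
Lemma flow_bounded_cst c : flow_bounded (fun _ _ => c).
Proof. by exists `|c|. Qed.
Lemma flow_bounded_time : flow_bounded (fun t _ => t).
Proof. by exists 2 => t z /andP[t1 t2] _; rewrite ler_norml; apply/andP; split; lra. Qed.
Lemma flow_bounded_sqr h : flow_bounded (fun t z => h t z ^+ 2) -> flow_bounded h.
Proof.
move=> [K hK]; exists (K + 1) => t z ht dz; have := hK t z ht dz.
rewrite ger0_norm ?sqr_ge0// -real_normK ?num_real//.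
have := sqr_ge0 (`|h t z| - 2^-1); rewrite !expr2; move: `|h t z| => x; nra.
Qed.

Definition flow_boundedC (h : R -> C -> C) : Prop :=
  flow_bounded (fun t z => Re (h t z)) /\ flow_bounded (fun t z => Im (h t z)).

Lemma flow_bounded_eq h k : (forall t z, h t z = k t z) -> flow_bounded h -> flow_bounded k.
Proof. by move=> hk [K hK]; exists K => t z; rewrite -hk; exact: hK. Qed.

Lemma flow_boundedCD h k : flow_boundedC h -> flow_boundedC k -> flow_boundedC (fun t z => h t z + k t z).
Proof.
move=> [h1 h2] [k1 k2]; split.
- by apply: flow_bounded_eq (flow_boundedD h1 k1) => t z; rewrite ReD.
- by apply: flow_bounded_eq (flow_boundedD h2 k2) => t z; rewrite ImD.
Qed.
Lemma flow_boundedCN h : flow_boundedC h -> flow_boundedC (fun t z => - h t z).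
Proof.
move=> [h1 h2]; split.
- by apply: flow_bounded_eq (flow_boundedN h1) => t z; rewrite ReN.
- by apply: flow_bounded_eq (flow_boundedN h2) => t z; rewrite ImN.
Qed.
Lemma flow_boundedCM h k : flow_boundedC h -> flow_boundedC k -> flow_boundedC (fun t z => h t z * k t z).
Proof.
move=> [h1 h2] [k1 k2]; split.
- by apply: flow_bounded_eq (flow_boundedD (flow_boundedM h1 k1) (flow_boundedN (flow_boundedM h2 k2))) => t z; rewrite ReM.
- by apply: flow_bounded_eq (flow_boundedD (flow_boundedM h1 k2) (flow_boundedM h2 k1)) => t z; rewrite ImM.
Qed.
Lemma flow_boundedCJ h : flow_boundedC h -> flow_boundedC (fun t z => conjc (h t z)).
Proof.
move=> [h1 h2]; split.
- by apply: flow_bounded_eq h1 => t z; rewrite ReJ.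
- by apply: flow_bounded_eq (flow_boundedN h2) => t z; rewrite ImJ.
Qed.
Lemma flow_boundedC_cst c : flow_boundedC (fun _ _ => c).
Proof. by split; exact: flow_bounded_cst. Qed.
Lemma flow_boundedC_real h : flow_bounded h -> flow_boundedC (fun t z => (h t z)%:C).
Proof. by split=> //; exact: flow_bounded_cst. Qed.
Lemma flow_boundedC_sqmod h : flow_bounded (fun t z => sqmod (h t z)) -> flow_boundedC h.
Proof.
move=> [K hK]; split; apply: flow_bounded_sqr; exists K => t z ht dz; apply: le_trans (hK t z ht dz).
  by rewrite !ger0_norm ?sqr_ge0 ?sqmod_ge0// /sqmod lerDl sqr_ge0.
by rewrite !ger0_norm ?sqr_ge0 ?sqmod_ge0// /sqmod lerDr sqr_ge0.
Qed.
Lemma flow_bounded_sqmod h : flow_boundedC h -> flow_bounded (fun t z => sqmod (h t z)).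
Proof.
move=> [h1 h2]; apply: flow_bounded_eq (flow_boundedD (flow_boundedM h1 h1) (flow_boundedM h2 h2)) => t z.
by rewrite sqmodE.
Qed.
Lemma flow_boundedC_id : flow_boundedC (fun _ z => z).
Proof.
apply: flow_boundedC_sqmod; exists 1 => t z _ dz.
by rewrite ger0_norm ?sqmod_ge0//; exact: ltW.
Qed.

Lemma flow_boundedC_A : flow_boundedC (fun t _ => A t).
Proof.
have s := flow_boundedD (flow_bounded_cst 1) (flow_boundedN flow_bounded_time).
have t2 := flow_boundedC_real (flow_boundedM flow_bounded_time flow_bounded_time).
exact (flow_boundedCD (flow_boundedC_real (flow_boundedM s s)) (flow_boundedCM t2 (flow_boundedC_cst a))).
Qed.
Lemma flow_boundedC_B : flow_boundedC (fun t _ => B t).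
Proof.
have t2 := flow_boundedC_real (flow_boundedM flow_bounded_time flow_bounded_time).
exact (flow_boundedCM t2 (flow_boundedC_cst b)).
Qed.
Lemma flow_boundedC_A' : flow_boundedC (fun t _ => A' t).
Proof.
have s := flow_boundedD (flow_bounded_cst 1) (flow_boundedN flow_bounded_time).
have t2 := flow_boundedC_real (flow_boundedM (flow_bounded_cst 2) flow_bounded_time).
exact (flow_boundedCD (flow_boundedC_real (flow_boundedN (flow_boundedM (flow_bounded_cst 2) s))) (flow_boundedCM t2 (flow_boundedC_cst a))).
Qed.
Lemma flow_boundedC_B' : flow_boundedC (fun t _ => B' t).
Proof.
have t2 := flow_boundedC_real (flow_boundedM (flow_bounded_cst 2) flow_bounded_time).
exact (flow_boundedCM t2 (flow_boundedC_cst b)).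
Qed.

Lemma size_ge0 t : 0 <= sqmod (A t) + sqmod (B t).
Proof. exact: addr_ge0 (sqmod_ge0 _) (sqmod_ge0 _). Qed.

Lemma flow_bounded_size : flow_bounded (fun t _ => sqmod (A t) + sqmod (B t)).
Proof. exact (flow_boundedD (flow_bounded_sqmod flow_boundedC_A) (flow_bounded_sqmod flow_boundedC_B)). Qed.

Lemma flow_boundedC_Dinv : flow_boundedC (fun t z => (D t z)^-1).
Proof.
have [K hK] := flow_bounded_size.
(* The factor 64 bounds the inverse square of [Delta t], by [Delta_ge]; the rest is the constant of
   [mob_inv_bound]. *)
apply: flow_boundedC_sqmod; exists (2 * K * 64) => t z ht dz.
rewrite ger0_norm ?sqmod_ge0//.
apply: le_trans (mob_inv_bound (Delta_pos t) dz) _.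
have hk := hK t z ht dz; rewrite ger0_norm ?size_ge0// in hk.
have d := Delta_ge t; have d0 := Delta_pos t.
have dd : (Delta t ^+ 2)^-1 <= 64.
  by rewrite -exprVn (_ : 64 = 8 ^+ 2); [rewrite ler_sqr ?nnegrE ?invr_ge0 ?(ltW d0)// -(invrK 8) lef_pV2 ?posrE ?invr_gt0|rewrite expr2; ring].
apply: ler_pM => //; first by rewrite mulr_ge0 ?size_ge0.
  by rewrite invr_ge0 sqr_ge0.
by rewrite ler_pM2l.
Qed.

Lemma flow_bounded_comp g : (exists M, forall z, disc z -> `|g z| <= M) ->
  flow_bounded (fun t z => g (M t z)).
Proof. by move=> [K hK]; exists K => t z ht dz; apply: hK; exact: M_disc. Qed.

Lemma ext_disc_bounded g : Ck 0 g -> csupp r g -> exists M, forall z, disc z -> `|g z| <= M.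
Proof.
move=> cg sg; have [K _ hK] := ext_bounded r1 sg (fun z => @Ck_cont _ 0 g z cg).
exists K => z dz; have := hK (Re z, Im z); rewrite /ext /= complex_eta.
by move: dz; rewrite /disc /= => ->.
Qed.

Lemma flow_bounded_G : flow_bounded flowG.
Proof.
have bA := flow_boundedC_A; have bB := flow_boundedC_B.
have bA' := flow_boundedC_A'; have bB' := flow_boundedC_B'; have bz := flow_boundedC_id.
have bi := flow_boundedC_Dinv.
have bN := flow_boundedCD (flow_boundedCM bA bz) bB.
have bD := flow_boundedCD (flow_boundedCM (flow_boundedCJ bB) bz) (flow_boundedCJ bA).
have bN' := flow_boundedCD (flow_boundedCM bA' bz) bB'.
have bD' : flow_boundedC D' := flow_boundedCD (flow_boundedCM (flow_boundedCJ bB') bz) (flow_boundedCJ bA').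
have bP : flow_boundedC P := flow_boundedCD (flow_boundedCM bN' bD) (flow_boundedCN (flow_boundedCM bN bD')).
have bDelta : flow_boundedC (fun t _ => (Delta t)%:C).
  apply: flow_boundedC_real.
  exact (flow_boundedD (flow_bounded_sqmod bA) (flow_boundedN (flow_bounded_sqmod bB))).
have bDV : flow_boundedC (fun t _ => (Delta t)^-1%:C).
  apply: flow_boundedC_real; exists 8 => t z _ _.
  by rewrite ger0_norm ?invr_ge0 ?(ltW (Delta_pos t))// -(invrK 8) lef_pV2 ?posrE ?invr_gt0 ?Delta_ge ?Delta_pos.
have bH : flow_boundedC H := flow_boundedCM bDelta (flow_boundedCM bi bi).
have bX : flow_boundedC X := flow_boundedCM bP bDV.
have bq : flow_boundedC (fun t z => - D' t z / D t z ^+ 2).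
  have h := flow_boundedCM (flow_boundedCN bD') (flow_boundedCM bi bi).
  by case: h => u v; split; [apply: flow_bounded_eq u|apply: flow_bounded_eq v] => t z; rewrite expr2 invfM.
have bdDelta := flow_boundedCD (flow_boundedCD (flow_boundedCM bA' (flow_boundedCJ bA)) (flow_boundedCM bA (flow_boundedCJ bA')))
  (flow_boundedCN (flow_boundedCD (flow_boundedCM bB' (flow_boundedCJ bB)) (flow_boundedCM bB (flow_boundedCJ bB')))).
have bHt : flow_boundedC Ht := flow_boundedCD (flow_boundedCM bdDelta (flow_boundedCM bi bi))
  (flow_boundedCM bDelta (flow_boundedCD (flow_boundedCM bq bi) (flow_boundedCM bi bq))).
have bXH := flow_boundedCM bX bH.
have cdx := Ck_csupp_dx cf; have cdy := Ck_csupp_dy cf.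
have b0 := flow_bounded_comp (ext_disc_bounded (CkW cf.1) cf.2).
have b1 := flow_bounded_comp (ext_disc_bounded cdx.1 cdx.2).
have b2 := flow_bounded_comp (ext_disc_bounded cdy.1 cdy.2).
apply: flow_boundedD.
  apply: flow_boundedM (flow_bounded_sqmod bH).
  exact (flow_boundedD (flow_boundedM b1 bXH.1) (flow_boundedM b2 bXH.2)).
apply: flow_boundedM b0 _; apply: flow_boundedM (flow_bounded_cst 2) _.
exact (flow_boundedD (flow_boundedM bH.1 bHt.1) (flow_boundedM bH.2 bHt.2)).
Qed.

(** One radius serves all times: the distance given by [mob_supp] is made uniform by [Delta_ge] and
    by the bound [K] on the size of the matrices. *)
Lemma flow_supp : exists2 r' : R, r' < 1 & forall t, -1 < t < 2 -> csupp r' (flowF t).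
Proof.
have [K hK] := flow_bounded_size.
have K0 : 0 < K.
  have d0 : disc (0 : C) by rewrite /disc /= /sqmod /= expr0n /= addr0 ltr01.
  have ht : -1 < (0 : R) < 2 by apply/andP; split; lra.
  have := hK 0 0 ht d0; rewrite ger0_norm ?size_ge0//.
  by apply: lt_le_trans; have := Delta_pos 0; rewrite /Delta; have := sqmod_ge0 (B 0); lra.
have e0 : 0 < (1 - r) * 8^-1 / (2 * K) by rewrite divr_gt0 ?mulr_gt0 ?subr_gt0 ?invr_gt0.
exists (1 - (1 - r) * 8^-1 / (2 * K)) => [|t ht z dz rz]; first by lra.
rewrite /flowF cf.2 ?mul0r//; first exact: M_disc.
rewrite ltNge; apply/negP => Mr.
have := mob_supp (Delta_pos t) dz Mr r1.
rewrite -/(Delta t) leNgt => /negP; apply.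
apply: (@lt_le_trans _ _ ((1 - r) * 8^-1 / (2 * K))); first by lra.
have hk := hK t z ht dz; rewrite ger0_norm ?size_ge0// in hk.
have k0 : 0 < sqmod (A t) + sqmod (B t).
  by have := Delta_pos t; rewrite /Delta; have := sqmod_ge0 (B t); lra.
apply: ler_pM => //.
- by rewrite mulr_ge0 ?subr_ge0 ?(ltW r1)// invr_ge0.
- by rewrite invr_ge0 mulr_ge0// ltW.
- by rewrite ler_pM2l ?subr_gt0// Delta_ge.
- by rewrite lef_pV2 ?posrE ?mulr_gt0// ler_pM2l.
Qed.

Lemma is_derive_ext_flowF (t : R) p :
  is_derive t 1 (fun s : R => ext (flowF s) p) (ext (flowG t) p).
Proof.
rewrite /ext; case: ifP => dp; last exact: is_derive_cst.
exact: is_derive_flowF.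
Qed.

Lemma II_flowG (t : R) : -1 < t < 2 -> II (flowG t) = 0.
Proof.
move=> ht; have [r' r'1 sF] := flow_supp.
have [xr xi] := CkC_X 1 t; have cF := Ck_flowF t.
have c1 : Ck_csupp 1 r' (fun w => Re (X t w) * flowF t w).
  by split; [exact: CkM xr cF|move=> z dz rz; rewrite (sF t ht z dz rz) mulr0].
have c2 : Ck_csupp 1 r' (fun w => Im (X t w) * flowF t w).
  by split; [exact: CkM xi cF|move=> z dz rz; rewrite (sF t ht z dz rz) mulr0].
rewrite (eq_II (flowG_div t)) (IID r'1 (Ck_csupp_dx c1) (Ck_csupp_dy c2)).
by rewrite (II_dx r'1 c1) (II_dy r'1 c2) addr0.
Qed.

(** Differentiation under the integral, dominated by a multiple of the indicator of [box]; the
    derivative is then the integral of [flowG], a divergence with compact support. *)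
Lemma is_derive_II_flowF (t : R) : -1 < t < 2 -> is_derive t 1 (fun s : R => II (flowF s)) 0.
Proof.
move=> ht; have [r' r'1 sF] := flow_supp; have [K0 hK0] := flow_bounded_G.
pose K := `|K0|.
have hK s z : -1 < s < 2 -> disc z -> `|flowG s z| <= K.
  by move=> hs dz; apply: le_trans (hK0 s z hs dz) (ler_norm _).
have It : `]-1, 2[%classic t by rewrite /= in_itv.
have mu_int s : `]-1, 2[%classic s ->
    (@lebesgue_measure R \x @lebesgue_measure R)%E.-integrable setT (EFin \o ext (flowF s)).
  rewrite /= in_itv /= => hs; apply: (ext_integrable r'1 (sF s hs)) => z dz.
  exact (Ck_cont (Ck_flowF s) dz).
have der s p : `]-1, 2[%classic s -> setT p -> derivable (fun u => ext (flowF u) p) s 1.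
  by move=> _ _; have [] := is_derive_ext_flowF s p.
have bnd : forall p, 0 <= K * \1_(@box R) p by move=> p; rewrite mulr_ge0// normr_ge0.
have ub s p : `]-1, 2[%classic s -> setT p ->
    `|partial1of2 (fun u => ext (flowF u)) s p| <= K * \1_(@box R) p.
  rewrite /= in_itv /= => hs _; rewrite partial1of2E.
  have [_ ->] := is_derive_ext_flowF s p.
  apply: le_box => q; rewrite /ext; case: ifP => dq; last by rewrite normr0 normr_ge0.
  exact: hK.
have mT := @measurableT _ (measurableTypeR R * measurableTypeR R)%type.
have D1 := derivable_under_integral mT It mu_int der bnd (box_integrable K) ub.
have D2 := differentiation_under_integral mT It mu_int der bnd (box_integrable K) ub.
apply: DeriveDef; first exact: D1.
rewrite -derive1E D2 -(II_flowG ht) /II.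
congr (Rintegral _ setT _); apply/funext => p.
by rewrite partial1of2E; have [_ ->] := is_derive_ext_flowF t p.
Qed.

Lemma II_flow_const : II (flowF 1) = II (flowF 0).
Proof.
have [] := @MVT_segment _ (fun s : R => II (flowF s)) (fun=> 0) 0 1 ler01.
- move=> x; rewrite in_itv /= => /andP[x0 x1]; apply: is_derive_II_flowF.
  by apply/andP; split; lra.
- apply: derivable_within_continuous => x; rewrite in_itv /= => /andP[x0 x1].
  by have [] : is_derive x 1 (fun s : R => II (flowF s)) 0
    by apply: is_derive_II_flowF; apply/andP; split; lra.
- by move=> c _; rewrite mul0r => /eqP; rewrite subr_eq0 => /eqP.
Qed.

Lemma II_mob_ge0 : II (fun z => f (mob a b z) / sqmod (mobD a b z) ^+ 2) = II f.
Proof.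
have A1 : pathA 1 = a by apply: complex_ext; rewrite !reimE /=; ring.
have B1 : pathB 1 = b by apply: complex_ext; rewrite !reimE /=; ring.
have A0 : pathA 0 = 1 by apply: complex_ext; rewrite !reimE /=; ring.
have B0 : pathB 0 = 0 by apply: complex_ext; rewrite !reimE /=; ring.
have -> : (fun z => f (mob a b z) / sqmod (mobD a b z) ^+ 2) = flowF 1.
  apply/funext => z; rewrite /flowF /M /H /A /B sqmod_mobH A1 B1 ab1.
  by rewrite expr1n mul1r.
rewrite II_flow_const; congr II; apply/funext => z.
rewrite /flowF /M /H /A /B sqmod_mobH A0 B0.
have -> : mobD 1 0 z = 1 by apply: complex_ext; rewrite /mobD !reimE /=; ring.
have -> : mob 1 0 z = z.
  rewrite /mob; have -> : mobD 1 0 z = 1 by apply: complex_ext; rewrite /mobD !reimE /=; ring.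
  by rewrite /mobN mul1r addr0 invr1 mulr1.
by rewrite !sqmodE /=; field.
Qed.

End Flow.

(* The disc automorphism only depends on (a, b) up to sign, so the path to the
   identity may be assumed to avoid the degenerate matrices. *)
Lemma II_mob (a b : C) f r : sqmod a - sqmod b = 1 -> r < 1 -> Ck_csupp 1 r f ->
  II (fun z => f (mob a b z) / sqmod (mobD a b z) ^+ 2) = II f.
Proof.
move=> ab1 r1 cf; have [a0|a0] := leP 0 (Re a); first exact: II_mob_ge0 cf.
rewrite -(@II_mob_ge0 (- a) (- b) _ _ f r) //.
- apply: eq_II => z _.
  have hD : mobD (- a) (- b) z = - mobD a b z.
    by apply: complex_ext; rewrite /mobD !reimE; ring.
  have hN : mobN (- a) (- b) z = - mobN a b z.
    by apply: complex_ext; rewrite /mobN !reimE; ring.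
  by rewrite /mob hD hN sqmodN invrN mulrNN.
- by rewrite !sqmodN.
- by rewrite ReN oppr_ge0 ltW.
Qed.

End MobiusFlow.

(** * The deck group, its partition of unity, and Stokes for invariant forms *)

Section DeckGroup.
Variables (R : realType) (Sigma : marked_surface R).
Local Notation C := R[i].
Local Notation I := (0 +i* 1).
Local Notation act := (@deck R Sigma).
Local Notation G := (pi1 Sigma).
Implicit Types (f k : C -> R) (z w : C) (g h : G).

Lemma deck_mob g : exists a b : C, sqmod a - sqmod b = 1 /\
  forall z, disc z -> act g z = mob a b z.
Proof.
have [a [b [ab h]]] := deck_isometry g; exists a, b; split.
  by move: ab; rewrite !mulcJ => /(congr1 (@complex.Re R)); rewrite ReD ReN.
by move=> z dz; rewrite h.
Qed.

Lemma deck_disc g z : disc z -> disc (act g z).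
Proof.
move=> dz; have [a [b [ab ->]]] // := deck_mob g.
by apply: mob_disc => //; rewrite ab ltr01.
Qed.

Lemma deckK g z : disc z -> act g^-1%g (act g z) = z.
Proof. by move=> dz; rewrite -deckM// mulVg deck1. Qed.
Lemma deckVK g z : disc z -> act g (act g^-1%g z) = z.
Proof. by move=> dz; rewrite -deckM// mulgV deck1. Qed.

Lemma CkC_deck n g : CkC n (act g).
Proof.
have [a [b [ab h]]] := deck_mob g.
have ab0 : 0 < sqmod a - sqmod b by rewrite ab ltr01.
by apply: CkC_eq (CkC_mob ab0 n) => z dz; rewrite h.
Qed.

Lemma is_dxC_deck g z : disc z -> is_dxC (act g) z (dxC (act g) z).
Proof. exact: (CkCS_dx (CkC_deck 1 g)). Qed.

Lemma deck_derivE g : exists a b : C, sqmod a - sqmod b = 1 /\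
  forall z, disc z -> [/\ act g z = mob a b z, dxC (act g) z = mobH a b z
    & is_dyC (act g) z (I * dxC (act g) z)].
Proof.
have [a [b [ab h]]] := deck_mob g; exists a, b; split => // z dz.
have ab0 : 0 < sqmod a - sqmod b by rewrite ab ltr01.
have nz : nearC z (fun w => mob a b w = act g w).
  by apply: eqC_disc_near dz => w dw; rewrite h.
have E : dxC (act g) z = mobH a b z := is_dxC_val (is_dxC_near nz (is_dxC_mob ab0 dz)).
split; [exact: h|exact: E|].
by rewrite E; exact: (is_dyC_near nz (is_dyC_mob ab0 dz)).
Qed.

Lemma is_dyC_deck g z : disc z -> is_dyC (act g) z (I * dxC (act g) z).
Proof. by move=> dz; have [a [b [_ /(_ z dz)[_ _]]]] := deck_derivE g. Qed.

Lemma II_deck g f r : r < 1 -> Ck_csupp 1 r f ->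
  II (fun z => f (act g z) * sqmod (dxC (act g) z)) = II f.
Proof.
move=> r1 cf; have [a [b [ab h]]] := deck_derivE g.
rewrite -(II_mob ab r1 cf); apply: eq_II => z dz.
by have [-> -> _] := h z dz; rewrite sqmod_mobH ab expr1n mul1r.
Qed.

(** Invariance of p dx + q dy under pullback by g, written out with the Cauchy-Riemann equations;
    [dxC (act g) z] is the complex derivative of the deck transformation. *)
Definition invariant_form (p q : C -> R) : Prop := forall g z, disc z ->
  p z = p (act g z) * Re (dxC (act g) z) + q (act g z) * Im (dxC (act g) z) /\
  q z = q (act g z) * Re (dxC (act g) z) - p (act g z) * Im (dxC (act g) z).

(** The coefficient of dk /\ (p dx + q dy). *)
Definition dwedge (p q k : C -> R) z : R := dx k z * q z - dy k z * p z.

Lemma dwedge_deck p q k g z : invariant_form p q -> Ck 1 k -> disc z ->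
  dwedge p q (fun w => k (act g w)) z = dwedge p q k (act g z) * sqmod (dxC (act g) z).
Proof.
move=> inv ck dz; rewrite /dwedge.
rewrite (is_dx_val (is_dx_compC (@deck_disc g) ck dz (is_dxC_deck g dz))).
rewrite (is_dy_val (is_dy_compC (@deck_disc g) ck dz (is_dyC_deck g dz))).
have [-> ->] := inv g z dz.
rewrite sqmodE !reimE /=.
move: (dx k _) (dy k _) (p _) (q _) (dx (fun w => Re (act g w)) z) (dx (fun w => Im (act g w)) z) => *; ring.
Qed.

Lemma cont_pos : continuous (fun s : R => Num.max 0 s).
Proof.
by move=> s; apply: continuous_max; [exact: cst_continuous|exact: cvg_id].
Qed.

(** Only s = 0 needs care: the difference quotient there is at most |h|^(n+1), so the truncated
    power glues differentiably once the exponent is at least 2. *)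
Lemma is_derive_pos n (s : R) :
  is_derive s 1 (fun t : R => Num.max 0 t ^+ n.+2) (n.+2%:R * Num.max 0 s ^+ n.+1).
Proof.
have [s0|s0|->] := ltgtP s 0.
- have E : \forall t \near s, cst (0 : R) t = Num.max 0 t ^+ n.+2.
    near=> t; rewrite max_l ?expr0n//; apply: ltW.
    by near: t; exact: lt_nbhsl.
  rewrite expr0n /= mulr0.
  have K : is_derive s (1 : R) (cst (0 : R)) 0 by exact: is_derive_cst.
  exact: near_eq_is_derive K.
- have E : \forall t \near s, (t : R) ^+ n.+2 = Num.max 0 t ^+ n.+2.
    near=> t; rewrite max_r//; apply: ltW.
    by near: t; exact: lt_nbhsr.
  apply: (near_eq_is_derive E).
  have H := is_deriveX n.+2 (is_derive_id s 1).
  have Ef : (@id R) ^+ n.+2 = (fun t : R => t ^+ n.+2) by rewrite exprfctE.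
  rewrite Ef in H.
  apply: is_derive_eq H _; exact: mulr1.
- rewrite expr0n /= mulr0; apply/is_derive_quot.
  apply/cvgr0Pnorm_le => e e0.
  near=> h.
  rewrite addr0 maxxx expr0n /= subr0.
  have h0 : h != 0 by near: h; exact: nbhs_dnbhs_neq.
  have h1 : `|h| <= 1.
    by near: h; exact: dnbhs0_le.
  have he : `|h| <= e.
    by near: h; exact: dnbhs0_le.
  have hm : `|Num.max 0 h| <= `|h|.
    by rewrite /Num.max; case: ifP => // _; rewrite normr0.
  rewrite normrM normrX normfV.
  apply: (@le_trans _ _ (`|h|^-1 * `|h| ^+ n.+2)).
    by rewrite ler_wpM2l ?invr_ge0// lerXn2r ?nnegrE.
  rewrite exprS mulrA mulVf ?normr_eq0// mul1r exprS.
  apply: le_trans he; apply: ler_piMr => //; exact: exprn_ile1.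
Unshelve. all: by end_near. Qed.

Section Partition.
Variables (r0 : R).
Hypotheses (r0_lt1 : r0 < 1)
  (r0_cover : forall z, disc z -> exists g, sqmod (act g z) <= r0).
(** A squared radius strictly between [r0] and 1: the bump is then positive on the disc that meets
    every orbit and still has compact support. *)
Definition rad : R := (r0 + 1) / 2.
Let r1 := rad.

Lemma rad_lt1 : r1 < 1. Proof. by have := r0_lt1; rewrite /r1 /rad; lra. Qed.
Lemma lt_rad : r0 < r1. Proof. by have := r0_lt1; rewrite /r1 /rad; lra. Qed.

Definition bump z : R := Num.max 0 (r1 - sqmod z).

Lemma bump_ge0 z : 0 <= bump z.
Proof. by rewrite /bump le_max lexx. Qed.

Lemma bump_eq0 z : r1 <= sqmod z -> bump z = 0.
Proof. by move=> h; rewrite /bump max_l// subr_le0. Qed.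

Lemma bump_gt0 z : sqmod z < r1 -> 0 < bump z.
Proof. by move=> h; rewrite /bump lt_max subr_gt0 h orbT. Qed.

Lemma cont_bump z : cont_at bump z.
Proof.
have h : cont_at (fun w => r1 - sqmod w) z.
  by apply: contD; [exact: cont_cst|apply: contN; exact: cont_sqmod].
by case: z h => x y h; apply: continuous_comp h _; exact: cont_pos.
Qed.

Lemma is_dx_bump n z : is_dx (fun w => bump w ^+ n.+2) z (n.+2%:R * bump z ^+ n.+1 * (- (2 * Re z))).
Proof.
have h : is_dx (fun w => r1 - sqmod w) z (- (2 * Re z)).
  have := is_dxD (is_dx_cst r1 z) (is_dxN (is_dx_sqmod (is_dxC_id z))).
  by congr is_dx; rewrite /=; ring.
have := @is_derive1_comp _ _ _ _ _ _ (is_derive_pos n _) h.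
by case: z {h}.
Qed.
Lemma is_dy_bump n z : is_dy (fun w => bump w ^+ n.+2) z (n.+2%:R * bump z ^+ n.+1 * (- (2 * Im z))).
Proof.
have h : is_dy (fun w => r1 - sqmod w) z (- (2 * Im z)).
  have := is_dyD (is_dy_cst r1 z) (is_dyN (is_dy_sqmod (is_dyC_id z))).
  by congr is_dy; rewrite /=; ring.
have := @is_derive1_comp _ _ _ _ _ _ (is_derive_pos n _) h.
by case: z {h}.
Qed.

Lemma Ck_bump n : Ck n (fun z => bump z ^+ n.+1).
Proof.
elim: n => [|n IH].
  by split; [move=> z dz; apply: contX; exact: cont_bump|exact Logic.I].
apply: (@CkS_intro _ n _ (fun z => n.+2%:R * bump z ^+ n.+1 * (- (2 * Re z)))
  (fun z => n.+2%:R * bump z ^+ n.+1 * (- (2 * Im z)))).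
- by move=> z _; apply: contX; exact: cont_bump.
- by move=> z _; exact: is_dx_bump.
- by move=> z _; exact: is_dy_bump.
- exact (CkM (CkM (Ck_cst n _) IH) (CkN (CkM (Ck_cst n 2) (Ck_Re R n)))).
- exact (CkM (CkM (Ck_cst n _) IH) (CkN (CkM (Ck_cst n 2) (Ck_Im R n)))).
Qed.

(** Finite by [deck_proper]. For a point with [sqmod z <= r], any other group element moves it out
    of that disc, so a sum over the group of terms vanishing there is a sum over [closes r]. *)
Definition close (r : R) : set G := [set g | exists z, sqmod z <= r /\ sqmod (act g z) <= r].
Definition closes (r : R) : seq G := finmap.enum_fset (fset_set (close r)).

Lemma mem_closes r g : r < 1 -> (g \in closes r) = `[< close r g >].
Proof. by move=> r_1; rewrite /closes in_fset_set; [apply/idP/asboolP; rewrite in_setE|exact: deck_proper]. Qed.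

Lemma fsbig_close r (F : G -> R) z : r < 1 -> sqmod z <= r ->
  (forall g, r < sqmod (act g z) -> F g = 0) ->
  \sum_(g \in [set: G]) F g = \sum_(g <- closes r) F g.
Proof.
move=> r_1 zr F0; rewrite -(fsbig_widen (close r)) ?fsbig_finite//; first exact: deck_proper.
move=> g [_ ng] /=; apply: F0; rewrite ltNge; apply/negP => gz.
by apply: ng; exists z.
Qed.

Variable n : nat.
(** An exponent of at least 3 makes [chi] of class C^2, so that the wedge of its differential with a
    C^1 form is C^1, the regularity under which [II_deck] is available. *)
Let N := n.+3.

Definition bumpsum z : R := \sum_(g \in [set: G]) bump (act g z) ^+ N.

Lemma bumpsum_close r z : r < 1 -> r1 <= r -> sqmod z <= r ->
  bumpsum z = \sum_(g <- closes r) bump (act g z) ^+ N.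
Proof.
move=> r_1 r1r zr; apply: fsbig_close r_1 zr _ => g gz.
by rewrite bump_eq0 ?expr0n//; apply: le_trans r1r (ltW gz).
Qed.

Lemma bumpsum_deck g z : disc z -> bumpsum (act g z) = bumpsum z.
Proof.
move=> dz; rewrite /bumpsum [RHS](@reindex_fsbigT _ _ _ _ _ (fun h : G => (h * g)%g)).
  by apply: eq_fsbigr => h _; rewrite deckM.
by exists (fun h : G => (h * g^-1)%g) => h; rewrite -mulgA ?mulgV ?mulVg mulg1.
Qed.

Lemma bumpsum_gt0 z : disc z -> 0 < bumpsum z.
Proof.
move=> dz; have [g gz] := r0_cover dz.
pose r := Num.max r1 (sqmod z).
have r_1 : r < 1 by rewrite /r gt_max rad_lt1.
have r1r : r1 <= r by rewrite /r le_max lexx.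
have zr : sqmod z <= r by rewrite /r le_max lexx orbT.
rewrite (bumpsum_close r_1 r1r zr).
have gr : g \in closes r.
  rewrite mem_closes//; apply/asboolP; exists z; split=> //.
  by apply: le_trans gz _; apply: le_trans r1r; exact: ltW lt_rad.
rewrite (big_rem g)//=; apply: ltr_wpDr; first by apply: sumr_ge0 => h _; rewrite exprn_ge0// bump_ge0.
by rewrite exprn_gt0// bump_gt0// (le_lt_trans gz)// lt_rad.
Qed.

Lemma Ck_bumpsum : Ck 2 bumpsum.
Proof.
apply: Ck_local => z dz.
(* The midpoint of [sqmod z] and 1 lies strictly above [sqmod z], so the single list [closes r]
   computes the sum on a whole neighbourhood of z. *)
pose r := Num.max r1 ((1 + sqmod z) / 2).
have dz' : sqmod z < 1 := dz.
have r_1 : r < 1 by rewrite /r gt_max rad_lt1; lra.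
have r1r : r1 <= r by rewrite /r le_max lexx.
have zr : sqmod z < r by rewrite /r lt_max; apply/orP; right; lra.
exists (fun w => \sum_(g <- closes r) bump (act g w) ^+ N).
  apply: Ck_sum => g.
  exact (Ck_compC (@deck_disc g) (Ck_le (isT : (2 <= n.+2)%N) (Ck_bump n.+2)) (CkC_deck 2 g)).
have hn : nearC z (fun w => sqmod w < r) by apply: cont_lt zr; exact: cont_sqmod.
apply: filterS hn => p pr.
by rewrite (bumpsum_close r_1 r1r (ltW pr)).
Qed.

Definition chi z : R := bump z ^+ N / bumpsum z.

Lemma Ck_chi : Ck 2 chi.
Proof.
have h : forall z, disc z -> bumpsum z != 0 by move=> z dz; rewrite gt_eqF ?bumpsum_gt0.
have hb : Ck 2 (fun z => bump z ^+ N).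
  exact (Ck_le (isT : (2 <= n.+2)%N) (Ck_bump n.+2)).
exact (CkM hb (CkV h Ck_bumpsum)).
Qed.

Lemma chi_eq0 z : r1 <= sqmod z -> chi z = 0.
Proof. by move=> h; rewrite /chi bump_eq0// expr0n mul0r. Qed.

Lemma csupp_chi : csupp r1 chi.
Proof. by move=> z _ h; rewrite chi_eq0// ltW. Qed.

Lemma chi_sum z : disc z -> sqmod z <= r1 -> \sum_(g <- closes r1) chi (act g z) = 1.
Proof.
move=> dz zr; rewrite -(divff (lt0r_neq0 (bumpsum_gt0 dz))).
rewrite {1}(bumpsum_close rad_lt1 (lexx _) zr) mulr_suml.
by apply: eq_bigr => g _; rewrite /chi bumpsum_deck.
Qed.

(** The defining condition is symmetric in z and [act g z]. The symmetry is wanted because a change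
    of variables turns translates by g into translates by its inverse. *)
Lemma closes_inv : perm_eq [seq g^-1%g | g <- closes r1] (closes r1).
Proof.
apply: uniq_perm; [by rewrite map_inj_uniq ?finmap.fset_uniq//; exact: invg_inj|exact: finmap.fset_uniq|].
have inv g : close r1 g -> close r1 g^-1%g.
  move=> [z [z1 z2]]; exists (act g z); split=> //.
  by rewrite deckK//; exact: le_lt_trans z1 rad_lt1.
move=> g; rewrite (mem_closes _ rad_lt1); apply/mapP/asboolP.
  by move=> [h]; rewrite (mem_closes _ rad_lt1) => /asboolP hh ->; exact: inv.
move=> gh; exists g^-1%g; last by rewrite invgK.
by rewrite (mem_closes _ rad_lt1); apply/asboolP; exact: inv.
Qed.

Lemma chi_sumV z : disc z -> sqmod z <= r1 -> \sum_(g <- closes r1) chi (act g^-1%g z) = 1.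
Proof.
move=> dz zr; rewrite -(chi_sum dz zr) -(perm_big _ closes_inv) /=.
by rewrite big_map; apply: eq_bigr => g _; rewrite invgK.
Qed.

Lemma is_dx_sum (T : Type) (s : seq T) (F : T -> C -> R) z (d : T -> R) :
  (forall i, is_dx (F i) z (d i)) -> is_dx (fun w => \sum_(i <- s) F i w) z (\sum_(i <- s) d i).
Proof.
move=> h; elim: s => [|i s IH].
  by apply: (isd_eq (@is_dx_cst _ 0 z)) => [w|]; rewrite big_nil.
by apply: (isd_eq (is_dxD (h i) IH)) => [w|]; rewrite big_cons.
Qed.
Lemma is_dy_sum (T : Type) (s : seq T) (F : T -> C -> R) z (d : T -> R) :
  (forall i, is_dy (F i) z (d i)) -> is_dy (fun w => \sum_(i <- s) F i w) z (\sum_(i <- s) d i).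
Proof.
move=> h; elim: s => [|i s IH].
  by apply: (isd_eq (@is_dy_cst _ 0 z)) => [w|]; rewrite big_nil.
by apply: (isd_eq (is_dyD (h i) IH)) => [w|]; rewrite big_cons.
Qed.

Variables p q : C -> R.
Hypotheses (cp : Ck 1 p) (cq : Ck 1 q) (inv : invariant_form p q).

Lemma Ck_dwedge k : Ck 2 k -> Ck 1 (dwedge p q k).
Proof. by move=> ck; exact (CkB (CkM (Ck_dx ck) cq) (CkM (Ck_dy ck) cp)). Qed.

Lemma csupp_dwedge r k : csupp r k -> csupp r (dwedge p q k).
Proof.
by move=> sk z dz rz; rewrite /dwedge (csupp_dx sk dz rz) (csupp_dy sk dz rz) !mul0r subr0.
Qed.

Let chig g z := chi (act g z).

Lemma Ck_chig g : Ck 2 (chig g).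
Proof. exact (Ck_compC (@deck_disc g) Ck_chi (CkC_deck 2 g)). Qed.

(** Either [chi z] is zero, or the squared modulus is below [r1] near z, where the translates sum to
    the constant 1 and their differentials sum to 0. *)
Lemma dwedge_chi_sum z : disc z ->
  chi z * \sum_(g <- closes r1) dwedge p q (chig g^-1%g) z = 0.
Proof.
move=> dz; have [zr|zr] := leP r1 (sqmod z); first by rewrite chi_eq0// mul0r.
have near1 : nearC z (fun w => 1 = \sum_(g <- closes r1) chig g^-1%g w).
  have hn : nearC z (fun w => disc w /\ sqmod w < r1).
    by apply: filterI; [exact: disc_near|apply: cont_lt zr; exact: cont_sqmod].
  by apply: filterS hn => w [dw wr]; rewrite /chig chi_sumV// ltW.
have c1 g : Ck 1 (chig g^-1%g) := CkW (Ck_chig _).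
have X0 : \sum_(g <- closes r1) dx (chig g^-1%g) z = 0.
  rewrite -(is_dx_val (is_dx_sum (closes r1) (fun g => CkS_dx (c1 g) dz))).
  by rewrite -(dx_near near1); exact: (is_dx_val (is_dx_cst 1 z)).
have Y0 : \sum_(g <- closes r1) dy (chig g^-1%g) z = 0.
  rewrite -(is_dy_val (is_dy_sum (closes r1) (fun g => CkS_dy (c1 g) dz))).
  by rewrite -(dy_near near1); exact: (is_dy_val (is_dy_cst 1 z)).
by rewrite /dwedge sumrB -!mulr_suml X0 Y0 !mul0r subr0 mulr0.
Qed.

(** Insert the sum of the translates chi o g, equal to 1 on the support of [chi], and move each term
    by the inverse of g: by invariance, chi o g times d chi becomes chi times d (chi o g^-1). These
    differentials sum to 0 wherever [chi] is nonzero. *)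
Lemma II_dwedge_chi : II (dwedge p q chi) = 0.
Proof.
pose F g z := chig g z * dwedge p q chi z.
have cF g : Ck_csupp 1 r1 (F g).
  split; first exact (CkM (CkW (Ck_chig g)) (Ck_dwedge Ck_chi)).
  by move=> z dz zr; rewrite /F (csupp_dwedge csupp_chi dz zr) mulr0.
have E : forall z, disc z -> dwedge p q chi z = \sum_(g <- closes r1) F g z.
  move=> z dz; rewrite /F -mulr_suml.
  have [zr|zr] := leP (sqmod z) r1; first by rewrite chi_sum// mul1r.
  by rewrite (csupp_dwedge csupp_chi dz zr) mulr0.
rewrite (eq_II E) (II_sum _ rad_lt1); last by move=> g; split; [exact (CkW (cF g).1)|exact (cF g).2].
pose F' g z := chi z * dwedge p q (chig g^-1%g) z.
have EF g : II (F g) = II (F' g).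
  rewrite -(II_deck g^-1%g rad_lt1 (cF g)); apply: eq_II => z dz.
  rewrite /F /F' /chig deckVK// -mulrA; congr (_ * _).
  by rewrite (dwedge_deck _ inv (CkW Ck_chi) dz).
under eq_bigr do rewrite EF.
rewrite -(II_sum _ rad_lt1).
  rewrite -[RHS](II0 R); apply: eq_II => z dz.
  by rewrite /F' -mulr_sumr dwedge_chi_sum.
move=> g; split.
  exact (CkM (Ck_le (isT : (0 <= 2)%N) Ck_chi) (CkW (Ck_dwedge (Ck_chig _)))).
by move=> z dz zr; rewrite /F' (csupp_chi dz zr) mul0r.
Qed.

(** The product rule: chi d eta is d (chi eta) minus d chi /\ eta. The first has a compactly
    supported primitive, the second is [II_dwedge_chi]. *)
Lemma II_chi_exact : II (fun z => chi z * (dx q z - dy p z)) = 0.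
Proof.
have c1 : Ck_csupp 1 r1 (fun z => chi z * q z).
  by split; [exact (CkM (CkW Ck_chi) cq)|move=> z dz zr; rewrite (csupp_chi dz zr) mul0r].
have c2 : Ck_csupp 1 r1 (fun z => chi z * p z).
  by split; [exact (CkM (CkW Ck_chi) cp)|move=> z dz zr; rewrite (csupp_chi dz zr) mul0r].
have d1 := Ck_csupp_dx c1; have d2 := Ck_csupp_dy c2.
have cw : Ck_csupp 0 r1 (dwedge p q chi).
  by split; [exact (CkW (Ck_dwedge Ck_chi))|exact: csupp_dwedge csupp_chi].
have cB : Ck_csupp 0 r1 (fun z => dx (fun w => chi w * q w) z - dy (fun w => chi w * p w) z).
  by split; [exact (CkB d1.1 d2.1)|move=> z dz zr; rewrite (d1.2 z dz zr) (d2.2 z dz zr) subr0].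
transitivity (II (fun z => (dx (fun w => chi w * q w) z - dy (fun w => chi w * p w) z) - dwedge p q chi z)).
  apply: eq_II => z dz.
  rewrite (is_dx_val (is_dxM (CkS_dx (CkW Ck_chi) dz) (CkS_dx cq dz))).
  rewrite (is_dy_val (is_dyM (CkS_dy (CkW Ck_chi) dz) (CkS_dy cp dz))).
  rewrite /dwedge; move: (dx chi z) (dy chi z) (dx q z) (dy p z) (chi z) (p z) (q z) => *; ring.
rewrite (IIB rad_lt1 cB cw) (IIB rad_lt1 d1 d2) (II_dx rad_lt1 c1) (II_dy rad_lt1 c2).
by rewrite II_dwedge_chi !subr0.
Qed.

End Partition.
End DeckGroup.

(** * Lifts to the negative vectors and the primitive of the pulled-back form *)

Section Lifts.
Variable (R : realType).
Local Notation C := R[i].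
Local Notation I := (0 +i* 1).
Local Notation V := 'cV[C]_3.
Implicit Types (z w : C) (u v : V).

Lemma hermDl u v (w : V) : herm (u + v) w = herm u w + herm v w :> C.
Proof. by rewrite /herm !mxE; ring. Qed.
Lemma hermDr u v (w : V) : herm w (u + v) = herm w u + herm w v :> C.
Proof. by rewrite /herm !mxE !conjcD; ring. Qed.
Lemma hermZl (a : C) u v : herm (a *: u) v = a * herm u v.
Proof. by rewrite /herm !mxE; ring. Qed.
Lemma hermZr (a : C) u v : herm u (a *: v) = conjc a * herm u v.
Proof. by rewrite /herm !mxE !conjcM; ring. Qed.
Lemma hermC u v : herm v u = conjc (herm u v).
Proof.
have e (a b c : C) : conjc (a + b - c) = conjc a + conjc b - conjc c.
  by apply: complex_ext; rewrite !reimE; ring.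
by rewrite /herm e !conjcM !conjcK; ring.
Qed.

(* The reverse Cauchy-Schwarz inequality on negative vectors. *)
Lemma herm_neq0 u v : herm u u = -1 -> herm v v = -1 -> herm u v != 0.
Proof.
rewrite /herm !mulcJ => hu hv; apply/eqP => h.
set a1 := u 0 0 in hu h; set a2 := u 1 0 in hu h; set a3 := u ord_max 0 in hu h.
set b1 := v 0 0 in hv h; set b2 := v 1 0 in hv h; set b3 := v ord_max 0 in hv h.
have eu : sqmod a1 + sqmod a2 - sqmod a3 = -1.
  by have := congr1 (@complex.Re R) hu; rewrite !reimE.
have ev : sqmod b1 + sqmod b2 - sqmod b3 = -1.
  by have := congr1 (@complex.Re R) hv; rewrite !reimE.
have e3 : a3 * conjc b3 = a1 * conjc b1 + a2 * conjc b2.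
  by apply/eqP; rewrite eq_sym -subr_eq0 h.
have s3 : sqmod a3 * sqmod b3 = sqmod (a1 * conjc b1 + a2 * conjc b2).
  by rewrite -e3 sqmodM sqmodJ.
(* Lagrange's identity. If the product vanished, the right side would be at least
   [sqmod a3 * sqmod b3], although each of these two factors exceeds its counterpart by 1. *)
have lag : sqmod (a1 * conjc b1 + a2 * conjc b2) + sqmod (a1 * b2 - a2 * b1)
    = (sqmod a1 + sqmod a2) * (sqmod b1 + sqmod b2).
  by rewrite !sqmodE !reimE; ring.
have := sqmod_ge0 (a1 * b2 - a2 * b1); move: lag; rewrite -s3.
have p1 := sqmod_ge0 a1; have p2 := sqmod_ge0 a2; have q1 := sqmod_ge0 b1; have q2 := sqmod_ge0 b2.
move: (sqmod (a1 * b2 - a2 * b1)) (sqmod a1) (sqmod a2) (sqmod a3) (sqmod b1) (sqmod b2) (sqmod b3) eu ev p1 p2 q1 q2.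
move=> L A1 A2 A3 B1 B2 B3 eu ev p1 p2 q1 q2.
have -> : A3 = A1 + A2 + 1 by lra.
have -> : B3 = B1 + B2 + 1 by lra.
nra.
Qed.

(* The 1-form <du1,u1> - <du0,u0> - d log <u0,u1>, where u0' and u1' are the
   derivatives of u0 and u1 along a tangent vector. *)
Definition lift_form u0 u0' u1 u1' : C :=
  herm u1' u1 - herm u0' u0 - (herm u0' u1 + herm u0 u1') / herm u0 u1.

(** The coefficients are real because [<u0, u1'>] is conjugate-linear in [u1']. *)
Lemma lift_form_lin u0 u1 a0 a1 b0 b1 (c d : R) :
  lift_form u0 (c%:C *: a0 + d%:C *: b0) u1 (c%:C *: a1 + d%:C *: b1) =
  c%:C * lift_form u0 a0 u1 a1 + d%:C * lift_form u0 b0 u1 b1.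
Proof.
rewrite /lift_form !hermDl !hermDr !hermZl !hermZr.
have cr (x : R) : conjc x%:C = x%:C by apply: complex_ext; rewrite !reimE /= ?oppr0.
rewrite !cr; move: (herm u0 u1)^-1 => f; ring.
Qed.

(** The phase [l] adds [- l' * conjc l] through [<du1, u1>], since [<u1, u1> = -1], and
    [- l * conjc l'] through the logarithm. The sum is minus the derivative of [l * conjc l = 1]. *)
Lemma lift_form_inv (rho : 'M[C]_3) u0 u0' u1 u1' (l l' : C) :
  (forall u v, herm (rho *m u) (rho *m v) = herm u v) ->
  herm u1 u1 = -1 -> herm u0 u1 != 0 -> l * conjc l = 1 -> l' * conjc l + l * conjc l' = 0 ->
  lift_form (rho *m u0) (rho *m u0') (l *: (rho *m u1)) (l' *: (rho *m u1) + l *: (rho *m u1'))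
  = lift_form u0 u0' u1 u1'.
Proof.
move=> hrho h1 f0 ll lk; rewrite /lift_form !hermDl !hermDr !hermZl !hermZr !hrho h1.
have l0 : conjc l != 0.
  by apply/eqP => e; move: ll; rewrite e mulr0 => /eqP; rewrite eq_sym oner_eq0.
have e1 : conjc l' = - (l' * conjc l) * conjc l.
  have := congr1 (fun x => x * conjc l) lk; rewrite mul0r mulrDl (mulrAC l) ll mul1r.
  by move=> /eqP; rewrite addrC addr_eq0 => /eqP ->; rewrite mulNr.
have e2 : l = (conjc l)^-1 by apply: (mulIf l0); rewrite ll mulVf.
rewrite e1; move: (conjc l) l0 e2 => m m0 ->.
by field; rewrite f0 m0.
Qed.

Section SmoothVector.
Variable u : C -> V.
Hypothesis su : smoothM u.
Definition vdx z : V := mxderiv (@dxC R) u z.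
Definition vdy z : V := mxderiv (@dyC R) u z.

Lemma vector_CkC n i : CkC n (fun w => u w i 0).
Proof. exact: smoothC_CkC. Qed.
Lemma vdxE z i : vdx z i 0 = dxC (fun w => u w i 0) z. Proof. by rewrite mxE. Qed.
Lemma vdyE z i : vdy z i 0 = dyC (fun w => u w i 0) z. Proof. by rewrite mxE. Qed.
Lemma is_dxC_vec z i : disc z -> is_dxC (fun w => u w i 0) z (vdx z i 0).
Proof. by rewrite vdxE; exact: (CkCS_dx (vector_CkC 1 i)). Qed.
Lemma is_dyC_vec z i : disc z -> is_dyC (fun w => u w i 0) z (vdy z i 0).
Proof. by rewrite vdyE; exact: (CkCS_dy (vector_CkC 1 i)). Qed.
Lemma CkC_vdx n i : CkC n (fun w => vdx w i 0).
Proof. by apply: CkC_eq (CkC_dx (vector_CkC n.+1 i)) => z _; rewrite vdxE. Qed.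
Lemma CkC_vdy n i : CkC n (fun w => vdy w i 0).
Proof. by apply: CkC_eq (CkC_dy (vector_CkC n.+1 i)) => z _; rewrite vdyE. Qed.

Definition vdxy z : V := \col_i dyC (fun w => vdx w i 0) z.
Lemma is_dyC_vdx z i : disc z -> is_dyC (fun w => vdx w i 0) z (vdxy z i 0).
Proof. by rewrite mxE; exact: (CkCS_dy (CkC_vdx 1 i)). Qed.
Lemma is_dxC_vdy z i : disc z -> is_dxC (fun w => vdy w i 0) z (vdxy z i 0).
Proof.
move=> dz; have h := CkCS_dx (CkC_vdy 1 i) dz.
have E : dxC (fun w => vdy w i 0) z = vdxy z i 0.
  have -> : (fun w => vdy w i 0) = dyC (fun w => u w i 0) by apply/funext => w; rewrite vdyE.
  rewrite mxE; have -> : (fun w => vdx w i 0) = dxC (fun w => u w i 0) by apply/funext => w; rewrite vdxE.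
  exact: (dxCdyCC (vector_CkC 2 i) dz).
by rewrite -E.
Qed.

Hypothesis uS : forall z, disc z -> herm (u z) (u z) = -1.

Lemma herm_vdx z : disc z -> Re (herm (vdx z) (u z)) = 0.
Proof.
move=> dz; have h := is_dxC_herm (fun i => is_dxC_vec i dz) (fun i => is_dxC_vec i dz).
have n1 : nearC z (fun w => -1 = herm (u w) (u w)) by apply: eqC_disc_near dz => w /uS ->.
have := is_dxC_near n1 (is_dxC_cst (-1) z) => /is_dxC_val; rewrite (is_dxC_val h).
by rewrite (hermC (vdx z)) => /(congr1 (@complex.Re R)); rewrite !reimE /=; lra.
Qed.
Lemma herm_vdy z : disc z -> Re (herm (vdy z) (u z)) = 0.
Proof.
move=> dz; have h := is_dyC_herm (fun i => is_dyC_vec i dz) (fun i => is_dyC_vec i dz).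
have n1 : nearC z (fun w => -1 = herm (u w) (u w)) by apply: eqC_disc_near dz => w /uS ->.
have := is_dyC_near n1 (is_dyC_cst (-1) z) => /is_dyC_val; rewrite (is_dyC_val h).
by rewrite (hermC (vdy z)) => /(congr1 (@complex.Re R)); rewrite !reimE /=; lra.
Qed.

(** The horizontal projections add [<u_x, u>] times the conjugate of [<u_y, u>]. Both factors are
    imaginary, because [<u, u>] is constant, so the correction is real. *)
Lemma pullback_omegaE z : disc z -> pullback_omega u z = Im (herm (vdx z) (vdy z)).
Proof.
move=> dz; rewrite /pullback_omega /horizontal -/(vdx z) -/(vdy z).
rewrite !hermDl !hermDr !hermZl !hermZr (uS dz) (hermC (vdy z) (u z)).
have := herm_vdx dz; have := herm_vdy dz.
move: (herm (vdx z) (vdy z)) (herm (vdx z) (u z)) (herm (vdy z) (u z)) => a b c hc hb.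
by rewrite !reimE /= hc hb; ring.
Qed.

End SmoothVector.

Section TwoLifts.
Variables u0 u1 : C -> V.
Hypotheses (su0 : smoothM u0) (su1 : smoothM u1).
Hypotheses (S0 : forall z, disc z -> herm (u0 z) (u0 z) = -1)
           (S1 : forall z, disc z -> herm (u1 z) (u1 z) = -1).
Let f z := herm (u0 z) (u1 z).
Let f_neq0 z : disc z -> f z != 0.
Proof. by move=> dz; apply: herm_neq0; [exact: S0|exact: S1]. Qed.

Definition formx z : C := lift_form (u0 z) (vdx u0 z) (u1 z) (vdx u1 z).
Definition formy z : C := lift_form (u0 z) (vdy u0 z) (u1 z) (vdy u1 z).

Lemma CkC_formx n : CkC n formx.
Proof.
have c0 := vector_CkC su0 n; have c1 := vector_CkC su1 n.
have d0 := CkC_vdx su0 n; have d1 := CkC_vdx su1 n.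
exact (CkCB (CkCB (CkC_herm d1 c1) (CkC_herm d0 c0))
  (CkCM (CkCD (CkC_herm d0 c1) (CkC_herm c0 d1)) (CkCV f_neq0 (CkC_herm c0 c1)))).
Qed.
Lemma CkC_formy n : CkC n formy.
Proof.
have c0 := vector_CkC su0 n; have c1 := vector_CkC su1 n.
have d0 := CkC_vdy su0 n; have d1 := CkC_vdy su1 n.
exact (CkCB (CkCB (CkC_herm d1 c1) (CkC_herm d0 c0))
  (CkCM (CkCD (CkC_herm d0 c1) (CkC_herm c0 d1)) (CkCV f_neq0 (CkC_herm c0 c1)))).
Qed.

(** The logarithmic term is closed and the mixed second derivatives cancel by symmetry; only the
    exterior derivatives of [<du1, u1>] and [<du0, u0>] remain. *)
Lemma form_exact z : disc z -> dxC formy z - dyC formx z =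
  (herm (vdy u1 z) (vdx u1 z) - herm (vdx u1 z) (vdy u1 z))
  - (herm (vdy u0 z) (vdx u0 z) - herm (vdx u0 z) (vdy u0 z)).
Proof.
move=> dz; have f0 := f_neq0 dz.
have x0 i := is_dxC_vec su0 i dz; have x1 i := is_dxC_vec su1 i dz.
have y0 i := is_dyC_vec su0 i dz; have y1 i := is_dyC_vec su1 i dz.
have xy0 i := is_dyC_vdx su0 i dz; have xy1 i := is_dyC_vdx su1 i dz.
have yx0 i := is_dxC_vdy su0 i dz; have yx1 i := is_dxC_vdy su1 i dz.
have hx := is_dxCB (is_dxCB (is_dxC_herm yx1 x1) (is_dxC_herm yx0 x0))
  (is_dxCM (is_dxCD (is_dxC_herm yx0 x1) (is_dxC_herm x0 yx1)) (is_dxCV f0 (is_dxC_herm x0 x1))).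
have hy := is_dyCB (is_dyCB (is_dyC_herm xy1 y1) (is_dyC_herm xy0 y0))
  (is_dyCM (is_dyCD (is_dyC_herm xy0 y1) (is_dyC_herm y0 xy1)) (is_dyCV f0 (is_dyC_herm y0 y1))).
rewrite (is_dxC_val hx) (is_dyC_val hy).
rewrite -/(f z); move: (f z) f0; clear => F F0.
move: (u0 z) (u1 z) (vdx u0 z) (vdy u0 z) (vdx u1 z) (vdy u1 z) (vdxy u0 z) (vdxy u1 z).
move=> a b ax ay bx by_ axy bxy.
by field.
Qed.

(** Each bracket of [form_exact] is a number minus its conjugate, which is the origin of the factor
    2. *)
Lemma form_exact_im z : disc z ->
  dx (fun w => Im (formy w)) z - dy (fun w => Im (formx w)) z =
  - 2 * (pullback_omega u1 z - pullback_omega u0 z).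
Proof.
move=> dz; have E := congr1 (@complex.Im R) (form_exact dz); rewrite ImD ImN in E.
rewrite (pullback_omegaE su0 S0 dz) (pullback_omegaE su1 S1 dz).
change (Im (dxC formy z) - Im (dyC formx z) =
  - 2 * (Im (herm (vdx u1 z) (vdy u1 z)) - Im (herm (vdx u0 z) (vdy u0 z)))).
rewrite E (hermC (vdx u1 z)) (hermC (vdx u0 z)).
move: (herm (vdx u1 z) _) (herm (vdx u0 z) _) => a b.
by rewrite !reimE; ring.
Qed.

Variable Sigma : marked_surface R.
Local Notation act := (@deck R Sigma).
Variable rho : pi1 Sigma -> 'M[C]_3.
Hypothesis rho_herm : forall g u v, herm (rho g *m u) (rho g *m v) = herm u v.
Hypothesis equiv0 : forall g z, disc z -> u0 (act g z) = rho g *m u0 z.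
Hypothesis equiv1 : forall g z, disc z -> exists l : C, u1 (act g z) = l *: (rho g *m u1 z).

(** The scalar of [equiv1], recovered by pairing with a vector of square -1, whence the sign. This
    expression shows that it depends smoothly on z. *)
Definition phase g z : C := - herm (u1 (act g z)) (rho g *m u1 z).

Lemma equiv1_phase g z : disc z -> u1 (act g z) = phase g z *: (rho g *m u1 z).
Proof.
move=> dz; have [l e] := equiv1 g dz; rewrite {1}e; congr (_ *: _).
by rewrite /phase e hermZl rho_herm S1// mulrN1 opprK.
Qed.

Lemma phaseJ g z : disc z -> phase g z * conjc (phase g z) = 1.
Proof.
move=> dz; have := S1 (deck_disc g dz).
rewrite equiv1_phase// hermZl hermZr rho_herm S1// !mulrN1 mulrN => /eqP.
by rewrite eqr_opp => /eqP.
Qed.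

Lemma is_dxC_sum (T : Type) (s : seq T) (F : T -> C -> C) z (d : T -> C) :
  (forall i, is_dxC (F i) z (d i)) -> is_dxC (fun w => \sum_(i <- s) F i w) z (\sum_(i <- s) d i).
Proof.
move=> h; elim: s => [|i s IH].
  rewrite big_nil; have := is_dxC_cst 0 z; congr is_dxC.
  by apply/funext => w; rewrite big_nil.
rewrite big_cons; have := is_dxCD (h i) IH; congr is_dxC.
by apply/funext => w; rewrite big_cons.
Qed.
Lemma is_dyC_sum (T : Type) (s : seq T) (F : T -> C -> C) z (d : T -> C) :
  (forall i, is_dyC (F i) z (d i)) -> is_dyC (fun w => \sum_(i <- s) F i w) z (\sum_(i <- s) d i).
Proof.
move=> h; elim: s => [|i s IH].
  rewrite big_nil; have := is_dyC_cst 0 z; congr is_dyC.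
  by apply/funext => w; rewrite big_nil.
rewrite big_cons; have := is_dyCD (h i) IH; congr is_dyC.
by apply/funext => w; rewrite big_cons.
Qed.

Lemma is_dxC_mulmx (M : 'M[C]_3) (u : C -> V) z (d : V) :
  (forall i, is_dxC (fun w => u w i 0) z (d i 0)) ->
  forall i, is_dxC (fun w => (M *m u w) i 0) z ((M *m d) i 0).
Proof.
move=> h i; have := is_dxC_sum (index_enum 'I_3) (fun j => is_dxCM (is_dxC_cst (M i j) z) (h j)).
congr is_dxC; first by apply/funext => w; rewrite mxE.
by rewrite mxE; apply: eq_bigr => j _; rewrite mul0r add0r.
Qed.
Lemma is_dyC_mulmx (M : 'M[C]_3) (u : C -> V) z (d : V) :
  (forall i, is_dyC (fun w => u w i 0) z (d i 0)) ->
  forall i, is_dyC (fun w => (M *m u w) i 0) z ((M *m d) i 0).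
Proof.
move=> h i; have := is_dyC_sum (index_enum 'I_3) (fun j => is_dyCM (is_dyC_cst (M i j) z) (h j)).
congr is_dyC; first by apply/funext => w; rewrite mxE.
by rewrite mxE; apply: eq_bigr => j _; rewrite mul0r add0r.
Qed.

Lemma CkC_deck_vec (u : C -> V) g n i : smoothM u -> CkC n (fun w => u (act g w) i 0).
Proof.
move=> su; have [a b] := vector_CkC su n i.
by split; [exact (Ck_compC (@deck_disc _ _ g) a (CkC_deck n g))|exact (Ck_compC (@deck_disc _ _ g) b (CkC_deck n g))].
Qed.

Lemma is_dxC_deck_vec (u : C -> V) g z i : smoothM u -> disc z ->
  is_dxC (fun w => u (act g w) i 0) z
    (((Re (dxC (act g) z))%:C *: vdx u (act g z) + (Im (dxC (act g) z))%:C *: vdy u (act g z)) i 0).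
Proof.
move=> su dz; have [a b] := vector_CkC su 1 i.
have h := is_dxC_deck g dz; have dd := @deck_disc _ _ g.
have := conj (is_dx_compC dd a dz h) (is_dx_compC dd b dz h).
congr (_ /\ _); congr is_dx; rewrite !mxE.
- rewrite -[LHS]/(Re (dxC (fun w => u w i 0) (act g z)) * Re (dxC (act g) z) + Re (dyC (fun w => u w i 0) (act g z)) * Im (dxC (act g) z)).
  move: (dxC (fun w => u w i 0) _) (dyC (fun w => u w i 0) _) (dxC (act g) z).
  by clear=> d1 d2 h; rewrite !reimE /=; ring.
- rewrite -[LHS]/(Im (dxC (fun w => u w i 0) (act g z)) * Re (dxC (act g) z) + Im (dyC (fun w => u w i 0) (act g z)) * Im (dxC (act g) z)).
  move: (dxC (fun w => u w i 0) _) (dyC (fun w => u w i 0) _) (dxC (act g) z).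
  by clear=> d1 d2 h; rewrite !reimE /=; ring.
Qed.
Lemma is_dyC_deck_vec (u : C -> V) g z i : smoothM u -> disc z ->
  is_dyC (fun w => u (act g w) i 0) z
    (((- Im (dxC (act g) z))%:C *: vdx u (act g z) + (Re (dxC (act g) z))%:C *: vdy u (act g z)) i 0).
Proof.
move=> su dz; have [a b] := vector_CkC su 1 i.
have h := is_dyC_deck g dz; have dd := @deck_disc _ _ g.
have := conj (is_dy_compC dd a dz h) (is_dy_compC dd b dz h).
congr (_ /\ _); congr is_dy; rewrite !mxE.
- rewrite -[LHS]/(Re (dxC (fun w => u w i 0) (act g z)) * Re (I * dxC (act g) z) + Re (dyC (fun w => u w i 0) (act g z)) * Im (I * dxC (act g) z)).
  move: (dxC (fun w => u w i 0) _) (dyC (fun w => u w i 0) _) (dxC (act g) z).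
  by clear=> d1 d2 h; rewrite !reimE /=; ring.
- rewrite -[LHS]/(Im (dxC (fun w => u w i 0) (act g z)) * Re (I * dxC (act g) z) + Im (dyC (fun w => u w i 0) (act g z)) * Im (I * dxC (act g) z)).
  move: (dxC (fun w => u w i 0) _) (dyC (fun w => u w i 0) _) (dxC (act g) z).
  by clear=> d1 d2 h; rewrite !reimE /=; ring.
Qed.

Lemma CkC_phase n g : CkC n (phase g).
Proof.
apply: CkCN; apply: CkC_herm => i; first exact: CkC_deck_vec.
apply: CkC_eq (CkC_sum (index_enum 'I_3) (fun j => CkCM (CkC_cst n (rho g i j)) (vector_CkC su1 n j))) => w _.
by rewrite mxE.
Qed.

Lemma vec_eq (u v : V) : (forall i, u i 0 = v i 0) -> u = v.
Proof. by move=> h; apply/colP. Qed.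

(** The x-derivatives of [u0] and [u1] composed with g are computed twice, by the chain rule and
    from equivariance. Equating the results reduces invariance to [lift_form_inv]. *)
Lemma form_invariant_x g z : disc z ->
  formx z = (Re (dxC (act g) z))%:C * formx (act g z) + (Im (dxC (act g) z))%:C * formy (act g z).
Proof.
move=> dz; rewrite -lift_form_lin.
set w0 := _ + _ : V; set w1 := _ + _ : V.
have h0 : w0 = rho g *m vdx u0 z.
  apply: vec_eq => i; have a := is_dxC_deck_vec g i su0 dz.
  have b := is_dxC_mulmx (rho g) (fun i => is_dxC_vec su0 i dz) i.
  have n0 : nearC z (fun w => (rho g *m u0 w) i 0 = u0 (act g w) i 0).
    by apply: eqC_disc_near dz => w dw; rewrite equiv0.
  by rewrite -(is_dxC_val (is_dxC_near n0 b)) (is_dxC_val a).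
have dl := CkCS_dx (CkC_phase 1 g) dz.
have h1 : w1 = dxC (phase g) z *: (rho g *m u1 z) + phase g z *: (rho g *m vdx u1 z).
  apply: vec_eq => i; have a := is_dxC_deck_vec g i su1 dz.
  have b := is_dxCM dl (is_dxC_mulmx (rho g) (fun i => is_dxC_vec su1 i dz) i).
  have n0 : nearC z (fun w => phase g w * (rho g *m u1 w) i 0 = u1 (act g w) i 0).
    by apply: eqC_disc_near dz => w dw; rewrite equiv1_phase// [RHS]mxE.
  by rewrite -(is_dxC_val a) (is_dxC_val (is_dxC_near n0 b)) !mxE.
have h2 : dxC (phase g) z * conjc (phase g z) + phase g z * conjc (dxC (phase g) z) = 0.
  have b := is_dxCM dl (is_dxCJ dl).
  have n0 : nearC z (fun w => 1 = phase g w * conjc (phase g w)).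
    by apply: eqC_disc_near dz => w dw; rewrite phaseJ.
  by rewrite -(is_dxC_val b) (is_dxC_val (is_dxC_near n0 (is_dxC_cst 1 z))).
by rewrite h0 h1 equiv0// equiv1_phase// (lift_form_inv _ _ (rho_herm g) (S1 dz) (f_neq0 dz) (phaseJ g dz) h2).
Qed.

Lemma form_invariant_y g z : disc z ->
  formy z = (- Im (dxC (act g) z))%:C * formx (act g z) + (Re (dxC (act g) z))%:C * formy (act g z).
Proof.
move=> dz; rewrite -lift_form_lin.
set w0 := _ + _ : V; set w1 := _ + _ : V.
have h0 : w0 = rho g *m vdy u0 z.
  apply: vec_eq => i; have a := is_dyC_deck_vec g i su0 dz.
  have b := is_dyC_mulmx (rho g) (fun i => is_dyC_vec su0 i dz) i.
  have n0 : nearC z (fun w => (rho g *m u0 w) i 0 = u0 (act g w) i 0).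
    by apply: eqC_disc_near dz => w dw; rewrite equiv0.
  by rewrite -(is_dyC_val (is_dyC_near n0 b)) (is_dyC_val a).
have dl := CkCS_dy (CkC_phase 1 g) dz.
have h1 : w1 = dyC (phase g) z *: (rho g *m u1 z) + phase g z *: (rho g *m vdy u1 z).
  apply: vec_eq => i; have a := is_dyC_deck_vec g i su1 dz.
  have b := is_dyCM dl (is_dyC_mulmx (rho g) (fun i => is_dyC_vec su1 i dz) i).
  have n0 : nearC z (fun w => phase g w * (rho g *m u1 w) i 0 = u1 (act g w) i 0).
    by apply: eqC_disc_near dz => w dw; rewrite equiv1_phase// [RHS]mxE.
  by rewrite -(is_dyC_val a) (is_dyC_val (is_dyC_near n0 b)) !mxE.
have h2 : dyC (phase g) z * conjc (phase g z) + phase g z * conjc (dyC (phase g) z) = 0.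
  have b := is_dyCM dl (is_dyCJ dl).
  have n0 : nearC z (fun w => 1 = phase g w * conjc (phase g w)).
    by apply: eqC_disc_near dz => w dw; rewrite phaseJ.
  by rewrite -(is_dyC_val b) (is_dyC_val (is_dyC_near n0 (is_dyC_cst 1 z))).
by rewrite h0 h1 equiv0// equiv1_phase// (lift_form_inv _ _ (rho_herm g) (S1 dz) (f_neq0 dz) (phaseJ g dz) h2).
Qed.

(** The factor [- 2^-1] is chosen so that the exterior derivative is exactly the difference of the
    two pullbacks, as [form_primitive] records. *)
Lemma form_invariant : invariant_form Sigma (fun z => - 2^-1 * Im (formx z)) (fun z => - 2^-1 * Im (formy z)).
Proof.
move=> g z dz; rewrite (form_invariant_x g dz) (form_invariant_y g dz).
move: (formx _) (formy _) (dxC (act g) z); clear=> a b h.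
by split; rewrite !reimE /=; ring.
Qed.

Lemma form_primitive z : disc z ->
  dx (fun w => - 2^-1 * Im (formy w)) z - dy (fun w => - 2^-1 * Im (formx w)) z =
  pullback_omega u1 z - pullback_omega u0 z.
Proof.
move=> dz; have [_ cx] := CkC_formx 1; have [_ cy] := CkC_formy 1.
rewrite (is_dx_val (is_dxM (is_dx_cst (- 2^-1) z) (CkS_dx cy dz))).
rewrite (is_dy_val (is_dyM (is_dy_cst (- 2^-1) z) (CkS_dy cx dz))).
have := form_exact_im dz.
have gen (a b c d e e' : R) : a - b = - 2 * (e - e') ->
    0 * c + - 2^-1 * a - (0 * d + - 2^-1 * b) = e - e' by move=> E; lra.
by move/gen; apply.
Qed.

End TwoLifts.

End Lifts.

(** * Convergence of the partition of unity to the Dirichlet polygon *)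

Section DirichletLimit.
Variables (R : realType) (Sigma : marked_surface R).
Local Notation C := R[i].
Local Notation act := (@deck R Sigma).
Local Notation G := (pi1 Sigma).
Local Notation leb := (@lebesgue_measure R).
Local Notation mu2 := (@lebesgue_measure R \x @lebesgue_measure R)%E.
Implicit Types (f : C -> R) (z w : C) (g h : G).

Lemma cont_continuous2 f : (forall z, cont_at f z) -> continuous (fun p : R * R => f (p.1 +i* p.2)).
Proof. by move=> cf [x y]; exact: (cf (x +i* y)). Qed.

Lemma measurable_le_cont f (c : R) : (forall z, cont_at f z) ->
  measurable [set p : R * R | f (p.1 +i* p.2) <= c].
Proof.
move=> /cont_continuous2/continuous_measurable2 mf.
have := mf measurableT _ (@measurable_itv _ `]-oo, c]).
rewrite setTI; congr measurable; apply/seteqP; split=> p /=; by rewrite in_itv.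
Qed.

Lemma measurable_ge_cont f (c : R) : (forall z, cont_at f z) ->
  measurable [set p : R * R | c <= f (p.1 +i* p.2)].
Proof.
move=> /cont_continuous2/continuous_measurable2 mf.
have := mf measurableT _ (@measurable_itv _ `[c, +oo[).
rewrite setTI; congr measurable; apply/seteqP; split=> p /=; by rewrite in_itv /= andbT.
Qed.

Lemma cont_mobD a b z : cont_at (fun w => sqmod (mobD a b w)) z.
Proof.
have -> : (fun w => sqmod (mobD a b w)) = (fun w : C =>
  (Re b * Re w + Im b * Im w + Re a) * (Re b * Re w + Im b * Im w + Re a) +
  (Re b * Im w - Im b * Re w - Im a) * (Re b * Im w - Im b * Re w - Im a)).
  by apply/funext => w; rewrite sqmodE /mobD !reimE; ring.
have c u := @cont_cst R u z; have x := @cont_Re R z; have y := @cont_Im R z.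
have h1 := contD (contD (contM (c (Re b)) x) (contM (c (Im b)) y)) (c (Re a)).
have h2 := contD (contD (contM (c (Re b)) y) (contN (contM (c (Im b)) x))) (contN (c (Im a))).
exact (contD (contM h1 h1) (contM h2 h2)).
Qed.

(* mobD a b is affine in z, so the bisectors are Euclidean circles. *)
Lemma deck_bisector g : exists a b : C, (g != 1%g -> b != 0) /\
  forall z, disc z -> (sqmod z <= sqmod (act g z)) = (1 <= sqmod (mobD a b z)) /\
                      (sqmod (act g z) == sqmod z) = (sqmod (mobD a b z) == 1).
Proof.
have [a [b [ab h]]] := deck_mob g; exists a, b; split.
  move=> g1; apply/eqP => b0; move/eqP: g1; apply.
  have d0 : disc (0 : C) by rewrite /disc /= /sqmod /= expr0n /= addr0 ltr01.
  apply: (deck_free d0); rewrite h// b0 /mob /mobN mulr0 addr0 mul0r//.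
move=> z dz; rewrite h//.
have ab0 : 0 < sqmod a - sqmod b by rewrite ab ltr01.
have D0 := mobD_gt0 ab0 dz; have E := mob_defect ab0 dz; rewrite ab mul1r in E.
have s0 : 0 < 1 - sqmod z by rewrite subr_gt0; exact: dz.
have E' : sqmod (mob a b z) = 1 - (1 - sqmod z) / sqmod (mobD a b z) by rewrite -E; ring.
have ez : sqmod z = 1 - (1 - sqmod z) by ring.
rewrite E'; move: s0 ez; move: (1 - sqmod z) => s s0 ->.
move: (sqmod (mobD a b z)) D0 => D D0; split.
  by rewrite lerD2l lerN2 ler_pdivrMr// ler_pMr.
apply/eqP/eqP => [e|->]; last by rewrite divr1.
have sD : s / D = s by lra.
have h1 : s * D = s by rewrite -{1}sD divfK ?gt_eqF.
by apply: (mulfI (lt0r_neq0 s0)); rewrite mulr1.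
Qed.

(** On each vertical line the equation is quadratic in y with leading coefficient [sqmod b], so
    every slice has at most two points, and Fubini concludes. *)
Lemma circle_null (a b : C) : b != 0 ->
  mu2 [set p : R * R | sqmod (mobD a b (p.1 +i* p.2)) = 1] = 0%E.
Proof.
move=> b0; set A := [set p | _].
have mA : measurable A.
  have h := measurableI _ _ (measurable_le_cont 1 (@cont_mobD a b)) (measurable_ge_cont 1 (@cont_mobD a b)).
  move: h; congr measurable; apply/seteqP; split=> p /=.
    by move=> [h1 h2]; apply/eqP; rewrite eq_le h1 h2.
  by rewrite /A /= => ->.
rewrite /= /product_measure1 (eq_integral (cst 0%E)) ?integral0// => x _ /=.
apply: countable_lebesgue_measure0; apply: finite_set_countable.
have [[y0 h0]|none] := pselect (exists y, xsection A x y); last first.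
  by apply: (sub_finite_set _ (finite_set0 R)) => y hy; apply: none; exists y.
pose al := sqmod b.
have al0 : al != 0 by rewrite sqmod_eq0.
pose be := 2 * (Im b * (Re b * x + Re a) - Re b * (Im b * x + Im a)).
have poly y : sqmod (mobD a b (x +i* y)) = al * y ^+ 2 + be * y +
    ((Re b * x + Re a) ^+ 2 + (Im b * x + Im a) ^+ 2).
  by rewrite /al /be !sqmodE /mobD !reimE /=; ring.
have inA y : xsection A x y -> sqmod (mobD a b (x +i* y)) = 1.
  by rewrite /xsection /= inE.
apply: (@sub_finite_set _ _ [set y0; - be / al - y0]); last exact: finite_set2.
move=> y /inA hy /=; have [->|ny] := eqVneq y y0; [by left|right].
have := hy; have := inA _ h0; rewrite !poly => e0 e1.
(* Both are roots of the same quadratic, so the second root is determined by the sum of the roots,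
   [- be / al]. *)
have e : (y - y0) * (al * (y + y0) + be) = 0.
  have -> : (y - y0) * (al * (y + y0) + be) = (al * y ^+ 2 + be * y) - (al * y0 ^+ 2 + be * y0) by ring.
  lra.
have {}e : al * (y + y0) + be = 0.
  by move/eqP: e; rewrite mulf_eq0 subr_eq0 (negPf ny) => /eqP.
apply: (mulfI al0).
have -> : al * (- be / al - y0) = - be - al * y0 by field.
by rewrite -[LHS](subr0) -[in LHS]e; ring.
Qed.

Lemma ae_no_tie g : g != 1%g ->
  {ae mu2, forall p : R * R, disc (p.1 +i* p.2) ->
     sqmod (act g (p.1 +i* p.2)) != sqmod (p.1 +i* p.2)}.
Proof.
move=> g1; have [a [b [b0 h]]] := deck_bisector g.
exists [set p : R * R | sqmod (mobD a b (p.1 +i* p.2)) = 1]; split.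
- have k := measurableI _ _ (measurable_le_cont 1 (@cont_mobD a b)) (measurable_ge_cont 1 (@cont_mobD a b)).
  move: k; congr measurable; apply/seteqP; split=> p /=.
    by move=> [h1 h2]; apply/eqP; rewrite eq_le h1 h2.
  by move=> ->.
- exact: circle_null (b0 g1).
- move=> p /= np; apply: contrapT => n1; apply: np => dp.
  by have [_ ->] := h _ dp; apply/eqP.
Qed.

Lemma ae_seq (s : seq G) (P : G -> R * R -> Prop) : (forall g, {ae mu2, forall p, P g p}) ->
  {ae mu2, forall p, forall g, g \in s -> P g p}.
Proof.
move=> h; elim: s => [|g s IH]; first by apply: aeW.
apply: (negligibleS _ (negligibleU (h g) IH)) => p /= np.
apply: contrapT => /not_orP[/contrapT h1 /contrapT h2]; apply: np => k.
by rewrite inE => /predU1P[->//|]; exact: h2.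
Qed.

Lemma cvg_sum_seq (T : eqType) (s : seq T) (F : T -> nat -> R) (l : T -> R) :
  (forall i, i \in s -> F i n @[n --> \oo] --> l i) ->
  (\sum_(i <- s) F i n) @[n --> \oo] --> \sum_(i <- s) l i.
Proof.
elim: s => [|i s IH] h.
  by rewrite big_nil; under eq_fun do rewrite big_nil; exact: cvg_cst.
rewrite big_cons; under eq_fun do rewrite big_cons.
apply: cvgD; first by apply: h; rewrite inE eqxx.
by apply: IH => j js; apply: h; rewrite inE js orbT.
Qed.

Lemma cvg_expr3 (x : R) : 0 <= x < 1 -> x ^+ n.+3 @[n --> \oo] --> (0 : R).
Proof.
move=> /andP[x0 x1].
have h : (fun n => x ^+ 3 * x ^+ n) @ \oo --> x ^+ 3 * 0.
  by apply: cvgM; [exact: cvg_cst|apply: cvg_expr; rewrite ger0_norm].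
rewrite mulr0 in h.
by have -> : (fun n => x ^+ n.+3) = (fun n => x ^+ 3 * x ^+ n)
  by apply/funext => n; rewrite -exprD.
Qed.

Section Limit.
Variables (r0 : R).
Hypotheses (r0_lt1 : r0 < 1)
  (r0_cover : forall z, disc z -> exists g, sqmod (act g z) <= r0).
Let r1 := rad r0.
Let r1_lt1 : r1 < 1 := rad_lt1 r0_lt1.
Local Notation chi := (@chi R Sigma r0).
Let Dp : set (R * R) := [set p | dirichlet Sigma (p.1 +i* p.2)].

Lemma dirichlet_le z : dirichlet Sigma z -> sqmod z <= r0.
Proof. by move=> [dz h]; have [g gz] := r0_cover dz; exact: le_trans (h g) gz. Qed.

(** The polygon lies in [sqmod z <= r0], and there an element outside [close r0] increases the
    modulus automatically. Finitely many inequalities remain, each of them a closed condition by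
    [deck_bisector]. *)
Lemma measurable_dirichlet : measurable Dp.
Proof.
pose K := [set p : R * R | sqmod (p.1 +i* p.2) <= r0].
have mK : measurable K by exact: measurable_le_cont (@cont_sqmod R).
pose S g := K `&` [set p : R * R | sqmod (p.1 +i* p.2) <= sqmod (act g (p.1 +i* p.2))].
have mS g : measurable (S g).
  have [a [b [_ h]]] := deck_bisector g.
  have -> : S g = K `&` [set p : R * R | 1 <= sqmod (mobD a b (p.1 +i* p.2))].
    apply/seteqP; split=> p /= [hK hp]; split=> //.
      by have [e _] := h (p.1 +i* p.2) (le_lt_trans hK r0_lt1); rewrite /= -e.
    by have [e _] := h (p.1 +i* p.2) (le_lt_trans hK r0_lt1); rewrite /= e.
  by apply: measurableI => //; exact: measurable_ge_cont (@cont_mobD a b).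
have -> : Dp = K `&` \bigcap_(g in @close R Sigma r0) S g.
  apply/seteqP; split=> p /=.
    move=> h; have hK := dirichlet_le h; split=> // g _; split=> //.
    by have [_ /(_ g)] := h.
  move=> [hK hS]; have dz : disc (p.1 +i* p.2) by exact: le_lt_trans hK r0_lt1.
  split=> // g; have [gz|gz] := leP (sqmod (act g (p.1 +i* p.2))) r0.
    by have [_] := hS g (ex_intro _ _ (conj hK gz)).
  by apply: le_trans (ltW gz).
apply: measurableI => //; apply: fin_bigcap_measurable => //.
exact: deck_proper r0_lt1.
Qed.

Lemma one_closes z : disc z -> sqmod z <= r1 -> 1%g \in closes Sigma r1.
Proof. by move=> dz zr; rewrite mem_closes//; apply/asboolP; exists z; rewrite deck1. Qed.

Lemma chi_bounds n z : disc z -> 0 <= chi n z <= 1.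
Proof.
move=> dz; have [zr|zr] := leP (sqmod z) r1; last by rewrite chi_eq0 ?(ltW zr)// lexx ler01.
have S0 : 0 < bumpsum Sigma r0 n z := bumpsum_gt0 r0_lt1 r0_cover n dz.
have b0 : 0 <= bump r0 z ^+ n.+3 by rewrite exprn_ge0// bump_ge0.
apply/andP; split; first by rewrite divr_ge0// ltW.
rewrite ler_pdivrMr// mul1r (@bumpsum_close R Sigma r0 n r1 z r1_lt1 (lexx _) zr).
rewrite (big_rem 1%g) ?(one_closes dz zr)//= deck1// lerDl.
by apply: sumr_ge0 => h _; rewrite exprn_ge0// bump_ge0.
Qed.

Lemma chi_ratio n z : disc z -> sqmod z < r1 ->
  chi n z = (\sum_(g <- closes Sigma r1) (bump r0 (act g z) / bump r0 z) ^+ n.+3)^-1.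
Proof.
move=> dz zr; have b0 : 0 < bump r0 z by exact: bump_gt0.
have -> : chi n z = bump r0 z ^+ n.+3 / bumpsum Sigma r0 n z by [].
rewrite (@bumpsum_close R Sigma r0 n r1 z r1_lt1 (lexx _) (ltW zr)).
have bn0 : bump r0 z ^+ n.+3 != 0 by rewrite expf_neq0// gt_eqF.
under [in RHS]eq_bigr do rewrite expr_div_n.
by rewrite -mulr_suml invfM invrK mulrC.
Qed.

(** Everything is read off the ratios of bump values on the orbit. Inside the polygon, without ties,
    all ratios but that of the identity are less than 1 and their powers die out. Outside it some
    translate has a larger bump and forces [chi] to 0. *)
Lemma cvg_chi z : disc z ->
  (forall g, g \in closes Sigma r1 -> g != 1%g -> sqmod (act g z) != sqmod z) ->
  chi n z @[n --> \oo] --> (if `[< dirichlet Sigma z >] then 1 else 0 : R).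
Proof.
move=> dz notie; have [zr|zr] := leP r1 (sqmod z).
  have -> : `[< dirichlet Sigma z >] = false.
    apply/asboolP => /dirichlet_le h; have := lt_rad r0_lt1; rewrite -/r1; lra.
  by under eq_fun do rewrite chi_eq0//; exact: cvg_cst.
have b0 : 0 < bump r0 z by exact: bump_gt0.
have in1 := one_closes dz (ltW zr).
have bumpE : bump r0 z = r1 - sqmod z by rewrite /bump max_r// subr_ge0 ltW.
case: asboolP => [[_ hD]|nD].
  have S : (\sum_(g <- closes Sigma r1) (bump r0 (act g z) / bump r0 z) ^+ n.+3)
      @[n --> \oo] --> (\sum_(g <- closes Sigma r1) (if g == 1%g then 1 else 0) : R).
    apply: cvg_sum_seq => g gs; case: eqVneq => [->|g1].
      under eq_fun do rewrite deck1// divff ?gt_eqF// expr1n; exact: cvg_cst.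
    apply: cvg_expr3; rewrite divr_ge0 ?bump_ge0//= ltr_pdivrMr// mul1r.
    rewrite bumpE /bump gt_max subr_gt0 zr/= ltrD2l ltrN2 lt_neqAle hD andbT.
    by rewrite eq_sym; exact: notie.
  have e1 : \sum_(g <- closes Sigma r1) (if g == 1%g then 1 else 0) = 1 :> R.
    rewrite (big_rem 1%g)//= eqxx big1_seq ?addr0// => g /andP[_].
    by rewrite mem_rem_uniq ?finmap.fset_uniq// inE => /andP[/negPf ->].
  rewrite e1 in S.
  have V := cvgV (oner_neq0 R) S; rewrite invr1 in V.
  have -> : (fun n => chi n z) = (fun n => (\sum_(g <- closes Sigma r1) (bump r0 (act g z) / bump r0 z) ^+ n.+3)^-1).
    by apply/funext => n; rewrite chi_ratio.
  exact: V.
have [g hg] : exists g, sqmod (act g z) < sqmod z.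
  apply: contrapT => h; apply: nD; split=> // g; rewrite leNgt; apply/negP => k.
  by apply: h; exists g.
have gs : g \in closes Sigma r1.
  by rewrite mem_closes//; apply/asboolP; exists z; split; apply: ltW => //; exact: lt_trans hg zr.
have bg : bump r0 z < bump r0 (act g z).
  by rewrite bumpE /bump lt_max ltrD2l ltrN2 hg orbT.
have bg0 : 0 < bump r0 (act g z) := lt_trans b0 bg.
(* Keeping only the term of [g] in the denominator bounds [chi] by a power of a ratio less than
   1. *)
apply: (@squeeze_cvgr _ _ _ _ (cst 0) (fun n => (bump r0 z / bump r0 (act g z)) ^+ n.+3)).
- apply: nearW => n; have /andP[-> _] /= := chi_bounds n dz.
  rewrite expr_div_n; apply: ler_pM => //.
  + by rewrite exprn_ge0// bump_ge0.
  + by rewrite invr_ge0; apply: ltW; exact: bumpsum_gt0.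
  + have S0 : 0 < bumpsum Sigma r0 n z by exact: bumpsum_gt0.
    rewrite lef_pV2 ?posrE ?exprn_gt0//.
    rewrite (@bumpsum_close R Sigma r0 n r1 z r1_lt1 (lexx _) (ltW zr)).
    rewrite (big_rem g)//= lerDl.
    by apply: sumr_ge0 => h _; rewrite exprn_ge0// bump_ge0.
- exact: cvg_cst.
- by apply: cvg_expr3; rewrite divr_ge0 ?(ltW b0) ?(ltW bg0)//= ltr_pdivrMr// mul1r.
Qed.

Variable F : C -> R.
Hypothesis cF : Ck 0 F.
Hypothesis F0 : forall n, II (fun z => chi n z * F z) = 0.

(* chi n * F = chi n * cut * F, and the bounded function cut * F dominates. *)
Let delta := rad r1 - r1.
Let delta_gt0 : 0 < delta. Proof. by rewrite subr_gt0; exact: lt_rad. Qed.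
Let cut z := bump r1 z / Num.max delta (bump r1 z).
Let cutF z := cut z * F z.

(** On this disc [bump r1 z] is at least [delta], so the maximum in the denominator is the bump
    itself; elsewhere the maximum keeps the denominator positive and [cut] continuous. *)
Lemma cut_eq1 z : sqmod z <= r1 -> cut z = 1.
Proof.
move=> zr; have h : delta <= bump r1 z by rewrite /bump le_max lerD2l lerN2 zr orbT.
by rewrite /cut max_r// divff// gt_eqF// (lt_le_trans delta_gt0).
Qed.

Lemma cut_supp : csupp (rad r1) cutF.
Proof. by move=> z _ h; rewrite /cutF /cut bump_eq0 ?(ltW h)// !mul0r. Qed.

Lemma cont_cutF z : disc z -> cont_at cutF z.
Proof.
move=> dz; have cb := @cont_bump R r1 z; apply: contM (Ck_cont cF dz).
apply: (contM cb); apply: contV; first by rewrite gt_eqF// lt_max delta_gt0.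
by case: z cb {dz} => x y cb; apply: continuous_max; [exact: cst_continuous|exact: cb].
Qed.

(** Dominated convergence on the plane: the integrals against [chi n] are all 0, and the limit
    integrand is [F] times the indicator of the polygon. *)
Lemma surface_integral_eq0 : surface_integral Sigma F = 0.
Proof.
have r2_lt1 : rad r1 < 1 := rad_lt1 r1_lt1.
have [M M0 hM] := ext_bounded r2_lt1 cut_supp cont_cutF.
pose chiF n z := chi n z * F z.
have cchi n : Ck_csupp 0 r1 (chiF n).
  split; last by move=> z _ h; rewrite /chiF chi_eq0 ?mul0r// ltW.
  exact (CkM (Ck_le (isT : (0 <= 2)%N) (Ck_chi r0_lt1 r0_cover n)) cF).
have chiE n p : ext (chiF n) p = (if sqmod (p.1 +i* p.2) < 1 then chi n (p.1 +i* p.2) else 0) * ext cutF p.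
  rewrite /ext; case: ifP => dp; last by rewrite mul0r.
  rewrite /chiF /cutF; have [zr|zr] := leP (sqmod (p.1 +i* p.2)) r1.
    by rewrite cut_eq1// mul1r.
  by rewrite chi_eq0 ?(ltW zr)// !mul0r.
have cont_chi n z : disc z -> cont_at (chiF n) z by move=> dz; exact (Ck_cont (cchi n).1 dz).
have int_chi n := ext_integrable r1_lt1 (cchi n).2 (cont_chi n).
pose fl p := ext cutF p * \1_Dp p.
have mfl : measurable_fun setT (EFin \o fl).
  apply/measurable_EFinP; apply: measurable_funM.
    exact: continuous_measurable2 (ext_continuous r2_lt1 cut_supp cont_cutF).
  exact: measurable_indic measurable_dirichlet.
have mchi n : measurable_fun setT (EFin \o ext (chiF n)).
  apply/measurable_EFinP.
  exact: continuous_measurable2 (ext_continuous r1_lt1 (cchi n).2 (cont_chi n)).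
have cv : {ae mu2, forall p, setT p -> (EFin \o ext (chiF n)) p @[n --> \oo] --> (EFin \o fl) p}.
  (* [cvg_chi] asks for the absence of ties only over the list [closes Sigma r1], so the exceptional
     set is a finite union of null circles. The identity, which always ties, is exempted. *)
  pose P g (p : R * R) := g != 1%g -> disc (p.1 +i* p.2) ->
     sqmod (act g (p.1 +i* p.2)) != sqmod (p.1 +i* p.2).
  have aeP g : {ae mu2, forall p, P g p}.
    have [->|g1] := eqVneq g 1%g; first by apply: aeW => p; rewrite /P eqxx.
    by apply: (negligibleS _ (ae_no_tie g1)) => p /= np hp; apply: np => _.
  apply: (negligibleS _ (ae_seq (closes Sigma r1) aeP)) => p /= np hp; apply: np => _.
  apply: cvg_EFin; first exact: nearW.
  rewrite /comp /fl /=; under eq_fun do rewrite chiE.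
  rewrite mulrC; apply: cvgM; last exact: cvg_cst.
  have [dp|dp] := boolP (sqmod (p.1 +i* p.2) < 1); last first.
    rewrite indicE memNset; first exact: cvg_cst.
    by move=> [d _]; move: d; rewrite /disc /= (negbTE dp).
  rewrite indicE; have -> : ((p \in Dp)%:R : R) = if `[< dirichlet Sigma (p.1 +i* p.2) >] then 1 else 0.
    by case: asboolP => h; [rewrite mem_set|rewrite memNset].
  by apply: cvg_chi => // g gs g1; exact: hp.
pose G (p : R * R) : R := M * \1_(@box R) p.
have dom : {ae mu2, forall p n, setT p -> (`|(EFin \o ext (chiF n)) p| <= (EFin \o G) p)%E}.
  apply: aeW => p n _ /=; rewrite lee_fin; apply: le_trans (le_box hM p).
  rewrite chiE normrM; apply: ler_piMl => //; case: ifP => dp; last by rewrite normr0.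
  by have /andP[a b] := chi_bounds n dp; rewrite ger0_norm.
have iG : mu2.-integrable setT (EFin \o G) := box_integrable M.
have lim : (\int[mu2]_p (EFin \o ext (chiF n)) p @[n --> \oo] --> \int[mu2]_p (EFin \o fl) p)%E.
  have [|||||_ _ //] := @dominated_convergence _ _ R mu2 setT measurableT (fun n => EFin \o ext (chiF n)) (EFin \o fl) (EFin \o G).
  - exact: mchi.
  - exact: mfl.
  - exact: cv.
  - exact: iG.
  - exact: dom.
have int0 n : (\int[mu2]_p (EFin \o ext (chiF n)) p = 0)%E.
  (* [Rintegral] takes [fine] of the extended integral, and [fine] sends infinite values to 0 as
     well; finiteness is what lets [F0] determine the extended integral. *)
  have fn : (\int[mu2]_p (EFin \o ext (chiF n)) p)%E \is a fin_num by exact: integrable_fin_num (int_chi n).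
  by have := F0 n; rewrite /II /Rintegral => e; rewrite -(fineK fn) /= -[X in X%:E]/(fine _) e.
have fl0 : (\int[mu2]_p (EFin \o fl) p = 0)%E.
  move: lim; under eq_fun do rewrite int0.
  by move=> /(cvg_unique _ (cvg_cst _)) <-.
rewrite /surface_integral Rintegral_mkcond /Rintegral -[RHS]/(fine 0%E) -fl0.
congr (fine (integral _ setT _)); apply/funext => p /=; congr EFin.
rewrite /fl patchE indicE; case: ifPn => pD; last by rewrite mulr0.
have hz : sqmod (p.1 +i* p.2) <= r0 by move: pD; rewrite inE; exact: dirichlet_le.
rewrite mulr1 /ext (le_lt_trans hz r0_lt1) /cutF cut_eq1 ?mul1r//.
by apply: le_trans hz _; apply: ltW; exact: lt_rad.
Qed.

End Limit.
End DirichletLimit.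

(** * The Lagrangian lift given by the frame *)

Section FrameLift.
Variable R : realType.
Local Notation C := R[i].
Local Notation I := (0 +i* 1).
Local Notation V := 'cV[C]_3.

Lemma dxC_wirtinger (Q : C -> C) z : dxC Q z = dz Q z + dzbar Q z.
Proof. by rewrite /dz /dzbar; field. Qed.

Lemma dyC_wirtinger (Q : C -> C) z : dyC Q z = I * (dz Q z - dzbar Q z).
Proof.
have sqrI : I * I = -1 :> C by apply: complex_ext; rewrite !reimE /=; ring.
rewrite /dz /dzbar; transitivity (- (I * I) * dyC Q z); last by field.
by rewrite sqrI opprK mul1r.
Qed.

Variables (s : C -> R) (Q : C -> C) (F : C -> 'M[C]_3).
Hypothesis frameF : frame s Q F.

Definition frame_lift z : V := col ord_max (F z).

Lemma frame_lift_smooth : smoothM frame_lift.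
Proof.
have [sF _ _ _] := frameF => i j.
have -> : (fun z => frame_lift z i j) = (fun z => F z i ord_max).
  by apply/funext => z; rewrite mxE.
exact: (sF i ord_max).
Qed.

Lemma frame_lift_Sminus z : disc z -> herm (frame_lift z) (frame_lift z) = -1.
Proof.
move=> dz; have [_ /(_ z dz)[hF _] _ _] := frameF.
rewrite /frame_lift colE hF /herm !mxE /=.
by apply: complex_ext; rewrite !reimE /=; ring.
Qed.

Lemma frame_dz z : disc z -> mxderiv (@dz R) F z = F z *m A_mx s Q z.
Proof.
move=> dz; have [_ /(_ z dz)[_ detF] hA _] := frameF.
by rewrite -hA// mulKVmx// unitmxE detF unitr1.
Qed.

Lemma frame_dzbar z : disc z -> mxderiv (@dzbar R) F z = F z *m B_mx s Q z.
Proof.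
move=> dz; have [_ /(_ z dz)[_ detF] _ hB] := frameF.
by rewrite -hB// mulKVmx// unitmxE detF unitr1.
Qed.

(** The structure equations give dF/dx = F (A + B), since d/dx is the sum of the two Wirtinger
    operators; the lift sees only the last columns. *)
Lemma vdx_frame_lift z : disc z ->
  vdx frame_lift z = F z *m col ord_max (A_mx s Q z + B_mx s Q z).
Proof.
move=> dz; rewrite colE mulmxA mulmxDr -frame_dz// -frame_dzbar// -colE.
apply/matrixP => i j; rewrite !mxE -dxC_wirtinger.
by congr (dxC _ z); apply/funext => w; rewrite mxE.
Qed.

Lemma vdy_frame_lift z : disc z ->
  vdy frame_lift z = F z *m (I *: col ord_max (A_mx s Q z - B_mx s Q z)).
Proof.
move=> dz; rewrite -scalemxAr colE mulmxA mulmxBr -frame_dz// -frame_dzbar// -colE.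
apply/matrixP => i j; rewrite !mxE -dyC_wirtinger.
by congr (dyC _ z); apply/funext => w; rewrite mxE.
Qed.

(* The last columns of A and B are s e1 and s e2, which are <,>-orthogonal of
   equal length, so the lift is Lagrangian. *)
Lemma frame_lift_lagrangian z : disc z -> pullback_omega frame_lift z = 0.
Proof.
move=> dz; rewrite (pullback_omegaE frame_lift_smooth frame_lift_Sminus dz).
have [_ /(_ z dz)[hF _] _ _] := frameF.
rewrite vdx_frame_lift// vdy_frame_lift// hF /herm !mxE /=.
by ring.
Qed.

End FrameLift.

(** * Comparison of an arbitrary equivariant map with the Lagrangian one *)

Section Vanishing.
Variables (R : realType) (Sigma : marked_surface R).
Local Notation C := R[i].
Local Notation act := (@deck R Sigma).
Local Notation V := 'cV[C]_3.

(** The last diagonal entry of [c_mx] is 1, so the last column of the frame is equivariant as a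
    vector and not merely up to a phase. *)
Lemma c_mx_ord_max (g : pi1 Sigma) z :
  invmx (c_mx g z) *m delta_mx ord_max 0 = delta_mx ord_max 0 :> V.
Proof.
have ce : c_mx g z *m delta_mx ord_max 0 = delta_mx ord_max 0 :> V.
  apply/matrixP => i j; rewrite mul_diag_mx !mxE.
  by have [->|] := eqVneq i ord_max; rewrite /= ?mul1r// mulr0.
(* [invmx] returns a singular matrix unchanged, in which case [ce] applies directly. *)
have [cU|cU] := boolP (c_mx g z \in unitmx); last by rewrite invmx_out.
by rewrite -{1}ce mulKmx.
Qed.

Variables (rho : pi1 Sigma -> 'M[C]_3) (rho_rep : representation rho).
Variables (u0 : C -> V) (su0 : smoothM u0).
Hypothesis S0 : forall z, disc z -> herm (u0 z) (u0 z) = -1.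
Hypothesis equiv0 : forall g z, disc z -> u0 (act g z) = rho g *m u0 z.

Lemma equivariant_proj : equivariant rho (fun z => Defs.proj (u0 z)).
Proof.
move=> g z dz; rewrite equiv0//; apply/seteqP; split=> v.
  by move=> [c c0 ->]; exists (c *: u0 z); [exists c|rewrite -scalemxAr].
by move=> [_ [c c0 ->] <-]; exists c => //; rewrite -scalemxAr.
Qed.

Lemma equivariant_lift phi u1 : smooth_lift phi u1 -> equivariant rho phi ->
  forall g z, disc z -> exists l : C, u1 (act g z) = l *: (rho g *m u1 z).
Proof.
move=> [_ hu] ephi g z dz; have [_ e1] := hu _ (deck_disc g dz).
have : Defs.proj (u1 (act g z)) (u1 (act g z)) by exists 1; rewrite ?oner_neq0 ?scale1r.
rewrite -e1 ephi// => -[v]; have [_ ->] := hu _ dz.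
by move=> [c c0 ->] <-; exists c; rewrite -scalemxAr.
Qed.

(** As the pullback by [u0] vanishes, [form_primitive] exhibits the pullback by [u1] as the exterior
    derivative of an invariant form; [II_chi_exact] then supplies the hypothesis of
    [surface_integral_eq0] for every exponent. *)
Lemma surface_integral_pullback_eq0 phi u1 :
  (forall z, disc z -> pullback_omega u0 z = 0) ->
  smooth_lift phi u1 -> equivariant rho phi ->
  surface_integral Sigma (pullback_omega u1) = 0.
Proof.
move=> lag0 lift1 ephi; have equiv1 := equivariant_lift lift1 ephi.
have [su1 hu1] := lift1.
have S1 z : disc z -> herm (u1 z) (u1 z) = -1 by move=> /hu1[].
have rho_herm g u v : herm (rho g *m u) (rho g *m v) = herm u v.
  by have [h _] := rho_rep; have [] := h g.
have [r0 r0_lt1 r0_cover] := deck_cocompact Sigma.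
pose p z := - 2^-1 * Im (formx u0 u1 z); pose q z := - 2^-1 * Im (formy u0 u1 z).
have cp n : Ck n p := CkM (Ck_cst n (- 2^-1)) (CkC_formx su0 su1 S0 S1 n).2.
have cq n : Ck n q := CkM (Ck_cst n (- 2^-1)) (CkC_formy su0 su1 S0 S1 n).2.
have inv : invariant_form Sigma p q := form_invariant su0 su1 S0 S1 rho_herm equiv0 equiv1.
have prim z : disc z -> dx q z - dy p z = pullback_omega u1 z.
  by move=> dz; rewrite (form_primitive su0 su1 S0 S1 dz) lag0// subr0.
apply: (surface_integral_eq0 r0_lt1 r0_cover).
  exact (Ck_eq prim (CkB (Ck_dx (cq 1%N)) (Ck_dy (cp 1%N)))).
move=> n; rewrite -(II_chi_exact r0_lt1 r0_cover n (cp 1%N) (cq 1%N) inv).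
by apply: eq_II => z dz; rewrite -prim.
Qed.

End Vanishing.

Local Open Scope ring_scope.

Theorem proposition9p1 (R : realType) (c : R) (c_neq0 : c != 0)
    (Sigma : marked_surface R) (Q : R[i] -> R[i])
    (hQ : cubic_differential Sigma Q) (hU : max_normU2 Q < 1 / 54%:R)
    (rho : pi1 Sigma -> 'M[R[i]]_3) (hrho : produced_from Q rho) :
  toledo_invariant c rho 0.
Proof.
have [rep [u [F [_ frF eqF]]]] := hrho.
have equiv0 g z : disc z ->
    frame_lift F (deck g z) = rho g *m frame_lift F z.
  move=> dz; rewrite /frame_lift eqF// !colE -mulmxA c_mx_ord_max.
  by rewrite mulmxA.
have S0 := frame_lift_Sminus frF; have su0 := frame_lift_smooth frF.
split.
  (* The map carried by the frame is itself a smooth equivariant map, which settles existence. *)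
  exists (fun z => Defs.proj (frame_lift F z)), (frame_lift F); split.
    by split=> // z dz; split=> //; exact: S0.
  exact: equivariant_proj.
(* An arbitrary equivariant map is compared with the Lagrangian one, so independence of the map and
   the value 0 are obtained together. *)
move=> phi u1 lift1 ephi.
rewrite (surface_integral_pullback_eq0 rep su0 S0 equiv0 _ lift1 ephi) ?mulr0//.
exact: frame_lift_lagrangian frF.
Qed.
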